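(* Let $T$ be a Pisot automorphism of $\mathbb{T}^m$ given by $M\in GL(m,\mathbb{Z})$, whose associated Pisot unit $\beta$ is weakly finitary. For every homoclinic point $\mathbf{t}\in\mathcal{H}(T)$ there exists $\mathbf{n}\in\mathbb{Z}^m$ such that $$\#\varphi_{\mathbf{t}}^{-1}(x)=|f_M(\mathbf{n})|$$ for Haar-almost every $x\in\mathbb{T}^m$. Consequently, the minimum, over arithmetic codings $\varphi_{\mathbf{t}}$ of $T$ with $\mathbf{t}\in\mathcal H(T)\setminus\{\mathbf 0\}$, of the a.e. number of preimages equals the arithmetic minimum $\min\{|f_M(\mathbf{n})|:\mathbf{n}\in\mathbb{Z}^m\setminus\{\mathbf 0\}\}$ of the associated form $f_M$.
   Context: A Pisot number is a real algebraic integer $\beta>1$ all of whose other Galois conjugates have modulus less than 1. A Pisot automorphism $T$ of $\mathbb{T}^m=\mathbb{R}^m/\mathbb{Z}^m$ is $x\mapsto Mx \bmod \mathbb{Z}^m$ with $M\in GL(m,\mathbb{Z})$ whose characteristic polynomial is irreducible over $\mathbb{Q}$ and has a Pisot number $\beta$ as a root; $\beta$ is then a unit. Write this polynomial as $x^m-k_1x^{m-1}-\cdots-k_m$. The form associated with $T$: for $\mathbf{n}\in\mathbb{Z}^m$ let $B_M(\mathbf{n})$ be the $m\times m$ integer matrix with columns $$M\mathbf{n},\ (M^2-k_1M)\mathbf{n},\ (M^3-k_1M^2-k_2M)\mathbf{n},\ \dots,\ (M^{m-1}-k_1M^{m-2}-\cdots-k_{m-2}M)\mathbf{n},\ k_m\mathbf{n},$$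 and $f_M(\mathbf{n})=\det B_M(\mathbf{n})$. $\mathbf{t}\in\mathbb{T}^m$ is homoclinic for $T$ if $T^n\mathbf{t}\to\mathbf{0}$ as $n\to\pm\infty$; these points form the group $\mathcal H(T)$. For $\mathbf{t}\in\mathcal{H}(T)$, the arithmetic coding of $T$ parametrised by $\mathbf{t}$ is $\varphi_{\mathbf{t}}:X_\beta\to\mathbb{T}^m$, $\varphi_{\mathbf{t}}(\bar\varepsilon)=\sum_{k\in\mathbb{Z}}\varepsilon_kT^{-k}\mathbf{t}$. $\beta$-expansions and the $\beta$-compactum. For $x\in[0,1)$ the $\beta$-expansion $x=\sum_{k\ge1}\varepsilon_k\beta^{-k}$ is the greedy one: $\varepsilon_k=[\beta\tau^{k-1}(x)]$, where $\tau(x)=\beta x \bmod 1$. For $x\ge 1$ it is extended as for decimal expansions (expand $\beta^{-n}x\in[0,1)$ and shift). $Fin(\beta)$ is the set of $x\ge0$ whose $\beta$-expansion is finite. Let $d'_1=[\beta]$, $d'_n=[\beta\tau^{n-1}(1)]$ ($n\ge 2$), with $\tau(1)=\beta-[\beta]$. If $(d'_n)$ has infinitely many nonzero terms put $d_n=d'_n$; otherwise, with $k=\max\{j:d'_j>0\}$, let $(d_n)_{n\ge1}$ be the purely periodic sequence with period $(d'_1,\dots,d'_{k-1},d'_k-1)$. With $\prec$ the strict lexicographic order, $$X_\beta=\{(\varepsilon_n)_{n\in\mathbb{Z}}:\varepsilon_n\in\{0,1,\dots,[\beta]\},\ (\varepsilon_n,\varepsilon_{n+1},\dots)\prec(d_1,d_2,\dots)\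 \text{for all } n\in\mathbb{Z}\}.$$ A Pisot unit $\beta$ is weakly finitary if for every $\delta>0$ and every $x\in\mathbb{Z}[\beta]\cap[0,\infty)$ there exists $f\in Fin(\beta)\cap[0,\delta)$ such that $x+f\in Fin(\beta)$. *)

(* Defs.v *)
From HB Require Import structures.
From mathcomp Require Import all_boot all_order all_algebra.
From mathcomp Require Import generic_quotient ring_quotient.
From mathcomp Require Import all_classical all_reals all_analysis.
From mathcomp Require Import complex.
Set Implicit Arguments.
Unset Strict Implicit.
Unset Printing Implicit Defensive.
Import Order.TTheory GRing.Theory Num.Theory.
Import numFieldNormedType.Exports.
Local Open Scope classical_set_scope.
Local Open Scope ring_scope.
Local Open Scope complex_scope.
Local Open Scope quotient_scope.

Definition galois_conjugates (R : realType) (x z : R[i]) : Prop :=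
  exists p : {poly rat}, [/\ irreducible_poly p,
    root (map_poly ratr p) x & root (map_poly ratr p) z].

Definition pisot (R : realType) (beta : R) : Prop :=
  [/\ 1 < beta, integralOver (intr : int -> R) beta &
      forall z : R[i], galois_conjugates beta%:C z -> z <> beta%:C -> `|z| < 1].

Definition pisot_automorphism (R : realType) (m : nat) (M : 'M[int]_m)
    (beta : R) : Prop :=
  [/\ M \in unitmx,
      irreducible_poly (map_poly intr (char_poly M) : {poly rat}),
      pisot beta & root (map_poly intr (char_poly M)) beta].

(* k_i, the characteristic polynomial being x^m - k_1 x^(m-1) - ... - k_m. *)
Definition char_coef (m : nat) (M : 'M[int]_m) (i : nat) : int :=
  - (char_poly M)`_(m - i).

(* Columns are indexed from 0: column [j < m.-1] is
   (M^(j+1) - k_1 M^j - ... - k_j M) n, and column [m.-1] is k_m n. *)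
Definition assoc_mx (m : nat) (M : 'M[int]_m) (n : 'cV[int]_m) : 'M[int]_m :=
  \matrix_(i < m, j < m)
    (if j.+1 == m then char_coef M m *: n
     else (M ^+ j.+1
       - \sum_(1 <= l < j.+1) char_coef M l *: M ^+ (j.+1 - l)) *m n) i 0.

Definition assoc_form (m : nat) (M : 'M[int]_m) (n : 'cV[int]_m) : int :=
  \det (assoc_mx M n).

Section BetaExpansions.
Variables (R : realType) (beta : R).

Definition beta_shift (x : R) : R := beta * x - (Num.floor (beta * x))%:~R.

(* Digits are indexed from 0: [beta_digit x k] is the digit of beta^-(k+1) in
   the greedy expansion of x in [0, 1). For x = 1 these are the d'_(k+1). *)
Definition beta_digit (x : R) (k : nat) : nat :=
  Num.truncn (beta * iter k beta_shift x).

(* Dividing by a power of beta shifts the expansion, so the choice of n is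
   immaterial. *)
Definition Fin : set R :=
  [set x | 0 <= x /\ exists n : nat, x / beta ^+ n < 1 /\
    \forall k \near \oo, beta_digit (x / beta ^+ n) k = 0%N].

Definition weakly_finitary : Prop :=
  forall delta : R, 0 < delta -> forall p : {poly int},
    let x := (map_poly intr p).[beta] in
    0 <= x -> exists f : R, [/\ Fin f, f < delta & Fin (x + f)].

(* The sequence d, with [quasi_greedy n] its (n+1)-th term. *)
Definition quasi_greedy (n : nat) : nat :=
  let d' := beta_digit 1 in
  if `[< \forall k \near \oo, d' k = 0%N >] then
    let k := xget 0%N [set k | d' k <> 0%N /\
                               forall j : nat, (k < j)%N -> d' j = 0%N] in
    if (n %% k.+1)%N == k then (d' k).-1 else d' (n %% k.+1)%N
  else d' n.

Definition lex_lt (u v : nat -> nat) : Prop :=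
  exists k : nat, (forall i : nat, (i < k)%N -> u i = v i) /\ (u k < v k)%N.

Definition beta_compactum : set (int -> nat) :=
  [set e | (forall n : int, (e n <= Num.truncn beta)%N) /\
           forall n : int, lex_lt (fun i : nat => e (n + i%:Z)) quasi_greedy].

End BetaExpansions.

Section Torus.
Variables (R : realType) (m : nat).

Definition int_lattice : {pred 'cV[R]_m} := fun x => x \is a mxOver Num.int.

Fact int_lattice_zmod_closed : zmod_closed int_lattice.
Proof.
split=> [|x y /mxOverP xZ /mxOverP yZ]; apply/mxOverP => i j; rewrite !mxE.
  exact: rpred0.
exact: rpredB.
Qed.
HB.instance Definition _ :=
  GRing.isZmodClosed.Build 'cV[R]_m int_lattice int_lattice_zmod_closed.

(* The quotient of R^m by Z^m, with its quotient topology and group structure and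
   its Borel sigma-algebra. *)
Definition torus : Type := quotient_topology (Quotient.quot int_lattice).

HB.instance Definition _ := PointedTopological.on torus.
HB.instance Definition _ := Quotient.on torus.
HB.instance Definition _ := GRing.Zmodule.copy torus (Quotient.quot int_lattice).
HB.instance Definition _ :=
  Measurable.copy torus (g_sigma_algebraType (@open torus)).

End Torus.

Definition tuple_cons (R : realType) (p : nat)
    (x : measurableTypeR R * p.-tuple (measurableTypeR R)) :
  p.+1.-tuple (measurableTypeR R) := cons_tuple x.1 x.2.

Lemma measurable_tuple_cons (R : realType) (p : nat) :
  measurable_fun setT (@tuple_cons R p).
Proof. exact: (measurable_cons measurable_fst measurable_snd). Qed.
HB.instance Definition _ (R : realType) (p : nat) :=
  isMeasurableFun.Build _ _ _ _ (@tuple_cons R p) (@measurable_tuple_cons R p).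

(* Lebesgue measure on the unit cube [0, 1]^m, as an iterated product. *)
Fixpoint cube_prob (R : realType) (m : nat) :
    probability (m.-tuple (measurableTypeR R)) R :=
  if m is p.+1 then
    distribution (uniform_prob (@ltr01 R) \x cube_prob R p)%E (@tuple_cons R p)
  else dirac [tuple].

Definition torus_of_tuple (R : realType) (m : nat)
    (u : m.-tuple (measurableTypeR R)) : torus R m :=
  \pi_(torus R m) (\col_i tnth u i).

Lemma measurable_torus_of_tuple (R : realType) (m : nat) :
  measurable_fun setT (@torus_of_tuple R m).
Proof.
apply: (@measurability _ _ _ _ _ _ (@open (torus R m))) => //.
move=> _ [U openU <-]; rewrite setTI.
pose V : set 'cV[R]_m := \pi_(torus R m) @^-1` U.
have openV : open V by [].
pose box (q : rat ^ m * rat) : set (m.-tuple (measurableTypeR R)) :=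
  [set u | forall i, `|ratr (q.1 i) - tnth u i| < ratr q.2].
pose good (q : rat ^ m * rat) := [set u | box q u /\
  box q `<=` [set u | V (\col_i tnth u i)]].
have -> : @torus_of_tuple R m @^-1` U = \bigcup_q good q.
  apply/seteqP; split=> [u Vu|u [q _ [qu sq]]]; last exact: sq.
  have /nbhs_ballP[e /= e0 Ve] : nbhs (\col_i tnth u i : 'cV[R]_m) V.
    exact: open_nbhs_nbhs.
  have /rat_in_itvoo[r /andP[/= r0 re]] : 0 < e / 2 by rewrite divr_gt0.
  have r0' : ratr r > 0 :> R by [].
  have rq i : {q : rat | `|ratr q - tnth u i| < ratr r}.
    apply/cid.
    have /rat_in_itvoo[q /andP[/= q1 q2]] : tnth u i < tnth u i + ratr r.
      by rewrite ltrDl.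
    by exists q; rewrite ger0_norm ?subr_ge0 ?(ltW q1)// ltrBlDl.
  exists ([ffun i => sval (rq i)], r) => //; split => [i|v bv] /=.
    by rewrite ffunE; case: (rq i).
  apply: Ve; split => // i j; rewrite !mxE /ball/=.
  have := bv i; rewrite /= ffunE; case: (rq i) => q /= qu qv.
  have -> : tnth u i - tnth v i = (ratr q - tnth v i) - (ratr q - tnth u i).
    by rewrite opprB [RHS]addrC subrKA.
  apply: (le_lt_trans (ler_normB _ _)); rewrite [e]splitr.
  by apply: ltrD; [exact: lt_trans re|exact: lt_trans re].
apply: countable_bigcupT_measurable => [|q]; first exact: countableP.
have [sq|nsq] := pselect (box q `<=` [set u | V (\col_i tnth u i)]); last first.
  by rewrite (_ : good q = set0)//; apply/seteqP; split=> // u [].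
have -> : good q = \bigcap_(i in [set: 'I_m])
    ((fun u : m.-tuple (measurableTypeR R) => tnth u i)
       @^-1` ball (ratr (q.1 i) : R) (ratr q.2)).
  by apply/seteqP; split=> [u [bu _] i _|u bu]; [exact: bu|split=> // i; exact: bu].
apply: fin_bigcap_measurable => // i _.
rewrite -[X in measurable X]setTI; apply: measurable_tnth => //.
by rewrite ball_itv; exact: measurable_itv.
Qed.
HB.instance Definition _ (R : realType) (m : nat) :=
  isMeasurableFun.Build _ _ _ _ (@torus_of_tuple R m)
    (@measurable_torus_of_tuple R m).

(* Normalised Haar measure: the image of Lebesgue measure on the unit cube, which
   is a fundamental domain of the integer lattice up to a null set. *)
Definition haar (R : realType) (m : nat) : probability (torus R m) R :=
  distribution (cube_prob R m) (@torus_of_tuple R m).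

Definition toral_map (R : realType) (m : nat) (A : 'M[int]_m) (x : torus R m) :
  torus R m := \pi_(torus R m) (map_mx intr A *m repr x).

Definition toral_pow (R : realType) (m : nat) (M : 'M[int]_m) (k : int) :
    torus R m -> torus R m :=
  match k with
  | Posz n => iter n (toral_map M)
  | Negz n => iter n.+1 (toral_map (invmx M))
  end.

Definition homoclinic (R : realType) (m : nat) (M : 'M[int]_m) :
    set (torus R m) :=
  [set t | toral_pow M n%:Z t @[n --> \oo] --> (0 : torus R m) /\
           toral_pow M (- n%:Z) t @[n --> \oo] --> (0 : torus R m)].

(* The two-sided series is the limit of its sums over -N <= k < N; for
   homoclinic t it converges absolutely. *)
Definition coding (R : realType) (m : nat) (M : 'M[int]_m) (t : torus R m)
    (e : int -> nat) : torus R m :=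
  lim ((\sum_(0 <= k < N) (toral_pow M (- k%:Z) t *+ e k%:Z
                          + toral_pow M k.+1%:Z t *+ e (- k.+1%:Z)))
       @[N --> \oo]).

Definition ae_preimages (R : realType) (m : nat) (M : 'M[int]_m) (beta : R)
    (t : torus R m) (p : nat) : Prop :=
  \forall x \ae haar R m,
    (beta_compactum beta `&` coding M t @^-1` [set x] #= `I_p)%card.

Definition is_min (A : set nat) (p : nat) : Prop :=
  A p /\ forall q, A q -> (p <= q)%N.

(* Main.v *)
Require Import Defs.
From HB Require Import structures.
From mathcomp Require Import all_boot all_order all_algebra.
From mathcomp Require Import generic_quotient ring_quotient.
From mathcomp Require Import all_classical all_reals all_analysis.
From mathcomp Require Import complex measurable_realfun zify ring lra.
Set Implicit Arguments.
Unset Strict Implicit.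
Unset Printing Implicit Defensive.
Import Order.TTheory GRing.Theory Num.Theory.
Import numFieldNormedType.Exports.
Local Open Scope classical_set_scope.
Local Open Scope ring_scope.

(* Write Gamma = Z[M] n, and let v be the component of n on the expanding line of
   M. The homoclinic points are the images of these v, and coding by the image of
   v sends a sequence e of the beta-compactum to the image of M y_0, where
   (y_k) is the only bounded orbit of y_(k+1) = M y_k - e_k n; the coordinate of
   y_k along the expanding line is then the number with greedy expansion
   e_k e_(k+1) ...

   In each coset of Gamma some y_0 occurs: greedy orbits started in the past stay
   in finite subsets of cosets of Gamma, so they have an exact limit. Almost surely
   only one does: by weak finitarity there is a word w such that any two orbits
   which differ by elements of Gamma have merged once one of them has read w, and
   the orbits whose past misses w from some time on fill a null set, because the
   numbers whose expansion avoids w are covered by few short intervals and thin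
   slabs transverse to the expanding line have small Haar measure. Hence almost
   every point has one preimage for each of the cosets of Gamma in Z^m. Their
   number is |det (n, M n, ..., M^(m-1) n)| = |f_M(n)|. *)

(** * The torus as a quotient *)

(** Every almost-everywhere claim rests on one estimate: the image of a bounded slab of thickness
    [h] under a unimodular integer matrix has Haar measure O(h), with a constant independent of the
    matrix. A condition on the coordinate of [y_(-i)] therefore costs the same in measure, however
    large [i] is, when it is transported to the point coded at time 0.

    Weak finitarity enters through carries. Two orbits in one coset have coordinates [a] and [a - g]
    with [g] in a fixed finite subset of Z[beta]. One chooses [f] such that [f] and all relevant
    [f - g] have finite expansions. If [a] begins like [f] followed by enough zeros, then [a - f] is
    too small to cause a carry in [f + (a - f)] or in [(f - g) + (a - f)], so both tails equal that
    of [a - f].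

    The integer vector of a homoclinic point [t] is the difference of two lifts of [t], one with
    bounded backward orbit and one with bounded forward orbit. It vanishes only for [t = 0], where
    the number of preimages and the value of the form are both 0. *)

Section TorusProjection.
Local Open Scope quotient_scope.
Variables (R : realType) (m : nat).
Implicit Types (x y : 'cV[R]_m) (t : torus R m).

Definition tproj (x : 'cV[R]_m) : torus R m := \pi_(torus R m) x.

Lemma tproj_repr t : tproj (repr t) = t.
Proof. exact: reprK. Qed.

Lemma tproj_eq x y : tproj x = tproj y <-> x - y \in @int_lattice R m.
Proof.
have E := @Quotient.idealrBE _ (@int_lattice R m) x y.
split=> [H|H].
  by rewrite E; apply/eqP; exact: H.
by move: H; rewrite E => /eqP H; exact: H.
Qed.

Lemma tprojB x y : tproj (x - y) = tproj x - tproj y.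
Proof. exact: (@pi_is_zmod_morphism _ _ _ (Quotient.quot (@int_lattice R m)) x y). Qed.

Lemma tproj0 : tproj 0 = 0.
Proof. by rewrite -(subrr (0 : 'cV[R]_m)) tprojB subrr. Qed.

Lemma tprojN x : tproj (- x) = - tproj x.
Proof. by rewrite -[- x]add0r tprojB tproj0 add0r. Qed.

Lemma tprojD x y : tproj (x + y) = tproj x + tproj y.
Proof. by rewrite -[y in LHS]opprK tprojB tprojN opprK. Qed.

Lemma tprojMn x k : tproj (x *+ k) = tproj x *+ k.
Proof. by elim: k => [|k IH]; rewrite ?mulr0n ?tproj0 // !mulrS tprojD IH. Qed.

Lemma tproj_continuous : continuous tproj.
Proof. exact: pi_continuous. Qed.

Lemma open_tproj (U : set 'cV[R]_m) : open U -> open (tproj @` U).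
Proof.
move=> oU.
have E : tproj @^-1` (tproj @` U) =
  \bigcup_(z in [set z | z \in @int_lattice R m]) ((fun x => x + z) @^-1` U).
  apply/seteqP; split => [x [u Uu /tproj_eq ux]|x [z zZ /= Uxz]].
    by exists (u - x) => //=; rewrite addrC subrK.
  by exists (x + z) => //; apply/tproj_eq; rewrite addrC addKr.
change (open (tproj @^-1` (tproj @` U))); rewrite E.
apply: bigcup_open => z _.
apply: open_comp; last exact: oU.
move=> x _; exact: (cvgD (@cvg_id _ (nbhs x)) (cvg_cst z)).
Qed.

Lemma open_torus_translate (U : set (torus R m)) x :
  open U -> open [set t | U (t + tproj x)].
Proof.
move=> oU; pose V := tproj @^-1` U.
rewrite (_ : [set t | _] = tproj @` [set y | V (y + x)]); last first.
  apply/seteqP; split => [t Ut|_ [y Vy <-]] /=; last by rewrite -tprojD.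
  by exists (repr t); rewrite ?tproj_repr// /V /= tprojD tproj_repr.
apply: open_tproj; apply: (@open_comp _ _ (fun y => y + x) V); last exact: oU.
by move=> y _; exact: (cvgD (@cvg_id _ (nbhs y)) (cvg_cst x)).
Qed.

Lemma open_col_ball x (e : R) : 0 < e -> open [set y : 'cV[R]_m | forall i,
  `|x i 0 - y i 0| < e].
Proof.
move=> e0; rewrite openE => y /= xy; apply/nbhs_ballP.
have [d d0 dP] : exists2 d : R, 0 < d & forall i, `|x i 0 - y i 0| + d <= e.
  exists (\big[Order.min/e]_i (e - `|x i 0 - y i 0|)).
    by apply: lt_bigmin => // i _; rewrite subr_gt0.
  move=> i; rewrite addrC -lerBrDr; apply: bigmin_le_cond => //.
exists d => //= z [_ /(_ _ 0) yz] i.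
rewrite (le_lt_trans (ler_distD (y i 0) _ _))//.
by rewrite (lt_le_trans _ (dP i))// ltrD2l; exact: yz.
Qed.

Lemma int_lattice_sub (z : 'cV[R]_m) : z \in @int_lattice R m <-> exists w : 'cV[int]_m,
  z = map_mx intr w.
Proof.
split=> [/mxOverP zZ|[w ->]]; last by apply/mxOverP => i j; rewrite mxE;
  exact: Num.Theory.intr_int.
exists (\matrix_(i, j) Num.floor (z i j)); apply/matrixP => i j; rewrite !mxE.
by apply/esym/eqP; rewrite -intrEfloor; exact: zZ.
Qed.

(** Needed because [coding] is a [lim], whose value is pinned down only where limits are unique. A
    coordinate in which two lifts differ by a non-integer [r] separates the points. *)
Lemma torus_hausdorff : hausdorff_space (torus R m).
Proof.
rewrite open_hausdorff => t u tu.
have [a ta] : exists a, tproj a = t by exists (repr t); rewrite tproj_repr.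
have [b ub] : exists b, tproj b = u by exists (repr u); rewrite tproj_repr.
have [i ai] : exists i, a i 0 - b i 0 \isn't a Num.int.
  apply: contrapT => /forallNP H; move/eqP: tu; apply; rewrite -ta -ub.
  apply/tproj_eq/mxOverP => i j; rewrite !mxE (ord1 j).
  by have := H i; case: (_ \is a Num.int) => // /(_ isT).
set r := a i 0 - b i 0 in ai.
(* [d] is the distance from [r] to the nearest integer, so boxes of half that size stay disjoint
   modulo the lattice. *)
have [d d0 dP] : exists2 d : R, 0 < d & forall k : int, d <= `|r - k%:~R|.
  have fr : (Num.floor r)%:~R < r.
    by rewrite lt_neqAle floor_le andbT; apply: contra ai => /eqP <-; exact: intr_int.
  have fr1 := floorD1_gt r.
  exists (Num.min (r - (Num.floor r)%:~R) ((Num.floor r + 1)%:~R - r)).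
    by rewrite lt_min !subr_gt0 fr.
  move=> k; rewrite ge_min; have [kr|kr] := leP k (Num.floor r).
    apply/orP; left; rewrite (le_trans _ (ler_norm _))// lerB//; by rewrite ler_int.
  apply/orP; right; rewrite distrC (le_trans _ (ler_norm _))// lerB//; by rewrite ler_int lezD1.
pose B x := [set y : 'cV[R]_m | forall i, `|x i 0 - y i 0| < d / 2].
have d20 : 0 < d / 2 by rewrite divr_gt0.
exists (tproj @` B a, tproj @` B b) => /=.
  by split; rewrite inE; [exists a|exists b] => // k; rewrite subrr normr0.
split; [exact/open_tproj/open_col_ball|exact/open_tproj/open_col_ball|].
apply/eqP; rewrite -subset0 => _ [[x Bx <-] [y By /esym/tproj_eq/int_lattice_sub[w
  /matrixP /(_ i 0)]]].
rewrite !mxE => xyw.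
have := dP (w i 0); rewrite -xyw leNgt => /negP; apply.
have -> : r - (x i 0 - y i 0) = (a i 0 - x i 0) - (b i 0 - y i 0) by rewrite /r; ring.
by rewrite (le_lt_trans (ler_normB _ _))// [d]splitr ltrD// ?Bx ?By.
Qed.

Lemma torus_cvg0_lift (u : nat -> torus R m) (d : R) : 0 < d ->
  u n @[n --> \oo] --> (0 : torus R m) ->
  \forall n \near \oo, exists2 z : 'cV[R]_m, tproj z = u n & forall i, `|z i 0| < d.
Proof.
move=> d0 /(_ (tproj @` [set y : 'cV[R]_m | forall i, `|(0 : 'cV[R]_m) i 0 - y i 0| < d])).
case; first by apply: open_nbhs_nbhs; split; [exact/open_tproj/open_col_ball|exists 0;
  rewrite ?tproj0//= => i; rewrite subrr normr0].
move=> N _ NP; exists N => // n Nn.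
have [z zd zu] := NP _ Nn; exists z => // i.
by have := zd i; rewrite mxE add0r normrN.
Qed.

Lemma toral_mapE (A : 'M[int]_m) x : toral_map A (tproj x) = tproj (map_mx intr A *m x).
Proof.
apply/tproj_eq; rewrite -mulmxBr.
have /int_lattice_sub[w ->] : repr (tproj x) - x \in @int_lattice R m.
  by apply/tproj_eq; rewrite tproj_repr.
by apply/int_lattice_sub; exists (A *m w); rewrite map_mxM.
Qed.

Lemma col_cvg (u : nat -> 'cV[R]_m) (l : 'cV[R]_m) :
  (forall i, u n i 0 @[n --> \oo] --> l i 0) -> u n @[n --> \oo] --> l.
Proof.
move=> H; apply/cvg_ballP => e e0.
have : \forall n \near \oo, forall i, ball (l i 0) e (u n i 0).
  by apply: filter_forall => i; exact: (cvg_ball (H i)).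
apply: filterS => n nP; split => // i j; rewrite (ord1 j); exact: nP.
Qed.

End TorusProjection.
Arguments tproj {R m} x.

(** * Translation invariance of Haar measure *)

Section Translation.
Variable R : realType.
Local Notation mu := (@lebesgue_measure R).

Lemma measurable_addr (c : R) : measurable_fun setT (fun x : measurableTypeR R =>
  (x + c : measurableTypeR R)).
Proof. exact: measurable_funD (@measurable_id _ _ _) (measurable_cst _). Qed.

Lemma addr_preimage_itv (c x y : R) (b1 b2 : bool) :
  (fun z => z + c) @^-1` [set` Interval (BSide b1 x) (BSide b2 y)] =
  [set` Interval (BSide b1 (x - c)) (BSide b2 (y - c))].
Proof.
by apply/seteqP; split => z /=; rewrite !in_itv /=; case: b1; case: b2 => /=;
  rewrite ?lerBlDr ?ltrBlDr ?lerBrDr ?ltrBrDr.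
Qed.

(** Lebesgue measure is determined by its values on half-open intervals, whose lengths a translation
    keeps. *)
Lemma lebesgue_measure_translate (c : R) (A : set (measurableTypeR R)) : measurable A ->
  pushforward mu (fun x : measurableTypeR R => (x + c : measurableTypeR R)) A = mu A.
Proof.
move=> mA; apply/esym.
pose phi : {mfun measurableTypeR R >-> measurableTypeR R} :=
  HB.pack (fun x : measurableTypeR R => (x + c : measurableTypeR R))
    (isMeasurableFun.Build _ _ _ _ _ (measurable_addr c)).
apply: (@lebesgue_measure_unique R (pushforward mu phi)) => //= _ [[a b]] _ <-.
rewrite /pushforward addr_preimage_itv !lebesgue_measure_itv/=.
rewrite !lte_fin ltrD2r -!EFinB; case: ifP => // _; congr (_%:E); ring.
Qed.

Local Open Scope ereal_scope.

Lemma ge0_integral_translate (c a b : R) (f : R -> \bar R) :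
  measurable_fun setT f -> (forall x, 0 <= f x) ->
  \int[mu]_(x in `[a, b[) f (x + c)%R = \int[mu]_(x in `[(a + c)%R, (b + c)%R[) f x.
Proof.
move=> mf f0.
have -> : `[a, b[%classic = (fun x : measurableTypeR R => (x + c)%R : measurableTypeR R)
  @^-1` `[(a + c)%R, (b + c)%R[%classic :> set R.
  by rewrite addr_preimage_itv !addrK.
rewrite -(@ge0_integral_pushforward _ _ _ _ _ _ (measurable_addr c) mu); last 3 first.
- exact: measurable_itv.
- exact: measurable_funS mf.
- by move=> y _; exact: f0.

apply: eq_measure_integral; first exact: measurable_addr.
by move=> mphi A mA _; exact: lebesgue_measure_translate.
Qed.

(** Rotation of the circle: periodicity reduces [c] to [0, 1); then the translated interval [c, 1 +
    c) is cut at 1 and its second piece moved back by 1. *)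
Lemma uniform_translate (c : R) (f : R -> \bar R) :
  measurable_fun setT f -> (forall x, 0 <= f x) ->
  (forall x (k : int), f (x + k%:~R)%R = f x) ->
  \int[uniform_prob (@ltr01 R)]_x f (x + c)%R = \int[uniform_prob (@ltr01 R)]_x f x.
Proof.
move=> mf f0 fZ.
have mfS D : measurable_fun D f by apply: measurable_funS mf.
wlog c01 : c / (0 <= c < 1)%R => [H|].
  rewrite -(H (c - (Num.floor c)%:~R)%R).
    by apply: eq_integral => x _; rewrite -[LHS](fZ _ (- Num.floor c)%R) -addrA intrN.
  by rewrite subr_ge0 floor_le ltrBlDl (_ : (_ + 1)%R = (Num.floor c + 1)%:~R)%R
    ?floorD1_gt // intrD.
have /andP[c0 c1] := c01.
have mfc : measurable_fun setT (fun x : R => f (x + c)%R).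
  exact: (measurableT_comp mf (measurable_addr c)).
rewrite !integral_uniform//; congr (_ * _).
rewrite -!integral_itv_bndo_bndc; [|exact: mfS|exact: measurable_funS mfc].
rewrite ge0_integral_translate// add0r.
rewrite (@itv_bndbnd_setU _ _ (BLeft c) (BLeft 1%R)); last 2 first.
- by rewrite bnd_simp ltW.
- by rewrite bnd_simp lerDl.
rewrite ge0_integral_setU//=; [|exact: mfS|]; last first.
  by apply/disj_setPS => x [] /=; rewrite !in_itv /= => /andP[_ x1] /andP[+ _];
    rewrite leNgt x1.
have -> : \int[mu]_(x in `[1%R, (1 + c)%R[) f x = \int[mu]_(x in `[0%R, c[) f (x + 1)%R.
  by rewrite ge0_integral_translate// add0r addrC.
rewrite [in RHS](@itv_bndbnd_setU _ _ (BLeft 0%R) (BLeft c)); last 2 first.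
- by rewrite bnd_simp.
- by rewrite bnd_simp ltW.
rewrite ge0_integral_setU//=; [|exact: mfS|]; last first.
  by apply/disj_setPS => x [] /=; rewrite !in_itv /= => /andP[_ x1] /andP[+ _];
    rewrite leNgt x1.
rewrite addeC; congr (_ + _).
by apply: eq_integral => x _; rewrite -[RHS](fZ x (Posz 1)).
Qed.

End Translation.

(** * Translations of the cube modulo the integers *)

Section CubeTranslation.
Variable R : realType.

Definition addt m (u c : m.-tuple (measurableTypeR R)) : m.-tuple (measurableTypeR R) :=
  [tuple (tnth u i : R) + (tnth c i : R) | i < m].

Lemma addt_cons m (x c : R) (u v : m.-tuple (measurableTypeR R)) :
  addt (@tuple_cons R m (x, u)) (@tuple_cons R m (c, v)) = @tuple_cons R m (x + c, addt u v).
Proof.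
apply: eq_from_tnth => i; rewrite tnth_mktuple.
case: (unliftP ord0 i) => [j|] ->; last by rewrite /tuple_cons/= !tnth0.
by rewrite /tuple_cons/= !tnthS tnth_mktuple.
Qed.

Lemma tuple_cons_decomp m (u : m.+1.-tuple (measurableTypeR R)) :
  u = @tuple_cons R m (thead u, [tuple of behead u]).
Proof. exact: tuple_eta. Qed.

Definition tuple_periodic m (G : set (m.-tuple (measurableTypeR R))) :=
  forall u z, (forall i, (tnth z i : R) \is a Num.int) -> G (addt u z) <-> G u.

Lemma cube_probE m (G : set (m.+1.-tuple (measurableTypeR R))) : measurable G ->
  (cube_prob R m.+1 G =
   \int[uniform_prob (@ltr01 R)]_x cube_prob R m [set v | G (@tuple_cons R m (x, v))])%E.
Proof.
move=> mG; rewrite /= /distribution /= /pushforward /product_measure1.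
apply: eq_integral => x _ /=; congr (cube_prob R m _).
by apply/seteqP; split => v /=; rewrite /xsection /= inE.
Qed.

Lemma cube_prob_section_measurable m (G : set (m.+1.-tuple (measurableTypeR R))) :
  measurable G ->
  measurable_fun setT (fun x : measurableTypeR R => cube_prob R m [set v | G (@tuple_cons
    R m (x, v))]).
Proof.
move=> mG.
have mG' : measurable (@tuple_cons R m @^-1` G).
  by rewrite -[X in measurable X]setTI; apply: measurable_tuple_cons.
have := measurable_fun_xsection (cube_prob R m) mG'.
apply: eq_measurable_fun => x _ /=; congr (cube_prob R m _).
by apply/seteqP; split => v /=; rewrite /xsection /= inE.
Qed.

Lemma measurable_tuple_section m (G : set (m.+1.-tuple (measurableTypeR R))) (x : R) :
  measurable G ->
  measurable [set v | G (@tuple_cons R m (x, v))].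
Proof.
move=> mG.
have mG' : measurable (@tuple_cons R m @^-1` G).
  by rewrite -[X in measurable X]setTI; apply: measurable_tuple_cons.
rewrite (_ : [set v | _] = xsection (@tuple_cons R m @^-1` G) x);
  first exact: measurable_xsection.
by apply/seteqP; split => v /=; rewrite /xsection /= inE.
Qed.

Lemma measurable_addt m (c : m.-tuple (measurableTypeR R)) :
  measurable_fun setT (fun u => addt u c).
Proof.
apply/measurable_fun_tnthP => i.
rewrite (_ : _ \o _ = (fun u => (tnth u i : R) + tnth c i)).
  exact: (measurableT_comp (measurable_addr _) (measurable_tnth i)).
by apply/funext => u /=; rewrite tnth_mktuple.
Qed.

(** Induction on the dimension: [cube_prob] integrates the measures of sections, the first
    coordinate is rotated by [uniform_translate] and the sections by the induction hypothesis. *)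
Lemma cube_prob_translate m (G : set (m.-tuple (measurableTypeR R))) c :
  measurable G -> tuple_periodic G ->
  cube_prob R m [set u | G (addt u c)] = cube_prob R m G.
Proof.
elim: m => [|m IH] in G c *.
  move=> _ _; congr (cube_prob R 0 _); apply/seteqP.
  by split => u /=; rewrite (tuple0 (addt u c)) (tuple0 u).
move=> mG pG.
rewrite (tuple_cons_decomp c); move: (thead c) [tuple of behead c] => c0 {}c.
have mGc : measurable [set u | G (addt u (@tuple_cons R m (c0, c)))].
  by rewrite -[X in measurable X]setTI; exact: measurable_addt.
rewrite !cube_probE//.
pose h (x : R) := cube_prob R m [set v | G (@tuple_cons R m (x, v))].
have pGx x : tuple_periodic [set v | G (@tuple_cons R m (x, v))].
  move=> u z zZ /=; rewrite -[x in X in X <-> _]addr0 -addt_cons; apply: pG => i.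
  case: (unliftP ord0 i) => [j|] ->; last by rewrite /tuple_cons/= tnth0 rpred0.
  by rewrite /tuple_cons/= tnthS.
have hZ (x : R) (k : int) : h (x + k%:~R) = h x.
  rewrite /h; congr (cube_prob R m _); apply/seteqP; split => v /=.
    have -> : @tuple_cons R m (x + k%:~R, v) =
      addt (@tuple_cons R m (x, v)) (@tuple_cons R m (k%:~R, [tuple 0 | i < m])).
      rewrite addt_cons; congr (tuple_cons (_, _)); apply: eq_from_tnth => i.
      by rewrite !tnth_mktuple addr0.
    move/pG; apply => i.
    case: (unliftP ord0 i) => [j|] ->; last by rewrite /tuple_cons/= tnth0 intr_int.
    by rewrite /tuple_cons/= tnthS tnth_mktuple rpred0.
  have -> : @tuple_cons R m (x + k%:~R, v) =
    addt (@tuple_cons R m (x, v)) (@tuple_cons R m (k%:~R, [tuple 0 | i < m])).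
    rewrite addt_cons; congr (tuple_cons (_, _)); apply: eq_from_tnth => i.
    by rewrite !tnth_mktuple addr0.
  move=> Gv; apply/pG => // i.
  case: (unliftP ord0 i) => [j|] ->; last by rewrite /tuple_cons/= tnth0 intr_int.
  by rewrite /tuple_cons/= tnthS tnth_mktuple rpred0.
rewrite -[RHS](@uniform_translate R c0 h) //; last exact: cube_prob_section_measurable.
apply: eq_integral => x _; rewrite /h.
rewrite -(IH _ c (measurable_tuple_section _ mG) (pGx _)).
congr (cube_prob R m _); apply/seteqP.
by split => v /=; rewrite addt_cons.
Qed.

Lemma haar_translate m (U : set (torus R m)) (c : 'cV[R]_m) : measurable U ->
  haar R m [set t | U (t + tproj c)] = haar R m U.
Proof.
move=> mU; rewrite /haar /= /distribution /= /pushforward.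
pose ct : m.-tuple (measurableTypeR R) := [tuple c i 0 | i < m].
have E u : torus_of_tuple (addt u ct) = torus_of_tuple u + tproj c.
  rewrite -[torus_of_tuple u]/(tproj (\col_i tnth u i)) -tprojD.
  rewrite -[LHS]/(tproj (\col_i tnth (addt u ct) i)); congr tproj.
  by apply/matrixP => i j; rewrite !mxE !tnth_mktuple (ord1 j).
have pG : tuple_periodic (@torus_of_tuple R m @^-1` U).
  move=> u z zZ /=.
  suff -> : torus_of_tuple (addt u z) = torus_of_tuple u by [].
  apply/tproj_eq/mxOverP => i j; rewrite !mxE tnth_mktuple addrC addKr; exact: zZ.
rewrite -(cube_prob_translate ct _ pG).
  by congr (cube_prob R m _); apply/seteqP; split => u /=; rewrite E.
by rewrite -[X in measurable X]setTI; apply: measurable_torus_of_tuple.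
Qed.
End CubeTranslation.

(** * Haar measure of thin slabs *)

(** The sum of the measures is the integral of the number of sets containing a point. *)
Lemma overlap_bound d (T : measurableType d) (R : realType) (mu : probability T R)
    (J N : nat) (U : 'I_J -> set T) :
  (forall j, measurable (U j)) ->
  (forall x, #|[set j | x \in U j]%SET| <= N)%N ->
  (\sum_(j < J) mu (U j) <= N%:R%:E)%E.
Proof.
move=> mU UN.
have -> : (\sum_(j < J) mu (U j) = \int[mu]_x \sum_(j < J) (\1_(U j) x)%:E)%E.
  rewrite ge0_integral_sum//; last by move=> j; exact/measurable_EFinP/measurable_indic.
  by apply: eq_bigr => j _; rewrite integral_indic// setIT.
have -> : (N%:R%:E = \int[mu]_x (cst N%:R%:E x))%E.
  by rewrite integral_cst//= probability_setT mule1.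
apply: ge0_le_integral => //.
- by move=> x _; apply: sume_ge0.
- by apply: emeasurable_sum => j; exact/measurable_EFinP/measurable_indic.
move=> x _ /=; rewrite sumEFin lee_fin.
rewrite (le_trans _ (_ : (#|[set j | x \in U j]%SET|)%:R <= _)) ?ler_nat//.
rewrite -sum1_card natr_sum (bigID (fun j => x \in U j)) /= addrC big1 ?add0r; last first.
  by move=> j /negbTE xj; rewrite indicE xj.
rewrite le_eqVlt; apply/orP; left; apply/eqP; apply: eq_big => j; first by rewrite inE.
by move=> xj; rewrite indicE xj.
Qed.

Lemma continuous_mulmx_coord (R : realType) (p m : nat) (A : 'M[R]_(p, m)) (i : 'I_p) :
  continuous (fun x : 'cV[R]_m => (A *m x) i 0).
Proof.
move=> x; rewrite /continuous_at mxE.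
under eq_cvg do rewrite mxE.
apply: (@cvg_big R _ +%R 0 _ add_continuous _ (nbhs x)) => k _.
by apply: cvgM; [exact: cvg_cst|exact: coord_continuous].
Qed.

Lemma open_mulmx_preimage (R : realType) (p m : nat) (A : 'M[R]_(p, m)) (U : set 'cV[R]_p) :
  open U -> open [set x | U (A *m x)].
Proof.
move=> oU; apply: (@open_comp _ _ (fun x : 'cV[R]_m => A *m x)) oU => x _.
apply/(@cvg_ballP _ _ _ _ (nbhs_filter x)) => e e0.
have : \forall y \near x, forall i, ball ((A *m x) i 0) e ((A *m y) i 0).
  apply: (@filter_forall _ _ _ (nbhs x) (nbhs_filter x)) => i;
    exact: (cvg_ball (@continuous_mulmx_coord R p m A i x)).
by apply: (@filterS _ _ (nbhs_filter x)) => y yP; split => // i j; rewrite (ord1 j); exact: yP.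
Qed.

Section Slab.
Variables (R : realType) (m : nat) (l : 'rV[R]_m) (v : 'cV[R]_m).
Hypothesis lv : l *m v = 1%:M.

Definition slab (C a h : R) : set 'cV[R]_m :=
  [set y : 'cV[R]_m | (forall i, `|y i 0| < C) /\ a < (l *m y) 0 0 < a + h].

(** The matrix [A] is built in because slabs are drawn around the orbit at a time far in the past
    and transported to the present by a power of [M]. *)
Definition tslab (A : 'M[int]_m) (C a h : R) : set (torus R m) :=
  tproj @` ((fun y : 'cV[R]_m => map_mx intr A *m y) @` slab C a h).

Lemma open_tslab A C a h : A \in unitmx -> open (tslab A C a h).
Proof.
move=> Au; apply: open_tproj.
have ARu : (map_mx intr A : 'M[R]_m) \in unitmx by rewrite unitmxE det_map_mx
  rmorph_unit// -unitmxE.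
rewrite (_ : _ @` _ = [set x | slab C a h (invmx (map_mx intr A) *m x)]); last first.
  apply/seteqP; split => [x [y Sy <-]|x Sx] /=; first by rewrite mulKmx.
  by exists (invmx (map_mx intr A) *m x) => //; rewrite mulKVmx.
apply: open_mulmx_preimage; rewrite openE => y [yC /andP[ya yb]].
have lc := @continuous_mulmx_coord R 1 m l 0 y.
apply: (@filterI _ _ (nbhs_filter y));
  last by apply: (@filterS2 _ _ (nbhs_filter y)) (cvgr_gt _ lc _ ya) (cvgr_lt _ lc _ yb)
  => z -> ->.
apply: (@filter_forall _ _ _ (nbhs y) (nbhs_filter y)) => i; apply: cvgr_lt (yC i).
exact: cvg_norm (@coord_continuous _ _ _ i 0 y).
Qed.

Lemma measurable_tslab A C a h : A \in unitmx -> measurable (tslab A C a h).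
Proof. by move=> Au; apply: sub_sigma_algebra; exact: open_tslab. Qed.

(* On the torus, the translates of a slab by the multiples of h v overlap
   boundedly many times, and there are about 1 / h of them. *)
Lemma slab_haar (C : R) : exists2 K : R, 0 <= K & forall (A : 'M[int]_m) (a h : R),
  A \in unitmx -> 0 < h -> (haar R m (tslab A C a h) <= (K * h)%:E)%E.
Proof.
have [B BP] : exists B : nat, forall i, C + `|v i 0| <= B%:R.
  pose b i := (Num.truncn (C + `|v i 0|)).+1.
  exists (\max_i b i)%N => i; rewrite (le_trans (ltW (truncnS_gt _)))// ler_nat.
  by rewrite -/(b i) leq_bigmax.
(* [N] counts the integer vectors with entries between [- 2 * B] and [2 * B], the possible
   differences of two vectors with entries below [B]. *)
pose N := ((4 * B).+1 ^ m)%N.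
exists N%:R => // A a h Au h0.
(* [J] is just large enough for [J * h] to exceed 1, while the shifts [j * h] with [j < J] stay at
   most 1 and keep the slabs inside the box of size [B]. *)
pose J := (Num.truncn h^-1).+1.
have Jh : h^-1 < J%:R by exact: truncnS_gt.
have jh1 (j : 'I_J) : (0 : R) <= j%:R * h <= 1.
  rewrite mulr_ge0 ?(ltW h0)//= -(@ler_pdivlMr _ h)// div1r.
  by have := ltn_ord j; rewrite ltnS truncn_ge_nat // invr_ge0 ltW.
pose AR : 'M[R]_m := map_mx intr A.
have ARu : AR \in unitmx by rewrite unitmxE det_map_mx rmorph_unit// -unitmxE.
pose U (j : 'I_J) := [set t : torus R m | tslab A C a h (t + tproj (- (AR *m ((j%:R * h)
  *: v))))].
have mT := measurable_tslab C a h Au.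
have hU (j : 'I_J) : haar R m (U j) = haar R m (tslab A C a h) by rewrite haar_translate.
have mU j : measurable (U j).
  by apply: sub_sigma_algebra; apply: open_torus_translate; exact: open_tslab.
have UN : forall x, (#|[set j | x \in U j]%SET| <= N)%N.
  move=> x.
  have UP j : x \in U j -> exists y, [/\ tproj (AR *m y) = x,
      forall i, `|y i 0| < B%:R & a + j%:R * h < (l *m y) 0 0 < a + j%:R * h + h].
    rewrite inE => -[_ [y [yC /andP[ya yb]] <-]].
    move/(congr1 (fun t => t + tproj (AR *m ((j%:R * h) *: v)))).
    rewrite -addrA tprojN addNr addr0 -tprojD -mulmxDr => <-.
    have /andP[jh0 jh1'] := jh1 j.
    exists (y + (j%:R * h) *: v); split => //.
      move=> i; rewrite !mxE (lt_le_trans _ (BP i))// (le_lt_trans (ler_normD _ _))//.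
      by rewrite ltr_leD// normrM ger0_norm// ler_piMl.
    rewrite mulmxDr -scalemxAr lv.
    have -> (c : R) (X : 'M[R]_1) : (X + c *: 1%:M) 0 0 = X 0 0 + c.
      by rewrite !mxE eqxx mulr1.
    by rewrite ltrD2r ya /= addrAC ltrD2r.
  have [j0 Sj0|S0] := pickP (mem [set j | x \in U j]%SET); last first.
    by rewrite eq_card0.
  have {}Sj0 : x \in U j0 by move: Sj0 => /=; rewrite finset.in_set.
  have [y0 [y0x y0B _]] := UP _ Sj0.
  have /choice[w wP] j : exists w : 'cV[int]_m, x \in U j ->
      [/\ forall i, `|w i 0| <= (2 * B)%:Z & a + j%:R * h < (l *m (y0 + map_mx intr w)) 0
        0 < a + j%:R * h + h].
    have [Uj|nx] := boolP (x \in U j); last by exists 0.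
    have [y [yx yB yl]] := UP _ Uj.
    have /tproj_eq/int_lattice_sub[u uE] : tproj (AR *m y) = tproj (AR *m y0) by rewrite yx.
    (* As [A] is unimodular, already [y] and [y0] differ by an integer vector; this makes the
       constant independent of [A]. *)
    have yy0 : y - y0 = map_mx intr (invmx A *m u).
      apply: (can_inj (mulKmx ARu)); rewrite mulmxBr uE -map_mxM mulmxA mulmxV// mul1mx//.
    exists (invmx A *m u) => _; rewrite -yy0 [y0 + _]addrC subrK; split => // i.
    have := congr1 (fun z : 'cV[R]_m => z i 0) yy0; rewrite 2!mxE [in RHS]mxE => wE.
    rewrite -(ler_int R) intr_norm -wE (le_trans (ler_normB _ _))// -pmulrn natrM
      mulr_natl mulr2n.
    by rewrite lerD// ltW.
  pose F (j : 'I_J) : {ffun 'I_m -> 'I_(4 * B).+1} :=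
    [ffun i => inord (absz (w j i 0 + (2 * B)%:Z))].
  (* The vector [w j] determines [j]: the point [y0 + w j] has its coordinate in the open interval
     from [a + j * h] to [a + (j + 1) * h], and these are disjoint for distinct [j]. *)
  have Finj : {in [set j | x \in U j]%SET &, injective F}.
    move=> j j'; rewrite !finset.in_set => /wP[jB jl] /wP[j'B j'l] FF.
    have ww : w j = w j'.
      apply/matrixP => i k; rewrite (ord1 k); have /ffunP/(_ i) := FF;
        rewrite !ffunE => /(congr1 val) /=.
      have := jB i; have := j'B i; move: (w j i 0) (w j' i 0) => p q.
      rewrite !ler_norml => /andP[q1 q2] /andP[p1 p2]; rewrite !inordK; lia.
    apply/val_inj => /=; move: jl j'l; rewrite ww; move: ((_ *m _) 0 0) => X.
    move=> /andP[X1 X2] /andP[X3 X4].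
    have : j%:R * h < j'%:R * h + h by lra.
    have : j'%:R * h < j%:R * h + h by lra.
    have E (k : nat) : k%:R * h + h = k.+1%:R * h by rewrite -natr1 mulrDl mul1r.
    rewrite !E !ltr_pM2r// !ltr_nat !ltnS => jj' j'j.
    by apply/eqP; rewrite eqn_leq jj' j'j.
  rewrite -(card_in_imset Finj) (leq_trans (max_card _))// card_ffun !card_ord//.
have := overlap_bound (haar R m) mU UN.
have Hfin : haar R m (tslab A C a h) = (fine (haar R m (tslab A C a h)))%:E.
  by apply/esym/fineK; apply: fin_num_measure.
set X := fine _ in Hfin; have X0 : 0 <= X by exact: fine_ge0 (measure_ge0 _ _).
rewrite (eq_bigr (fun=> X%:E)); last by move=> j _; rewrite hU Hfin.
rewrite sumEFin Hfin !lee_fin sumr_const card_ord => H.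
have -> : X = X * h^-1 * h by rewrite mulfVK ?gt_eqF.
rewrite ler_wpM2r ?(ltW h0)// (le_trans _ H)// -[X *+ _]mulr_natr.
by rewrite ler_wpM2l// ltW.
Qed.

End Slab.

(** * Greedy expansions *)

Section Greedy.
Variables (R : realType) (beta : R).
Hypothesis b1 : 1 < beta.
Local Notation tau := (beta_shift beta).

Let b0 : 0 < beta. Proof. exact: lt_trans b1. Qed.
Let bn0 : beta != 0. Proof. by rewrite gt_eqF. Qed.

Lemma expr_beta_unbounded (C : R) : exists n : nat, C < beta ^+ n.
Proof.
have [n nC] : exists n : nat, C < 1 + n%:R * (beta - 1).
  exists (Num.truncn (C / (beta - 1))).+1.
  have bb : 0 < beta - 1 by rewrite subr_gt0.
  rewrite -ltrBlDl -ltr_pdivrMr// (le_lt_trans _ (truncnS_gt _))//.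
  by rewrite ler_pM2r ?invr_gt0// gerDl lerN10.
exists n; apply: lt_le_trans nC _; elim: n => [|n IH]; first by rewrite mul0r addr0 expr0.
rewrite exprS (le_trans _ (ler_wpM2l (ltW b0) IH))// -natr1.
have : 0 <= n%:R :> R by [].
move: (n%:R : R) => x x0; rewrite -subr_ge0.
have -> : beta * (1 + x * (beta - 1)) - (1 + (x + 1) * (beta - 1)) = x * (beta - 1) ^+ 2
  by ring.
by rewrite mulr_ge0// sqr_ge0.
Qed.

Lemma tau_itv x : 0 <= tau x < 1.
Proof. by rewrite /beta_shift subr_ge0 floor_le ltrBlDl; have := floorD1_gt (beta * x);
  rewrite intrD. Qed.

Lemma tau_def x (k : int) : 0 <= beta * x - k%:~R < 1 -> tau x = beta * x - k%:~R.
Proof.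
move=> /andP[h0 h1]; rewrite /beta_shift; congr (_ - _%:~R); apply: floor_def.
by rewrite -subr_ge0 h0 intrD /= -ltrBlDl.
Qed.

Lemma tau0 : tau 0 = 0.
Proof. by rewrite /beta_shift mulr0 floor0 subr0. Qed.

Lemma iter_tau0 n : iter n tau 0 = 0.
Proof. by elim: n => //= n ->; exact: tau0. Qed.

Lemma iter_tau_itv n x : 0 <= x < 1 -> 0 <= iter n tau x < 1.
Proof. by case: n => //= n _; exact: tau_itv. Qed.

Lemma tau_small x : 0 <= x -> beta * x < 1 -> tau x = beta * x.
Proof. by move=> x0 bx; rewrite (@tau_def _ 0) ?subr0// mulr_ge0// ltW. Qed.

Lemma iter_tau_small n x : 0 <= x -> beta ^+ n * x < 1 -> iter n tau x = beta ^+ n * x.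
Proof.
move=> x0; elim: n => [|n IH] H /=; first by rewrite mul1r.
have Hn : beta ^+ n * x < 1.
  by rewrite (le_lt_trans _ H)// ler_wpM2r// ler_weXn2l// ltW.
rewrite exprS -mulrA in H *; rewrite IH// tau_small//.
by rewrite mulr_ge0// exprn_ge0// ltW.
Qed.

(** A word of length [N] is represented by a point [f] whose expansion begins with it; the relation
    says that [a] lies in the same cylinder. *)
Definition same_digits N (a f : R) : Prop :=
  forall k, (k < N)%N -> Num.floor (beta * iter k tau a) = Num.floor (beta * iter k tau f).

Lemma same_digits_iter N a f : same_digits N a f ->
  iter N tau a = iter N tau f + beta ^+ N * (a - f).
Proof.
elim: N => [|N IH] H /=; first by rewrite mul1r addrC subrK.
have -> : tau (iter N tau a) = tau (iter N tau f) + beta * (iter N tau a - iter N tau f).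
  by rewrite /beta_shift; move: (H N (leqnn _)); rewrite /beta_shift => ->; ring.
rewrite [X in beta * (X - _)]IH => [|k kN]; last by rewrite H// ltnW.
by rewrite exprS; ring.
Qed.

Lemma same_digitsS N a f : Num.floor (beta * a) = Num.floor (beta * f) ->
  same_digits N (tau a) (tau f) -> same_digits N.+1 a f.
Proof. by move=> af H [|k] kN //; rewrite !iterSr H. Qed.

(** The greedy map is continuous from the right, so finitely many digits survive a small enough
    increase. *)
Lemma same_digits_right N y : 0 <= y < 1 -> exists2 eta : R, 0 < eta &
  forall e, 0 <= e < eta -> y + e < 1 /\ same_digits N (y + e) y.
Proof.
elim: N y => [|N IH] y /andP[y0 y1].
  by exists (1 - y) => [|e]; rewrite ?subr_gt0// ltrBrDl => /andP[].
have [eta' e0' H] := IH _ (tau_itv y).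
exists (Num.min (1 - y) (eta' / beta)).
  by rewrite lt_min subr_gt0 y1 divr_gt0.
move=> e /andP[e0]; rewrite lt_min ltrBrDl ltr_pdivlMr// => /andP[ye be].
split=> //.
have [tbe sd] : tau y + e * beta < 1 /\ same_digits N (tau y + e * beta) (tau y).
  by apply: H; rewrite be mulr_ge0// ltW.
have fE : Num.floor (beta * (y + e)) = Num.floor (beta * y).
  apply: floor_def; rewrite (le_trans (floor_le (beta * y))) ?ler_pM2l ?lerDl//=.
  by move: tbe; rewrite /beta_shift intrD; lra.
apply: same_digitsS => //.
have -> // : tau (y + e) = tau y + e * beta.
by rewrite /beta_shift fE; ring.
Qed.

Definition finite_greedy (y : R) : Prop := 0 <= y < 1 /\ exists N, iter N tau y = 0.

Lemma digits_eq0 w : 0 <= w < 1 ->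
  (forall j, Num.truncn (beta * iter j tau w) = 0%N) -> w = 0.
Proof.
move=> /andP[w0 w1] H.
have wj j : iter j tau w = beta ^+ j * w /\ beta ^+ j * w < 1.
  elim: j => [|j [IH1 IH2]] /=; first by rewrite mul1r.
  have w0' : 0 <= beta ^+ j * w by rewrite mulr_ge0// exprn_ge0// ltW.
  have := H j; rewrite IH1 => /eqP.
  rewrite -leqn0 truncn_le_nat exprS -mulrA => {}H; split=> //.
  by rewrite tau_small.
apply/eqP; apply: contraT => wn0; have wp : 0 < w by rewrite lt_neqAle eq_sym wn0.
have [j jP] := expr_beta_unbounded w^-1.
by have [_] := wj j; rewrite ltNge -ler_pdivrMr// div1r (ltW jP).
Qed.

Lemma finite_greedy_ex y : Fin beta y -> exists n N : nat, [/\ 0 <= y,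
  y / beta ^+ n < 1 & iter N tau (y / beta ^+ n) = 0].
Proof.
move=> [y0 [n [yn [N _ NP]]]]; exists n, N; split => //.
apply: digits_eq0.
  by apply: iter_tau_itv; rewrite yn divr_ge0// exprn_ge0// ltW.
by move=> j; have := NP (j + N)%N (leq_addl _ _); rewrite /beta_digit iterD.
Qed.

(** For [y < 1], division by [beta ^+ n] only prepends [n] zero digits. *)
Lemma Fin_finite_greedy y : Fin beta y -> y < 1 -> finite_greedy y.
Proof.
move=> /finite_greedy_ex[n [N [y0 yn H]]] y1; split; first by rewrite y0.
exists N.
have E : iter n tau (y / beta ^+ n) = y.
  have bn : beta ^+ n != 0 by rewrite expf_neq0.
  rewrite iter_tau_small; first by rewrite mulrC mulfVK.
    by rewrite divr_ge0// exprn_ge0// ltW.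
  by rewrite mulrC mulfVK.
by rewrite -E -iterD addnC iterD H iter_tau0.
Qed.

Definition Zbeta (x : R) : Prop := exists p : {poly int}, x = (map_poly intr p).[beta].

Lemma Zbeta_int k : Zbeta k%:~R.
Proof. by exists k%:P; rewrite map_polyC hornerC. Qed.

Lemma Zbeta_beta : Zbeta beta.
Proof. by exists 'X; rewrite map_polyX hornerX. Qed.

Lemma ZbetaD x y : Zbeta x -> Zbeta y -> Zbeta (x + y).
Proof. by move=> [p ->] [q ->]; exists (p + q); rewrite rmorphD hornerD. Qed.

Lemma ZbetaN x : Zbeta x -> Zbeta (- x).
Proof. by move=> [p ->]; exists (- p); rewrite rmorphN hornerN. Qed.

Lemma ZbetaM x y : Zbeta x -> Zbeta y -> Zbeta (x * y).
Proof. by move=> [p ->] [q ->]; exists (p * q); rewrite rmorphM hornerM. Qed.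

Lemma ZbetaX x n : Zbeta x -> Zbeta (x ^+ n).
Proof. by move=> [p ->]; exists (p ^+ n); rewrite rmorphXn horner_exp. Qed.

Hypothesis Zbeta_inv : Zbeta beta^-1.

Lemma finite_greedy_Zbeta N z : iter N tau z = 0 -> Zbeta z.
Proof.
elim: N z => [|N IH] z; first by move=> /= ->; exact: (Zbeta_int 0).
rewrite iterSr => /IH H.
have -> : z = beta^-1 * (tau z + (Num.floor (beta * z))%:~R).
  by rewrite /beta_shift subrK mulKf.
by apply: ZbetaM => //; apply: ZbetaD => //; exact: Zbeta_int.
Qed.

Lemma Fin_Zbeta y : Fin beta y -> Zbeta y.
Proof.
move=> /finite_greedy_ex[n [N [_ _ /finite_greedy_Zbeta H]]].
rewrite -(@mulfVK _ (beta ^+ n) _ y) ?expf_neq0//.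
by apply: ZbetaM => //; exact/ZbetaX/Zbeta_beta.
Qed.

(** Addition without carry: a small [e] does not disturb the digits of [y] up to the place where
    they end, and from there on only [e] is being read, each zero digit multiplying the remainder by
    [beta]. *)
Lemma finite_greedy_addsmall (ys : seq R) : (forall y, y \in ys -> finite_greedy y) ->
  exists2 eta : R, 0 < eta & exists N0, forall y N e, y \in ys -> (N0 <= N)%N ->
   0 <= e < eta -> y + e < 1 /\ (beta ^+ N * e < 1 -> iter N tau (y + e) = beta ^+ N * e).
Proof.
elim: ys => [_|y ys IH H]; first by exists 1 => //; exists 0%N.
have [eta' e0' [N0' H']] : exists2 eta : R, 0 < eta & exists N0, forall y N e,
  y \in ys -> (N0 <= N)%N ->
   0 <= e < eta -> y + e < 1 /\ (beta ^+ N * e < 1 -> iter N tau (y + e) = beta ^+ N * e).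
  by apply: IH => z zy; apply: H; rewrite inE zy orbT.
have [y01 [N1 yN1]] := H y (mem_head _ _).
have [eta1 e01 H1] := same_digits_right N1 y01.
exists (Num.min eta1 eta'); first by rewrite lt_min e01.
exists (maxn N1 N0') => z N e; rewrite inE geq_max lt_min => zy /andP[N1N N0N] /and3P[e0
  ee1 ee'].
case/orP: zy => [/eqP ->|zys]; last by apply: H'; rewrite ?e0.
have [ye sd] := H1 e (introT andP (conj e0 ee1)); split=> // Ne.
have := same_digits_iter sd; rewrite yN1 add0r addrAC subrr add0r => E.
rewrite -(subnK N1N) iterD E iter_tau_small ?mulrA ?exprD// -?exprD ?subnK//.
by rewrite mulr_ge0// exprn_ge0// ltW.
Qed.

Lemma finite_greedy_add (ys : seq R) : (forall y, y \in ys -> finite_greedy y) ->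
  exists2 eta : R, 0 < eta & forall y e, y \in ys -> 0 <= e < eta -> finite_greedy e ->
    finite_greedy (y + e).
Proof.
move=> ysF; have [eta e0 [N H]] := finite_greedy_addsmall ysF.
(* Below [(beta ^+ N)^-1], the expansion of [e] starts with [N] zeros, so it follows that of [y] as
   a concatenation. *)
exists (Num.min eta (beta ^+ N)^-1); first by rewrite lt_min e0 invr_gt0 exprn_gt0.
move=> y e yys /andP[e0']; rewrite lt_min => /andP[ee eN] [_ [K eK]].
have Ne : beta ^+ N * e < 1 by rewrite mulrC -ltr_pdivlMr ?exprn_gt0// div1r.
have [ye /(_ Ne) yN] := H y N e yys (leqnn N) (introT andP (conj e0' ee)).
have eN' := iter_tau_small e0' Ne.
split; last first.
  by exists (K + N)%N; rewrite iterD yN -eN' -iterD addnC iterD eK iter_tau0.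
by rewrite ye andbT addr_ge0//; have [/andP[]] := ysF y yys.
Qed.

(** Weak finitarity treats one [x] at a time. With [f] found for the other elements, it is applied
    to [x + f] and yields a [g] so small that adding it keeps finite what was already finite;
    [f + g] is the new shift. *)
Lemma common_finite_shift (xs : seq R) (delta : R) : weakly_finitary beta ->
  (forall x, x \in xs -> Zbeta x /\ 0 <= x < 1) -> 0 < delta ->
  exists f, [/\ f < delta, Zbeta f, finite_greedy f & forall x, x \in xs ->
    finite_greedy (x + f)].
Proof.
move=> W; elim: xs delta => [|x xs IH] delta H d0.
  exists 0; split => //; first exact: (Zbeta_int 0).
  by split; [rewrite lexx ltr01|exists 0%N].
have [Zx /andP[x0 x1]] := H x (mem_head _ _).
have [||f [fd Zf Ff Ffs]] := IH (Num.min (delta / 2) ((1 - x) / 2)).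
- by move=> z zs; apply: H; rewrite inE zs orbT.
- by rewrite lt_min !divr_gt0// subr_gt0.
move: fd; rewrite lt_min => /andP[fd fx].
have [f0 f1] : 0 <= f /\ f < 1 by have [/andP[]] := Ff.
(* [f] itself belongs to the list, so that [f + g] stays finite too. *)
have ysF y : y \in f :: [seq z + f | z <- xs] -> finite_greedy y.
  by rewrite inE => /orP[/eqP ->//|/mapP[z zs ->]]; exact: Ffs.
have [eta e0 etaP] := finite_greedy_add ysF.
have [p xfE] := ZbetaD Zx Zf.
have [] := W (Num.min eta (Num.min (delta / 2) ((1 - x) / 2))) _ p.
- by rewrite !lt_min e0 !divr_gt0// subr_gt0.
- by rewrite -xfE addr_ge0.
rewrite -xfE => g [Fg]; rewrite !lt_min => /and3P[ge gd gx] Fxg.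
have g0 : 0 <= g by case: Fg.
have FTg : finite_greedy g by apply: Fin_finite_greedy => //; lra.
exists (f + g); split; first lra.
- by apply: ZbetaD => //; exact: Fin_Zbeta.
- by apply: etaP; rewrite ?mem_head ?g0.
move=> z; rewrite inE => /orP[/eqP ->|zs]; rewrite addrA.
  by apply: Fin_finite_greedy => //; lra.
by apply: etaP; rewrite ?g0// inE (map_f (+%R^~ f) zs) orbT.
Qed.

(** The shift [f] makes [f] and every [- g + f] with [- g] in [0, 1) finite. Once [a] agrees with
    [f] for [N] digits, both [a] and [a - g] are such finite numbers plus [a - f], added without
    carry, so both arrive at [beta ^+ N * (a - f)]. *)
Lemma sync_word (gs : seq R) : weakly_finitary beta -> (forall g, g \in gs -> Zbeta g) ->
  exists f N, 0 <= f < 1 /\ forall g a, g \in gs -> 0 <= a < 1 -> same_digits N a f ->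
    0 <= a - g < 1 -> iter N tau (a - g) = iter N tau a.
Proof.
move=> W gZ.
(* [d] bounds the positive elements of [gs] from below. Since [f] and [a - f] will be less than
   [d / 2], a positive [g] would make [a - g] negative. *)
have [d d0 dP] : exists2 d : R, 0 < d & forall g, g \in gs -> 0 < g -> d <= g.
  elim: (gs) => [|g s [d d0 IH]]; first by exists 1.
  exists (if 0 < g then Num.min d g else d); first by case: ifP; rewrite // lt_min d0.
  move=> z; rewrite inE => /orP[/eqP -> g0|zs z0]; first by rewrite g0 ge_min lexx orbT.
  by case: ifP; rewrite ?ge_min IH.
pose xs := [seq x <- [seq - g | g <- gs] | 0 <= x < 1].
have [||f [fd Zf Ff fxs]] := @common_finite_shift xs (d / 2) W; last 1 first.
- have ysF y : y \in f :: [seq z + f | z <- xs] -> finite_greedy y.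
    by rewrite inE => /orP[/eqP ->//|/mapP[z zs ->]]; exact: fxs.
  have [eta e0 [N0 etaP]] := finite_greedy_addsmall ysF.
  have [f01 [N1 fN1]] := Ff.
  (* Agreement for [N] digits gives [a - f < beta ^- N], which has to be below both [eta] and
     [d / 2]. *)
  have [N2 N2P] := expr_beta_unbounded (eta^-1 + 2 / d).
  pose N := maxn (maxn N0 N1) N2.
  have bN : eta^-1 + 2 / d < beta ^+ N.
    by rewrite (lt_le_trans N2P)// ler_weXn2l ?ltW// leq_maxr.
  exists f, N; split=> // g a ggs a01 sd ag01.
  have fN : iter N tau f = 0.
    have N1N : (N1 <= N)%N by rewrite /N -maxnA leq_max leq_max leqnn !orbT.
    by rewrite -(subnK N1N) iterD fN1 iter_tau0.
  have aE := same_digits_iter sd; rewrite fN add0r in aE.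
  have /andP[af0 af1] := iter_tau_itv N a01; rewrite aE in af0 af1.
  have bN0 : 0 < beta ^+ N by rewrite exprn_gt0.
  have af : 0 <= a - f by rewrite -(pmulr_rge0 _ bN0).
  have ei : 0 < eta^-1 by rewrite invr_gt0.
  have di : 0 < 2 / d by rewrite divr_gt0.
  have afe : a - f < eta.
    rewrite -(ltr_pM2l bN0) (lt_le_trans af1)// -ler_pdivrMr// div1r; lra.
  have afd : a - f < d / 2.
    rewrite -(ltr_pM2l bN0) (lt_le_trans af1)// -ler_pdivrMr ?divr_gt0// div1r invf_div; lra.
  have N0N : (N0 <= N)%N by rewrite /N -maxnA leq_max leqnn.
  have [g0|g0] := ltP 0 g.
    have := dP g ggs g0; lra.
  have gx : - g \in xs by rewrite mem_filter map_f// andbT; lra.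
  have [] := etaP (- g + f) N (a - f) _ N0N (introT andP (conj af afe)).
    by rewrite inE (map_f (+%R^~ f) gx) orbT.
  move=> _ /(_ af1); rewrite aE => <-; congr (iter N tau _); ring.
- move=> x; rewrite mem_filter => /andP[x01 /mapP[g ggs xg]]; split => //.
  by rewrite xg; exact/ZbetaN/gZ.
- by rewrite divr_gt0.
Qed.

End Greedy.

(** * Points whose expansion avoids a word *)

Section Covering.
Variables (R : realType) (beta : R).
Hypothesis b1 : 1 < beta.
Local Notation tau := (beta_shift beta).

Let b0 : 0 < beta. Proof. exact: lt_trans b1. Qed.
Let bn0 : beta != 0. Proof. by rewrite gt_eqF. Qed.

(** Covers by finitely many intervals, given by left end and width; the widths are positive so that
    each interval can be enlarged to an open slab. *)
Definition small_cover (A : set R) (w : R) : Prop := exists s : seq (R * R),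
  [/\ forall p, p \in s -> 0 < p.2 <= 1,
      forall a, A a -> exists2 p, p \in s & p.1 <= a <= p.1 + p.2 &
      \sum_(p <- s) p.2 <= w].

Lemma small_cover_sub (A B : set R) (w w' : R) : A `<=` B -> w <= w' ->
  small_cover B w -> small_cover A w'.
Proof.
by move=> AB ww [s [s1 s2 s3]]; exists s; split => // [a /AB/s2//|]; exact: le_trans ww.
Qed.

Lemma small_cover0 (A : set R) (w : R) : (forall a, ~ A a) -> 0 <= w -> small_cover A w.
Proof. by move=> A0 w0; exists [::]; split => // [a /A0//|]; rewrite big_nil. Qed.

Lemma small_coverU (A B : set R) (w w' : R) : small_cover A w -> small_cover B w' ->
  small_cover (A `|` B) (w + w').
Proof.
move=> [s [s1 s2 s3]] [t [t1 t2 t3]]; exists (s ++ t); split.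
- by move=> p; rewrite mem_cat => /orP[/s1|/t1].
- by move=> a [/s2|/t2] [p ps pa]; exists p; rewrite // mem_cat ps ?orbT.
by rewrite big_cat lerD.
Qed.

Lemma small_cover_branch (A : set R) (w k : R) : small_cover A w ->
  small_cover [set a | A (beta * a - k)] (w / beta).
Proof.
move=> [s [s1 s2 s3]]; exists [seq ((p.1 + k) / beta, p.2 / beta) | p <- s]; split.
- move=> _ /mapP[p /s1/andP[p0 p1] ->] /=; rewrite divr_gt0//= ler_pdivrMr// mul1r.
  by rewrite (le_trans p1)// ltW.
- move=> a /s2[p ps /andP[p1 p2]]; exists ((p.1 + k) / beta, p.2 / beta).
    exact: (map_f (fun p => ((p.1 + k) / beta, p.2 / beta))).
  by rewrite /= -mulrDl ler_pdivrMr// ler_pdivlMr//; lra.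
by rewrite big_map /= -mulr_suml ler_pM2r ?invr_gt0.
Qed.

Lemma small_cover_sum (D : nat) (A : nat -> set R) (w : nat -> R) :
  (forall d, (d < D)%N -> small_cover (A d) (w d)) ->
  small_cover [set a | exists2 d, (d < D)%N & A d a] (\sum_(d < D) w d).
Proof.
elim: D => [|D IH] H; first by rewrite big_ord0; apply: small_cover0 => // a [].
rewrite big_ord_recr /=.
apply: small_cover_sub (lexx _) (small_coverU (IH _) (H D (leqnn _))) => [a [d]|d dD];
  last by apply: H; rewrite ltnW.
by rewrite ltnS leq_eqVlt => /orP[/eqP -> Aa|dD Aa]; [right|left; exists d].
Qed.

Variables (f : R) (N : nat).

(** [n] counts the positions at which the word [f] could start. *)
Definition avoid n : set R :=
  [set a | 0 <= a < 1 /\ forall k, (k < n)%N -> ~ same_digits beta N (iter k tau a) f].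

Lemma avoid_tau n a : avoid n.+1 a -> avoid n (tau a).
Proof.
move=> [a01 H]; split; first exact: tau_itv.
by move=> k kn; rewrite -iterSr; apply: H.
Qed.

Lemma avoid_mono n n' a : (n <= n')%N -> avoid n' a -> avoid n a.
Proof. by move=> nn [a01 H]; split => // k kn; apply: H; exact: leq_trans nn. Qed.

(** All initial intervals [0, c) are treated at once, with a bound proportional to [c], because the
    last branch of the greedy map over [0, c) has such an interval as its image. *)
Definition covered (s : R) : Prop := forall c, 0 <= c <= 1 ->
  exists n, small_cover (avoid n `&` [set a | a < c]) (s * c).

Lemma covered1 : covered 1.
Proof.
move=> c /andP[]; rewrite le_eqVlt => /orP[/eqP <- _|c0 c1]; exists 0%N.
  rewrite mulr0; apply: small_cover0 => // a [[/andP[a0 _] _]] /=; by rewrite ltNge a0.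
exists [:: (0, c)]; split => [p||]; first by rewrite inE => /eqP -> /=; rewrite c0.
  by move=> a [[/andP[a0 _] _]] /= ac; exists (0, c); rewrite ?mem_head//= a0 add0r ltW.
by rewrite big_seq1 mul1r.
Qed.

(* [D] full branches of the greedy map meet [0, c), together with the initial
   part [0, c') of one more; the branch [d0] is covered at a discount [kappa]. *)
Lemma covered_split (s c kappa : R) (d0 : nat) (S : set R) :
  let D := Num.truncn (beta * c) in
  let top d := if (d < D)%N then 1 else beta * c - D%:R in
  0 <= c <= 1 -> (d0 <= D)%N -> covered s ->
  (exists n, small_cover (avoid n `&` [set a | a < top d0] `&` S) (s * (top d0 - kappa))) ->
  exists n, small_cover [set a | [/\ avoid n a, a < c &
     Num.floor (beta * a) = d0 -> S (tau a)]] (s * (c - kappa / beta)).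
Proof.
move=> D top /andP[c0 c1] d0D sP [n0 n0P].
have bc0 : 0 <= beta * c by rewrite mulr_ge0// ltW.
have /andP[D1 D2] := truncn_itv bc0.
have top01 d : 0 <= top d <= 1.
  rewrite /top; case: ifP => _; first by rewrite ler01 lexx.
  by rewrite -natr1 in D2; rewrite -/D in D1 D2; lra.
pose A d n := avoid n `&` [set a | a < top d] `&` (if d == d0 then S else setT).
pose w d := s * (top d - (if d == d0 then kappa else 0)).
have /choice[nn nnP] d : exists n, small_cover (A d n) (w d).
  rewrite /A /w; case: eqP => [->|_]; first by exists n0.
  by have [n nP] := sP _ (top01 d); exists n; rewrite setIT subr0.
pose n := (\max_(d < D.+1) nn d)%N.
exists n.+1.
have H d : (d < D.+1)%N -> small_cover [set a | A d n (beta * a - d%:R)] (w d / beta).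
  move=> dD; apply: small_cover_branch;
    apply: small_cover_sub (lexx _) (nnP d) => a [[an ad] aS].
  split=> //; split=> //; apply: avoid_mono an.
  exact: (leq_bigmax (Ordinal dD)).
apply: small_cover_sub (small_cover_sum H).
  move=> a [an ac aS]; have [/andP[a0 a1] _] := an.
  have ba0 : 0 <= beta * a by rewrite mulr_ge0// ltW.
  have bac : beta * a < beta * c by rewrite ltr_pM2l.
  have fE : Num.floor (beta * a) = Num.truncn (beta * a) by rewrite truncn_floor ba0
    gez0_abs// floor_ge0.
  have tE : tau a = beta * a - (Num.truncn (beta * a))%:R by rewrite /beta_shift fE.
  have dD : (Num.truncn (beta * a) <= D)%N by apply: le_truncn; exact: ltW.
  exists (Num.truncn (beta * a)) => //; rewrite /A /= -tE; split; last first.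
    by case: eqP => // dE; apply: aS; rewrite fE dE.
  split; first exact: avoid_tau.
  rewrite /top; case: ltnP => [_|Dd] /=; first by have /andP[] := tau_itv beta a.
  have -> : D = Num.truncn (beta * a) by apply/eqP; rewrite eqn_leq dD Dd.
  by rewrite tE; lra.
(* The lengths [top d] add up to [beta * c], and only the branch [d0] is discounted. *)
rewrite -mulr_suml /w -mulr_sumr sumrB.
rewrite (bigD1 (Ordinal (d0D : (d0 < D.+1)%N)))//= [X in _ - X](bigD1 (Ordinal (d0D : (d0
  < D.+1)%N)))//= eqxx.
rewrite [X in _ - (_ + X)]big1 => [|i]; last first.
  by rewrite -val_eqE /= => /negbTE ->.
rewrite addr0.
have -> : top d0 + \sum_(i < D.+1 | i != Ordinal (d0D : (d0 < D.+1)%N)) top i = \sum_(i <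
  D.+1) top i.
  by rewrite [RHS](bigD1 (Ordinal (d0D : (d0 < D.+1)%N))).
rewrite big_ord_recr /= (eq_bigr (fun=> 1)) => [|i _]; last by rewrite /top ltn_ord.
rewrite sumr_const card_ord {1}/top ltnn addrC subrK.
by rewrite le_eqVlt; apply/orP; left; apply/eqP; field.
Qed.

(** Following the digits of [g], one branch at each step leads towards its cylinder; after [M] steps
    the remaining piece, of positive length since [g < c], lies in the cylinder and needs no cover.
    The gain [kappa] is independent of [s], so it can be used repeatedly. *)
Lemma covered_discount M g c : 0 <= g < c -> c <= 1 -> exists2 kappa : R, 0 < kappa &
  forall s, covered s -> exists n, small_cover (avoid n `&` [set a | a < c] `&`
     [set a | ~ same_digits beta M a g]) (s * (c - kappa)).
Proof.
elim: M g c => [|M IH] g c /andP[g0 gc] c1.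
  exists c => [|s _]; first exact: le_lt_trans gc.
  exists 0%N; apply: small_cover0; last by rewrite subrr mulr0.
  by move=> a [_]; apply.
have bg0 : 0 <= beta * g by rewrite mulr_ge0// ltW.
have bgc : beta * g < beta * c by rewrite ltr_pM2l.
have bc0 : 0 <= beta * c by apply: le_trans (ltW bgc).
pose D := Num.truncn (beta * c).
pose top d : R := if (d < D)%N then 1 else beta * c - D%:R.
have /andP[D1 D2] := truncn_itv bc0.
pose d0 := Num.truncn (beta * g).
have d0D : (d0 <= D)%N by apply: le_truncn; exact: ltW.
have fE : Num.floor (beta * g) = d0 by rewrite /d0 truncn_floor bg0 gez0_abs// floor_ge0.
have tE : tau g = beta * g - d0%:R by rewrite /beta_shift fE.
have gtop : 0 <= tau g < top d0.
  have /andP[-> t1] := tau_itv beta g; rewrite /top; case: ltnP => // Dd.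
  have -> : D = d0 by apply/eqP; rewrite eqn_leq d0D Dd.
  by rewrite tE; lra.
have top1 : top d0 <= 1.
  rewrite /top; case: ifP => _ //; by rewrite -natr1 -/D in D2; lra.
have [k' k'0 k'P] := IH _ _ gtop top1.
exists (k' / beta) => [|s sP]; first by rewrite divr_gt0.
have c01 : 0 <= c <= 1 by lra.
have [n nP] := covered_split c01 d0D sP (k'P s sP).
exists n; apply: small_cover_sub (lexx _) nP => a [[an ac] ad]; split => // aE sd.
by apply: ad; apply: same_digitsS => //; rewrite fE.
Qed.

Hypothesis f01 : 0 <= f < 1.

Lemma covered_unit : exists2 kappa : R, 0 < kappa <= 1 &
  forall s, 0 <= s -> covered s -> exists n,
    small_cover (avoid n `&` [set a | a < 1]) (s * (1 - kappa)).
Proof.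
have [k k0 kP] := covered_discount N f01 (lexx 1).
exists (Num.min k 1); first by rewrite lt_min k0 ltr01 ge_min lexx orbT.
move=> s s0 /kP[n nP]; exists n.+1; apply: small_cover_sub nP; last first.
  by rewrite ler_wpM2l// lerD2l lerN2 ge_min lexx.
move=> a [an a1]; split; last by have [_ /(_ 0%N)] := an; apply.
by split=> //; exact: avoid_mono an.
Qed.

(** If [c] exceeds [beta^-1], then [0, c) contains the full branch of digit 0, where [covered_unit]
    saves a fixed proportion. A smaller [c] is multiplied by [beta] until it does; below [beta^-1]
    the greedy map is just this multiplication. *)
Lemma covered_step : exists2 r : R, 0 <= r < 1 & forall s, 0 <= s -> covered s ->
  covered (s * r).
Proof.
have [k /andP[k0 k1] kP] := covered_unit.
have kb0 : 0 < k / beta by rewrite divr_gt0.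
have kb1 : k / beta <= 1 by rewrite ler_pdivrMr// mul1r (le_trans k1)// ltW.
exists (1 - k / beta) => [|s s0 sP]; first lra.
have [n1 n1P] := kP s s0 sP.
have big c : beta^-1 < c <= 1 -> exists n,
  small_cover (avoid n `&` [set a | a < c]) (s * (1 - k / beta) * c).
  move=> /andP[cb c1]; have c0 : 0 < c by apply: lt_trans cb; rewrite invr_gt0.
  have c01 : 0 <= c <= 1 by rewrite ltW.
  have D1 : (0 < Num.truncn (beta * c))%N.
    by rewrite truncn_gt0 -(mulfV bn0) ler_pM2l// ltW.
  have [|n nP] := @covered_split s c k 0 setT c01 (leq0n _) sP.
    by exists n1; rewrite setIT D1.
  exists n; apply: small_cover_sub nP; first by move=> a [].
  rewrite -mulrA ler_wpM2l//; nra.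
have all j c : 0 < c <= 1 -> beta^-1 < beta ^+ j * c -> exists n,
  small_cover (avoid n `&` [set a | a < c]) (s * (1 - k / beta) * c).
  elim: j c => [|j IH] c /andP[c0 c1]; first by rewrite mul1r => cb; apply: big; rewrite cb.
  have [cb _|cb] := ltP beta^-1 c; first by apply: big; rewrite cb.
  rewrite exprSr -mulrA => /IH[|n nP].
    by rewrite mulr_gt0//= mulrC -ler_pdivlMr// div1r.
  exists n.+1; have := small_cover_branch 0 nP; apply: small_cover_sub; last first.
    by rewrite le_eqVlt; apply/orP; left; apply/eqP; field.
  move=> a [an ac] /=; have [/andP[a0 a1] _] := an.
  have ba : beta * a < 1.
    by rewrite mulrC -ltr_pdivlMr// div1r (lt_le_trans ac).
  by rewrite subr0; split; [rewrite -tau_small//; exact: avoid_tau|rewrite /= ltr_pM2l].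
move=> c /andP[]; rewrite le_eqVlt => /orP[/eqP <- _|c0 c1].
  exists 0%N; rewrite mulr0; apply: small_cover0 => // a [[/andP[a0 _] _]] /=;
    by rewrite ltNge a0.
have [j jP] := expr_beta_unbounded b1 (beta^-1 / c).
by apply: (all j); rewrite ?c0// -ltr_pdivrMr.
Qed.

Lemma avoid_small_cover (e : R) : 0 < e -> exists n, small_cover (avoid n) e.
Proof.
have [r /andP[r0 r1] rP] := covered_step.
have cr j : covered (r ^+ j).
  elim: j => [|j IH]; first exact: covered1.
  by rewrite exprSr; apply: rP => //; rewrite exprn_ge0.
move=> e0.
have [j je] : exists j, r ^+ j <= e.
  have [rp|rn] := ltP 0 r; last first.
    by exists 1%N; rewrite expr1 (le_trans rn)// ltW.
  have r1' : 1 < r^-1 by rewrite invf_gt1.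
  have [j jP] := expr_beta_unbounded r1' e^-1; exists j.
  by rewrite exprVn ltf_pV2 ?posrE ?exprn_gt0// in jP; exact: ltW.
have [|n nP] := cr j 1; first by rewrite ler01 lexx.
exists n; apply: small_cover_sub nP; last by rewrite mulr1.
by move=> a an; split=> //=; have [/andP[]] := an.
Qed.

End Covering.

(** * Admissible sequences *)

Section Parry.
Variables (R : realType) (beta : R).
Hypothesis b1 : 1 < beta.
Local Notation tau := (beta_shift beta).

Let b0 : 0 < beta. Proof. exact: lt_trans b1. Qed.
Let bn0 : beta != 0. Proof. by rewrite gt_eqF. Qed.

(** [a k] is the value of the tail of [e] from place [k], given by its recursion instead of by a
    series. *)
Definition digit_values (e : nat -> nat) (a : nat -> R) : Prop :=
  forall k, beta * a k = (e k)%:R + a k.+1.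

Lemma tau_digit x : 0 <= x -> beta * x = (Num.truncn (beta * x))%:R + tau x.
Proof.
move=> x0; have bx : 0 <= beta * x by rewrite mulr_ge0// ltW.
by rewrite /beta_shift truncn_floor bx pmulrn gez0_abs ?floor_ge0// addrC subrK.
Qed.

(** The tail values of the sequence [d]. They are the greedy orbit of 1 when it never reaches 0.
    Otherwise this orbit is repeated periodically: lowering the last nonzero digit by one turns the
    remainder 0 at that place into 1, the start of the next period. *)
Lemma quasi_greedy_values : exists r : nat -> R,
  [/\ r 0%N = 1, forall j, 0 < r j <= 1 & digit_values (quasi_greedy beta) r].
Proof.
pose t j := iter j tau 1.
have t01 j : 0 <= t j <= 1.
  case: j => [|j]; first by rewrite /t /= ler01 lexx.
  by have /andP[t0 t1] := tau_itv beta (t j); rewrite /t /= t0 ltW.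
have tS j : beta * t j = (beta_digit beta 1 j)%:R + t j.+1.
  by rewrite /t /= -tau_digit//; have /andP[] := t01 j.
have d0 : beta_digit beta 1 0 <> 0%N.
  by apply/eqP; rewrite -lt0n /beta_digit /= mulr1 truncn_gt0 ltW.
have tz i j : t i = 0 -> (i <= j)%N -> t j = 0.
  by move=> ti ij; rewrite /t -(subnK ij) iterD -/(t i) ti iter_tau0.
have dz i j : t i = 0 -> (i <= j)%N -> beta_digit beta 1 j = 0%N.
  by move=> ti ij; rewrite /beta_digit -/(t j) (tz i)// mulr0 truncn0.
rewrite /quasi_greedy; have [[n0 _ fin]|inf] := pselect (\forall k \near \oo,
  beta_digit beta 1 k = 0%N).
  have E : `[< \forall k \near \oo, beta_digit beta 1 k = 0%N >] by apply/asboolP; exists n0.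
  rewrite E; set S := [set k | _].
  have [K0 K0P] : exists k, S k.
    have ex : exists k, beta_digit beta 1 k != 0%N by exists 0%N; apply/eqP.
    have ub k : beta_digit beta 1 k != 0%N -> (k <= n0)%N.
      by apply: contraNT; rewrite -ltnNge => /ltnW /fin /= ->.
    case: (ex_maxnP ex ub) => K /eqP KP Kmax; exists K; split => // j Kj.
    by apply/eqP; apply: contraTT Kj => /Kmax; rewrite -leqNgt.
  have := @xgetPex _ 0%N S (ex_intro _ K0 K0P); move: (xget _ _) => K [KP Kmax].
  have tK j : (j <= K)%N -> 0 < t j.
    move=> jK; have /andP[tj _] := t01 j; rewrite lt_neqAle tj andbT.
    by apply/eqP => /esym tj0; exact/KP/(dz j).
  have tK1 : t K.+1 = 0.
    apply: (digits_eq0 b1); first exact: tau_itv.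
    by move=> j; have := Kmax (j + K.+1)%N (leq_addl _ _); rewrite /beta_digit iterD.
  exists (fun j => t (j %% K.+1)%N); split => [|j|j]; first by rewrite mod0n.
    by rewrite tK ?leq_mod1 ?andTb //;
      [have /andP[] := t01 (j %% K.+1)%N|rewrite -ltnS ltn_mod].
  have := ltn_mod j K.+1; rewrite ltnS => jK.
  rewrite tS; case: eqVneq => [jE|jN].
    rewrite -[j.+1]addn1 -(modnDml j 1) jE addn1 modnn tK1 addr0 [t _]/(t 0%N) /t /=.
    by rewrite -[X in X%:R]prednK ?natr1// lt0n; apply/eqP.
  suff -> : (j.+1 %% K.+1 = (j %% K.+1).+1)%N by [].
  have lt : ((j %% K.+1).+1 < K.+1)%N by rewrite ltnS ltn_neqAle jN.
  by rewrite -[j.+1]addn1 -(modnDml j 1) addn1 (modn_small lt).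
exists t; split => // [j|j]; last first.
  by rewrite tS; case: asboolP => // /inf.
have /andP[tj ->] := t01 j; rewrite andbT lt_neqAle tj andbT.
by apply/eqP => /esym tj0; apply: inf; exists j => // k /= jk; exact: (dz j).
Qed.

Lemma digit_values_agree e d a r i : digit_values e a -> digit_values d r ->
  (forall j, (j < i)%N -> e j = d j) -> beta ^+ i * (a 0%N - r 0%N) = a i - r i.
Proof.
move=> ea dr; elim: i => [|i IH] H; first by rewrite mul1r.
rewrite exprS -mulrA IH => [|j ji]; last by rewrite H// ltnW.
by rewrite mulrBr ea dr H//; ring.
Qed.

Lemma digit_values_shift e a k : digit_values e a ->
  digit_values (fun i => e (k + i)%N) (fun i => a (k + i)%N).
Proof. by move=> H i; rewrite H addnS. Qed.

(** As long as [e] agrees with [d], the gap [1 - a 0] is multiplied by [beta]. Boundedness forces a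
    disagreement, and there the sign of the gap decides which digit is smaller. *)
Lemma values_lex e a : digit_values e a -> (forall k, 0 <= a k < 1) ->
  lex_lt e (quasi_greedy beta).
Proof.
move=> ea a01; have [r [r0 r01 dr]] := quasi_greedy_values.
have [a00 a01'] := andP (a01 0%N).
have [ex|nex] := pselect (exists i, e i != quasi_greedy beta i); last first.
  have H j : e j = quasi_greedy beta j by apply/eqP; apply: contrapT => /negP H;
    apply: nex; exists j.
  have [i iP] := expr_beta_unbounded b1 (1 - a 0%N)^-1.
  have := digit_values_agree ea dr (fun j (_ : (j < i)%N) => H j); rewrite r0.
  have a1 : 0 < 1 - a 0%N by rewrite subr_gt0.
  move: iP; rewrite -(ltr_pM2r a1) mulVf ?gt_eqF// => iP.
  have /andP[ai0 ai1] := a01 i; have /andP[ri0 ri1] := r01 i.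
  lra.
case: (ex_minnP ex) => i ni mini; exists i.
have agree j : (j < i)%N -> e j = quasi_greedy beta j.
  by move=> ji; apply/eqP; apply: contraTT ji => /mini; rewrite -leqNgt.
split=> //; rewrite ltn_neqAle ni /=.
have := digit_values_agree ea dr agree; rewrite r0 => E.
have : a i - r i < 0 by rewrite -E pmulr_rlt0 ?exprn_gt0// subr_lt0.
rewrite -(pmulr_rlt0 _ b0) mulrBr ea dr => H.
have /andP[ai0 ai1] := a01 i.+1; have /andP[ri0 ri1] := r01 i.+1.
by rewrite -ltnS -(ltr_nat R) -natr1; lra.
Qed.

(** A bound [1 + X] on all tails improves to [1 + X / beta]: at the first disagreement the digit of
    [e] is smaller by at least one, which absorbs the 1. Iteration gives the bound 1, and one more
    round with [X = 0] makes it strict since the tail values of [d] are positive. *)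
Lemma lex_values e a (C : R) : digit_values e a -> (forall k, a k <= C) ->
  (forall k, lex_lt (fun i => e (k + i)%N) (quasi_greedy beta)) -> forall k, a k < 1.
Proof.
move=> ea aC elex; have [r [r0 r01 dr]] := quasi_greedy_values.
have key X : 0 <= X -> (forall k, a k <= 1 + X) -> forall k, a k < 1 + X / beta.
  move=> X0 aX k; have [i [agree ei]] := elex k.
  have := digit_values_agree (digit_values_shift k ea) dr agree; rewrite r0 addn0 => E.
  have := digit_values_shift k ea i; rewrite addnS => E'; have := dr i => E''.
  have /andP[ri0 ri1] := r01 i.+1; have := aX (k + i).+1 => aX'.
  have ei' : (e (k + i)%N)%:R + 1 <= (quasi_greedy beta i)%:R :> R by rewrite natr1 ler_nat.
  have H : beta ^+ i.+1 * (a k - 1) < X by rewrite exprS -mulrA E mulrBr E' E''; lra.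
  rewrite -ltrBlDl ltr_pdivlMr//.
  have [ak|ak] := lerP (a k - 1) 0.
    have : (a k - 1) * beta <= 0 by rewrite pmulr_lle0.
    rewrite le_eqVlt => /orP[/eqP ak0|ak0]; last exact: lt_le_trans ak0 X0.
    have ak1 : a k - 1 = 0 by apply/eqP; move/eqP: ak0; rewrite mulf_eq0 (negbTE bn0) orbF.
    by move: H; rewrite ak1 mulr0 mul0r.
  apply: le_lt_trans H; rewrite exprSr -mulrA [_ * beta]mulrC ler_peMl//.
    by rewrite mulr_ge0// ltW.
  by rewrite exprn_ege1// ltW.
have bd n : forall k, a k <= 1 + `|C| / beta ^+ n.
  elim: n => [|n IH] k.
    by rewrite divr1 (le_trans (aC k))// (le_trans (ler_norm _))// lerDr.
  rewrite exprSr invfM mulrA; apply: ltW; apply: key => //.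
  by rewrite divr_ge0// exprn_ge0// ltW.
move=> k; have := key 0 (lexx _); rewrite mul0r addr0; apply=> {}k.
rewrite leNgt; apply/negP => ak.
have ak0 : 0 < a k - 1 by rewrite subr_gt0.
have [n nP] := expr_beta_unbounded b1 (`|C| / (a k - 1)).
have := bd n k; rewrite leNgt => /negP; apply.
by rewrite -ltrBrDl ltr_pdivrMr ?exprn_gt0// mulrC -ltr_pdivrMr.
Qed.

Lemma digit_values_ex (e : nat -> nat) (B : nat) : (forall k, (e k <= B)%N) ->
  exists2 a, digit_values e a & forall k, 0 <= a k <= B%:R / (beta - 1).
Proof.
move=> eB.
pose S k n : R := \sum_(j < n) (e (k + j)%N)%:R / beta ^+ j.+1.
have SS k n : beta * S k n.+1 = (e k)%:R + S k.+1 n.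
  rewrite /S big_ord_recl /= addn0 expr1 mulrDr mulrC mulfVK//; congr (_ + _).
  rewrite mulr_sumr; apply: eq_bigr => j _; rewrite /bump /= add1n addnS addSn.
  by rewrite mulrC [beta ^+ j.+2]exprSr invfM mulrA mulfVK.
have bb : 0 < beta - 1 by rewrite subr_gt0.
have Sb n : forall k, S k n <= B%:R / (beta - 1).
  elim: n => [|n IH] k; first by rewrite /S big_ord0 divr_ge0// ltW.
  rewrite -(ler_pM2l b0) SS.
  have ekB : (e k)%:R <= B%:R :> R by rewrite ler_nat.
  apply: le_trans (lerD ekB (IH k.+1)) _.
  by rewrite le_eqVlt; apply/orP; left; apply/eqP; field; rewrite gt_eqF.
have S0 k n : 0 <= S k n.
  by apply: sumr_ge0 => j _; rewrite divr_ge0// exprn_ge0// ltW.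
have Snd k : nondecreasing_seq (S k).
  apply/nondecreasing_seqP => n; rewrite /S big_ord_recr /= lerDl.
  by rewrite divr_ge0// exprn_ge0// ltW.
have Scvg k : cvgn (S k).
  apply: nondecreasing_is_cvgn => //; exists (B%:R / (beta - 1)) => _ [n _ <-]; exact: Sb.
exists (fun k => limn (S k)) => k; last first.
  by rewrite limr_ge ?limr_le//; near=> n; [exact: Sb|exact: S0].
have H1 : beta * S k n.+1 @[n --> \oo] --> beta * limn (S k).
  by apply: cvgMr; rewrite (cvg_shiftS (S k)); exact: Scvg.
have H2 : (e k)%:R + S k.+1 n @[n --> \oo] --> (e k)%:R + limn (S k.+1).
  by apply: cvgD; [exact: cvg_cst|exact: Scvg].
have E : (fun n => beta * S k n.+1) = (fun n => (e k)%:R + S k.+1 n).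
  by apply/funext => n; exact: SS.
by move: H1; rewrite E => H1; exact: (cvg_unique _ H1 H2).
Unshelve. all: by end_near.
Qed.

End Parry.

(** Parry's criterion in the form used for orbits: the lexicographic condition is traded for tail
    values in [0, 1). *)
Lemma compactum_values (R : realType) (beta : R) (e : int -> nat) : 1 < beta ->
  beta_compactum beta e <->
  exists a : int -> R, forall k, 0 <= a k < 1 /\ beta * a k = (e k)%:R + a (k + 1).
Proof.
move=> b1; have b0 : 0 < beta by exact: lt_trans b1.
split=> [[eB elex]|[a aP]].
  have /choice[A AP] (k : int) : exists a : nat -> R,
      digit_values beta (fun i => e (k + i%:Z)) a /\ forall i, 0 <= a i < 1.
    have [a ea aB] := digit_values_ex b1 (fun i => eB (k + i%:Z)).
    exists a; split=> // i; have /andP[-> _] := aB i => /=.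
    apply: (lex_values b1 ea (C := (Num.truncn beta)%:R / (beta - 1))) => [j|j].
      by have /andP[] := aB j.
    suff -> : (fun i => e (k + (j + i)%N%:Z)) = (fun i => e (k + j%:Z + i%:Z)) by [].
    by apply/funext => x; rewrite PoszD addrA.
  (* a bounded solution of the digit recursion is unique *)
  have shift k i : A k i = A (k + i%:Z) 0%N.
    have E j : beta ^+ j * (A k i - A (k + i%:Z) 0%N) = A k (i + j)%N - A (k + i%:Z) j.
      have := digit_values_agree (i := j) (digit_values_shift i (AP k).1) (AP (k + i%:Z)).1.
      rewrite /= addn0 => H; apply: H => j' _; by rewrite PoszD addrA.
    apply/eqP; rewrite -subr_eq0; apply: contraT; rewrite -normr_gt0 => N0.
    have [j jP] := expr_beta_unbounded b1 (`|A k i - A (k + i%:Z) 0%N|^-1).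
    move: jP; rewrite -(ltr_pM2r N0) mulVf ?gt_eqF// -{1}(ger0_norm (exprn_ge0 j (ltW
      b0))) -normrM E.
    rewrite ltr_normr; have /andP[? ?] := (AP k).2 (i + j)%N;
      have /andP[? ?] := (AP (k + i%:Z)).2 j.
    by case/orP; lra.
  exists (fun k => A k 0%N) => k; split; first exact: (AP k).2.
  by have := (AP k).1 0%N; rewrite addr0 => ->; rewrite shift.
split=> n.
  have [/andP[a0 a1] E] := aP n; have [/andP[a0' a1'] _] := aP (n + 1).
  rewrite truncn_ge_nat ?(ltW b0)//; have : beta * a n <= beta by rewrite ger_pMr// ltW.
  by rewrite E; apply: le_trans; rewrite lerDl.
apply: (values_lex b1 (a := fun i => a (n + i%:Z))) => [k|k]; last by have [] := aP (n + k%:Z).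
by have [_ ->] := aP (n + k%:Z); rewrite -addrA -PoszD addn1.
Qed.

(** * Spectral splitting *)

Lemma irreducible_coprimep (F : fieldType) (p q : {poly F}) :
  irreducible_poly p -> q != 0 -> (size q < size p)%N ->
  exists u, u.1 * p + u.2 * q = 1.
Proof.
move=> irr q0 qp; have cpq : coprimep p q.
  rewrite /coprimep; apply: contraT => H.
  have /eqp_size gE := irr.2 (gcdp p q) H (dvdp_gcdl _ _).
  by have := dvdp_leq q0 (dvdp_gcdr p q); rewrite gE leqNgt qp.
exact/Bezout_eq1_coprimepP.
Qed.

Lemma mulmx_sum_col (R : pzRingType) (m n : nat) (A : 'M[R]_(m, n)) (c : 'cV[R]_n) :
  A *m c = \sum_j \col_i (A i j * c j 0).
Proof.
by apply/matrixP => i k; rewrite (ord1 k) mxE summxE; apply: eq_bigr => j _; rewrite mxE.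
Qed.

(** * Independence of the Krylov vectors *)

Section Krylov.
Variables (p : nat) (M : 'M[int]_p.+1).

Definition krylov (n : 'cV[int]_p.+1) : 'M[int]_p.+1 :=
  \matrix_(i, j) (M ^+ j *m n) i 0.

Lemma col_krylov n j : col j (krylov n) = M ^+ j *m n.
Proof. by apply/matrixP => i k; rewrite !mxE (ord1 k). Qed.

Hypothesis irr : irreducible_poly (map_poly intr (char_poly M) : {poly rat}).

(** A linear relation among the columns is a polynomial [q] of degree below that of the
    characteristic polynomial with [q(M) n = 0]. By irreducibility the two are coprime, so Bezout
    and Cayley-Hamilton give [n = 0]. *)
Lemma det_krylov n : n != 0 -> \det (krylov n) != 0.
Proof.
move=> n0; pose MQ : 'M[rat]_p.+1 := map_mx intr M.
pose nQ : 'cV[rat]_p.+1 := map_mx intr n.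
pose KQ : 'M[rat]_p.+1 := map_mx intr (krylov n).
suff : \det KQ != 0 by rewrite det_map_mx intr_eq0.
apply/negP => /eqP d0.
have : \det KQ^T = 0 by rewrite det_tr.
move/eqP/det0P => [c c0 cK].
pose q : {poly rat} := \poly_(i < p.+1) (c 0 (inord i)).
have q0 : q != 0.
  apply: contra c0 => /eqP q0; apply/eqP/rowP => i; rewrite mxE.
  by have := congr1 (fun r : {poly rat} => r`_i) q0; rewrite coef_poly ltn_ord coef0 inord_val.
have szq : (size q < size (map_poly intr (char_poly M) : {poly rat}))%N.
  rewrite (leq_ltn_trans (size_poly _ _))// size_map_poly_id0 ?size_char_poly//.
  by rewrite (monicP (char_poly_monic M)) oner_neq0.
have [u uE] := irreducible_coprimep irr q0 szq.
have CH : horner_mx MQ (map_poly intr (char_poly M)) = 0.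
  by rewrite map_char_poly Cayley_Hamilton.
have qn : horner_mx MQ q *m nQ = 0.
  rewrite /q poly_def rmorph_sum mulmx_suml.
  have -> : \sum_(i < p.+1) horner_mx MQ (c 0 (inord i) *: 'X^i) *m nQ = (c *m KQ^T)^T.
    rewrite trmx_mul trmxK mulmx_sum_col; apply: eq_bigr => i _.
    rewrite inord_val linearZ /= rmorphXn /= horner_mx_X -scalemxAl.
    apply/matrixP => a b; rewrite (ord1 b) [RHS]mxE mulrC [LHS]mxE [c^T _ _]mxE; congr (_ * _).
    have -> : KQ a i = (map_mx intr (M ^+ i *m n) : 'cV[rat]_p.+1) a 0 by rewrite !mxE.
    by rewrite map_mxM rmorphXn.
  by rewrite cK trmx0.
have : horner_mx MQ 1 *m nQ = 0.
  rewrite -uE rmorphD !rmorphM /= CH mulr0 add0r -mulmxE -mulmxA qn mulmx0 //.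
rewrite rmorph1 mul1mx => /matrixP nQ0; case/negP: n0; apply/eqP/matrixP => i j.
by have := nQ0 i j; rewrite !mxE => /eqP; rewrite intr_eq0 => /eqP.
Qed.

End Krylov.

(** * Decay off the expanding line *)

Section Conjugates.
Local Open Scope complex_scope.

(* Peeling off the roots one at a time, each step solves x_(j+1) = z x_j + y_j
   with y geometrically small. *)
Lemma annihilated_powers_decay (R : realType) (p : nat) (A P : 'M[R[i]]_p.+1)
  (s : seq R[i]) (rho : R) :
  0 < rho -> (forall z, z \in s -> Normc.normc z < rho) ->
  horner_mx A (\prod_(z <- s) ('X - z%:P)) * P = 0 ->
  exists2 C : R, 0 <= C & forall j i k, Normc.normc ((A ^+ j * P) i k) <= C * rho ^+ j.
Proof.
move=> r0; elim: s P => [|z s IH] P zs.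
  rewrite big_nil rmorph1 mul1r => ->; exists 0 => // j i k.
  by rewrite mulr0 mxE Normc.normc0 mul0r.
rewrite big_cons mulrC rmorphM /= rmorphB /= horner_mx_X horner_mx_C -mulrA => /IH[].
  by move=> y ys; apply: zs; rewrite inE ys orbT.
move=> C C0 CP.
have zr : 0 < rho - Normc.normc z by rewrite subr_gt0 zs ?mem_head.
pose C1 := \sum_i \sum_k Normc.normc (P i k).
have nc0 (x : R[i]) : 0 <= Normc.normc x by case: x => a b; exact: sqrtr_ge0.
have C10 : 0 <= C1 by apply: sumr_ge0 => i _; apply: sumr_ge0.
have PC1 i k : Normc.normc (P i k) <= C1.
  rewrite /C1 (bigD1 i)//= (bigD1 k)//= -addrA lerDl addr_ge0// sumr_ge0// => i' _.
  exact: sumr_ge0.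
(* Chosen so that [D] bounds the entries of [P] and [Normc.normc z * D + C <= D * rho], which is the
   induction step. *)
pose D := C1 + C / (rho - Normc.normc z).
have D0 : 0 <= D by rewrite addr_ge0// divr_ge0// ltW.
exists D => // j i k; elim: j => [|j IHj].
  by rewrite mul1r mulr1 (le_trans (PC1 i k))// lerDl divr_ge0// ltW.
have E : A ^+ j.+1 * P = z *: (A ^+ j * P) + A ^+ j * ((A - z%:M) * P).
  rewrite exprSr -mulrA mulrBl mulrBr.
  have -> : z%:M * P = z *: P by rewrite -mul_scalar_mx.
  by rewrite -scalerAr addrC subrK.
rewrite E mxE (le_trans (@le_normcD R _ _))// mxE Normc.normcM.
apply: le_trans (lerD (ler_wpM2l (nc0 z) IHj) (CP j i k)) _.
rewrite [X in X <= _](_ : _ = (Normc.normc z * D + C) * rho ^+ j); last by ring.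
rewrite [X in _ <= X](_ : _ = (D * rho) * rho ^+ j); last by rewrite exprS; ring.
rewrite ler_wpM2r ?exprn_ge0 ?(ltW r0)//.
rewrite -subr_ge0 (_ : _ - _ = C1 * (rho - Normc.normc z)) ?mulr_ge0 ?(ltW zr)//.
have CE : C = (D - C1) * (rho - Normc.normc z).
  by rewrite /D addrAC subrr add0r mulfVK// gt_eqF.
by rewrite [in LHS]CE; ring.
Qed.

End Conjugates.

Section Spectral.
Local Open Scope complex_scope.
Variables (R : realType) (p : nat) (M : 'M[int]_p.+1) (beta : R).
Hypothesis hM : pisot_automorphism M beta.

Local Notation A := (map_mx intr M : 'M[R]_p.+1).
Let chiQ : {poly rat} := map_poly intr (char_poly M).
Let chiR : {poly R} := map_poly intr (char_poly M).

Let irr : irreducible_poly chiQ. Proof. by case: hM. Qed.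
Let b1 : 1 < beta. Proof. by case: hM => _ _ []. Qed.

Lemma ratr_char_poly (F : numFieldType) :
  map_poly ratr chiQ = map_poly intr (char_poly M) :> {poly F}.
Proof. by apply/polyP => i; rewrite !coef_map /= ratr_int. Qed.

(** An irreducible polynomial over the rationals is coprime to its derivative. *)
Lemma pisot_root_simple : exists2 g : {poly R}, chiR = ('X - beta%:P) * g & g.[beta] != 0.
Proof.
have rb : root chiR beta by case: hM.
have /factor_theorem[g gE] := rb.
exists g; first by rewrite mulrC.
have szQ : size chiQ = p.+2.
  by rewrite size_map_poly_id0 ?size_char_poly// (monicP (char_poly_monic M)) oner_neq0.
have d0 : chiQ^`() != 0.
  apply/eqP => /(congr1 (fun q : {poly rat} => q`_p)) /eqP; rewrite coef_deriv coef0.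
  have -> : chiQ`_p.+1 = 1.
    rewrite coef_map /=; have := monicP (char_poly_monic M).
    by rewrite lead_coefE size_char_poly /= => ->.
  by rewrite pnatr_eq0.
have [u /(congr1 (map_poly (ratr : rat ->
  R)))] := irreducible_coprimep irr d0 (lt_size_deriv (irredp_neq0 irr)).
rewrite rmorph1 rmorphD !rmorphM /= -deriv_map ratr_char_poly -/chiR => /(congr1 (fun q :
  {poly R} => q.[beta])).
rewrite hornerD !hornerM (rootP rb) mulr0 add0r hornerC gE derivM hornerD !hornerM !hornerE.
rewrite subrr mulr0 add0r derivXsubC hornerC mulr1 => E.
by apply: contra_eq_neq E => ->; rewrite mulr0 eq_sym oner_neq0.
Qed.

(** The complex roots of [g] are conjugates of [beta] other than [beta] itself, so the Pisot
    property puts them in the open unit disc. *)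
Lemma pisot_conjugates_decay (g : {poly R}) (P : 'M[R]_p.+1) :
  chiR = ('X - beta%:P) * g -> g.[beta] != 0 -> horner_mx A g * P = 0 ->
  exists C rho : R, [/\ 0 <= C, 0 < rho < 1 &
    forall j i k, `|(A ^+ j * P) i k| <= C * rho ^+ j].
Proof.
move=> gE gb gP.
pose toC := real_complex R.
have [s sE] := closed_field_poly_normal (map_poly toC g).
have g0 : g != 0 by apply: contra_neq gb => ->; rewrite horner0.
have zs z : z \in s -> Normc.normc z < 1.
  move=> zs.
  have rz : root (map_poly toC g) z.
    by rewrite sE rootZ ?lead_coef_eq0 ?map_poly_eq0// root_prod_XsubC.
  have [_ _ [_ _ conj] _] := hM.
  have chiC : map_poly ratr chiQ = map_poly toC chiR.
    by rewrite ratr_char_poly; apply/polyP => i; rewrite !coef_map /= rmorph_int.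
  have : `|z| < 1.
    apply: conj.
      exists chiQ; split => //; rewrite chiC.
        by rewrite /toC fmorph_root; case: hM.
      by rewrite gE rmorphM rootM rz orbT.
    move=> zb; move: rz; rewrite zb fmorph_root => /rootP gb0.
    by rewrite gb0 eqxx in gb.
  by rewrite -[X in X < _]/((Normc.normc z)%:C) ltcR.
(* There are finitely many roots, so one radius below 1 serves for all. *)
have [rho /andP[rho0 rho1] rhoP] : exists2 rho : R, 0 < rho < 1 & forall z, z \in s ->
  Normc.normc z < rho.
  elim: s {sE} zs => [|z s IH] zs.
    by exists 2^-1 => //; rewrite invr_gt0 invf_lt1 ?ltr1n ?ltr0n.
  have [|r /andP[r0 r1] rP] := IH; first by move=> y ys; apply: zs; rewrite inE ys orbT.
  have z1 := zs z (mem_head _ _).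
  exists ((Num.max r (Normc.normc z) + 1) / 2).
    have : r <= Num.max r (Normc.normc z) by rewrite le_max lexx.
    have : Num.max r (Normc.normc z) < 1 by rewrite gt_max r1.
    lra.
  move=> y; rewrite inE => /orP[/eqP ->|/rP ry].
    have : Normc.normc z <= Num.max r (Normc.normc z) by rewrite le_max lexx orbT.
    lra.
  have : r <= Num.max r (Normc.normc z) by rewrite le_max lexx.
  lra.
have [|C C0 CP] := @annihilated_powers_decay R p (map_mx toC A) (map_mx toC P) s rho rho0 rhoP.
  have : horner_mx (map_mx toC A) (map_poly toC g) * map_mx toC P = 0.
    by rewrite -map_horner_mx -rmorphM /= gP map_mx0.
  rewrite sE linearZ /= -scalerAl => /eqP;
    rewrite scaler_eq0 lead_coef_eq0 map_poly_eq0 (negbTE g0) /=.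
  by move/eqP.
exists C, rho; split; rewrite ?rho0// => j i k.
have := CP j i k.
have -> : (map_mx toC A) ^+ j * map_mx toC P = map_mx toC (A ^+ j * P) by rewrite rmorphM
  rmorphXn.
by rewrite mxE /= expr0n /= addr0 sqrtr_sqr.
Qed.

(** [Pu = g(A) / g(beta)] is the spectral projection onto the expanding line. A left eigenvector
    normalised by [l n = 1] and [v = Pu n] present it as [v l], and the complement is killed by
    [g(A)]. *)
Lemma pisot_splitting (n : 'cV[int]_p.+1) : n != 0 ->
  exists (l : 'rV[R]_p.+1) (v : 'cV[R]_p.+1) (C rho : R),
  [/\ l *m A = beta *: l, l *m map_mx intr n = 1%:M, A *m v = beta *: v, l *m v = 1%:M &
    [/\ 0 <= C, 0 < rho < 1 &
    forall j i k, `|(A ^+ j * (1 - v *m l)) i k| <= C * rho ^+ j]].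
Proof.
move=> n0.
pose nR : 'cV[R]_p.+1 := map_mx intr n.
pose K : 'M[R]_p.+1 := map_mx intr (krylov M n).
have Ku : K \in unitmx.
  by rewrite unitmxE det_map_mx unitfE intr_eq0 det_krylov.
have colK j : col j K = A ^+ j *m nR.
  by rewrite -map_col col_krylov map_mxM rmorphXn.
have : eigenvalue A beta.
  by rewrite eigenvalue_root_char -map_char_poly; case: hM.
move=> /eigenvalueP[l0 l0A l0n].
have l0X j : l0 *m A ^+ j = beta ^+ j *: l0.
  elim: j => [|j IH]; first by rewrite mulmx1 scale1r.
  by rewrite exprS mulmxA l0A -scalemxAl IH scalerA exprS.
(* A left eigenvector vanishing on [n] vanishes on all Krylov vectors, which form a basis. *)
have c0 : (l0 *m nR) 0 0 != 0.
  apply: contra l0n => /eqP c0.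
  have : l0 *m K = 0.
    apply/rowP => j; have -> : (l0 *m K) 0 j = (l0 *m col j K) 0 0.
      by rewrite [LHS]mxE [RHS]mxE; apply: eq_bigr => i _; rewrite [col _ _ _ _]mxE.
    by rewrite colK mulmxA l0X -scalemxAl mxE c0 mulr0 mxE.
  by move/(congr1 (mulmx^~ (invmx K))); rewrite mulmxK// mul0mx => ->.
pose l := ((l0 *m nR) 0 0)^-1 *: l0.
have lA : l *m A = beta *: l by rewrite -scalemxAl l0A !scalerA mulrC.
have ln : l *m nR = 1%:M.
  rewrite -scalemxAl; apply/matrixP => i j.
  by rewrite (ord1 i) (ord1 j) mxE mulVf// mxE.
have lX j : l *m A ^+ j = beta ^+ j *: l.
  by rewrite -scalemxAl l0X !scalerA mulrC.
have [g gE gb] := pisot_root_simple.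
pose Pu : 'M[R]_p.+1 := g.[beta]^-1 *: horner_mx A g.
have CH : (A - beta%:M) * horner_mx A g = 0.
  have := Cayley_Hamilton A; rewrite -map_char_poly -/chiR gE rmorphM rmorphB /=.
  by rewrite horner_mx_X horner_mx_C.
have APu : A *m Pu = beta *: Pu.
  rewrite /Pu -scalemxAr scalerA mulrC -scalerA; congr (_ *: _).
  by move/eqP: CH; rewrite mulrBl subr_eq0 => /eqP E; rewrite -[LHS]/(A * _) E;
    exact: mul_scalar_mx.
have PuX j : Pu *m A ^+ j = beta ^+ j *: Pu.
  have cm : comm_mx (A ^+ j) Pu.
    rewrite /Pu -mul_scalar_mx; apply: comm_mxM; first exact: comm_mx_scalar.
    by apply: comm_mx_horner; exact/commr_sym/commrX/commr_refl.
  rewrite -cm; elim: j {cm} => [|j IH]; first by rewrite mul1mx scale1r.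
  by rewrite exprSr -mulmxA APu -scalemxAr IH scalerA exprS.
pose v := Pu *m nR.
(* Both sides multiply [A ^+ j *m nR] to [beta ^+ j *: v], and these vectors form a basis. *)
have PuE : Pu = v *m l.
  apply: (can_inj (mulmxK Ku)); apply/matrixP => i j.
  have colE (B : 'M[R]_p.+1) : (B *m K) i j = (B *m col j K) i 0.
    by rewrite [LHS]mxE [RHS]mxE; apply: eq_bigr => k _; rewrite [col _ _ _ _]mxE.
  have H1 : v *m l *m (A ^+ j *m nR) = beta ^+ j *: v.
    by rewrite -mulmxA (mulmxA l) lX -scalemxAl ln -scalemxAr mulmx1.
  have H2 : Pu *m (A ^+ j *m nR) = beta ^+ j *: v by rewrite mulmxA PuX -scalemxAl.
  by rewrite !colE colK H1 H2.
have lPu : l *m Pu = l.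
  have lg (q : {poly R}) : l *m horner_mx A q = q.[beta] *: l.
    elim/poly_ind: q => [|q c IH]; first by rewrite rmorph0 mulmx0 horner0 scale0r.
    rewrite rmorphD rmorphM /= horner_mx_X horner_mx_C mulmxDr mulmxA IH -scalemxAl lA.
    by rewrite mul_mx_scalar hornerD hornerM hornerX hornerC scalerA scalerDl.
  by rewrite /Pu -scalemxAr lg scalerA mulVf// scale1r.
have lv : l *m v = 1%:M by rewrite /v mulmxA lPu.
(* Dividing [g] by [X - beta] and using that [A - beta] kills [g(A)] gives
   [g(A)^2 = g(beta) g(A)]. *)
have gPs : horner_mx A g * (1 - Pu) = 0.
  have /factor_theorem[h hE] : root (g - (g.[beta])%:P) beta by rewrite rootE !hornerE subrr.
  have gh : horner_mx A g = g.[beta] *: 1 + horner_mx A h * (A - beta%:M).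
    have -> : g = (g.[beta])%:P + h * ('X - beta%:P) by rewrite -hE addrC subrK.
    rewrite rmorphD rmorphM rmorphB /= horner_mx_X !horner_mx_C; congr (_ + _).
    by rewrite !hornerE subrr mulr0 addr0 scalemx1.
  rewrite mulrBr mulr1 /Pu -scalerAr {2}gh.
  have cm : horner_mx A g * horner_mx A g = g.[beta] *: horner_mx A g.
    rewrite {1}gh mulrDl -scalerAl mul1r -mulrA CH mulr0 addr0 //.
  rewrite -gh cm scalerA mulVf// scale1r subrr //.
have [C [rho [C0 r01 CP]]] := pisot_conjugates_decay gE gb gPs.
exists l, v, C, rho; split => //; first by rewrite mulmxA APu -scalemxAl.
by rewrite -PuE.
Qed.

End Spectral.

(** * Lattices *)

Lemma unit_absz (x : int) : x \is a GRing.unit -> `|x|%N = 1%N.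
Proof.
case/unitrP => y [yx _]; apply/eqP.
have := congr1 absz yx; rewrite abszM => /eqP; rewrite muln_eq1 => /andP[_ ->] //.
Qed.

(** In Smith normal form [K = L D S] with [L] and [S] unimodular, the cosets are represented by [L]
    applied to the vectors of residues modulo the diagonal entries of [D]. *)
Lemma int_cosets (q : nat) (K : 'M[int]_q) : \det K != 0 ->
  exists (F : finType) (g : F -> 'cV[int]_q), [/\ #|F| = `|\det K|%N,
    forall z, exists f c, z = g f + K *m c &
    forall f f' c, g f - g f' = K *m c -> f = f'].
Proof.
have [L Lu [S Su [d _ KE]]] := int_Smith_normal_form K => K0.
set D := \matrix_(i, j) _ in KE.
pose dd (i : 'I_q) : int := d`_i.
have DE : D = diag_mx (\row_i (dd i)) by apply/matrixP => i j; rewrite !mxE.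
have detKD : `|\det K|%N = (\prod_(i < q) `|(dd i)|)%N.
  have uL : `|\det L|%N = 1%N by apply: unit_absz; rewrite -unitmxE.
  have uS : `|\det S|%N = 1%N by apply: unit_absz; rewrite -unitmxE.
  rewrite KE !det_mulmx !abszM uL uS mul1n muln1 DE det_diag.
  by rewrite (big_morph absz abszM (erefl _)); apply: eq_bigr => i _; rewrite mxE.
have d0 (i : 'I_q) : (dd i) != 0.
  rewrite -absz_eq0 -lt0n.
  have : (0 < \prod_(i < q) `|(dd i)|)%N by rewrite -detKD lt0n absz_eq0.
  by rewrite (bigD1 i) //= muln_gt0 => /andP[].
have Dc (c : 'cV[int]_q) i : (D *m c) i 0 = (dd i) * c i 0.
  by rewrite DE mul_diag_mx !mxE.
pose F : finType := {dffun forall i : 'I_q, 'I_`|(dd i)|}.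
exists F, (fun f : {dffun forall i : 'I_q, 'I_`|dd i|} => L *m \col_i (f i : nat)%:Z); split.
- by rewrite card_dep_ffun foldrE big_map big_enum detKD; apply: eq_bigr => i _;
  rewrite card_ord.
- move=> z; pose y := invmx L *m z.
  have lt i : (absz (modz (y i ord0) (dd i)) < absz (dd i))%N.
    by rewrite -ltz_nat gez0_abs ?modz_ge0 ?d0// ltz_mod ?d0.
  exists [ffun i => Ordinal (lt i)], (invmx S *m \col_i divz (y i ord0) (dd i)).
  rewrite KE -!mulmxA mulKVmx // -mulmxDr -[LHS](mulKVmx Lu) -/y; congr (_ *m _).
  apply/matrixP => i j; rewrite (ord1 j) [RHS]mxE Dc [in RHS]mxE [in RHS]mxE ffunE /=.
  by rewrite gez0_abs ?modz_ge0 ?d0// [RHS]addrC mulrC -divz_eq.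
move=> f f' c; rewrite KE -!mulmxA -mulmxBr => /(can_inj (mulKmx Lu)).
move: (S *m c) => {}c E.
apply/ffunP => i; apply/val_inj; have := congr1 (fun z : 'cV[int]_q => z i 0) E.
rewrite Dc !mxE; move: (c i 0) => k; have := ltn_ord (f i); have := ltn_ord (f' i).
rewrite /=; move: (nat_of_ord (f i)) (nat_of_ord (f' i)) => a b.
move: (dd i) => e be ae E'.
have [k0|k0] := eqVneq k 0; first by move: E'; rewrite k0 mulr0; lia.
have := congr1 absz E'; rewrite abszM.
have : (0 < `|k|)%N by rewrite absz_gt0.
move: (absz k) (absz e) be ae => u w be ae u0 H.
have : (w <= w * u)%N by rewrite leq_pmulr.
rewrite -H; lia.
Qed.

(** * The Krylov lattice and the associated form *)

Section Companion.
Variables (p : nat) (M : 'M[int]_p.+1).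

Lemma krylov_sum n (c : 'cV[int]_p.+1) :
  krylov M n *m c = \sum_(i < p.+1) c i 0 *: (M ^+ i *m n).
Proof.
apply/matrixP => a b; rewrite (ord1 b) mxE summxE; apply: eq_bigr => i _.
by rewrite !mxE mulrC.
Qed.

Lemma Cayley_Hamilton_sum : M ^+ p.+1 = - \sum_(i < p.+1) (char_poly M)`_i *: M ^+ i.
Proof.
move: (char_poly_monic M) (size_char_poly M) (Cayley_Hamilton M).
move: (char_poly M) => q /monicP; rewrite lead_coefE => q1 sq; rewrite sq /= in q1.
rewrite -[X in horner_mx M X]coefK poly_def sq big_ord_recr /= rmorphD.
rewrite [X in X + _ = _ -> _]linear_sum /= q1 scale1r rmorphXn /= horner_mx_X.
rewrite addrC => /eqP; rewrite addr_eq0 => /eqP ->.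
congr (- _); apply: eq_bigr => i _.
by rewrite linearZ /= rmorphXn /= horner_mx_X.
Qed.

Hypothesis Mu : M \in unitmx.

(** In the Krylov basis [M] acts by its companion matrix, which has the determinant of [M]. Hence
    the lattice is stable under [M] and under its inverse. *)
Lemma krylov_companion n : \det (krylov M n) != 0 ->
  exists2 Cm : 'M[int]_p.+1, Cm \in unitmx & M *m krylov M n = krylov M n *m Cm.
Proof.
move=> K0.
pose Cm : 'M[int]_p.+1 := \matrix_(i, j)
  (if j == p :> nat then - (char_poly M)`_i else (i == j.+1 :> nat)%:R).
have E : M *m krylov M n = krylov M n *m Cm.
  apply/matrixP => a j.
  have colE (B X : 'M[int]_p.+1) : (B *m X) a j = (B *m col j X) a 0.
    by rewrite [LHS]mxE [RHS]mxE; apply: eq_bigr => i _; rewrite [col _ _ _ _]mxE.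
  rewrite !colE col_krylov krylov_sum mulmxA -[M *m M ^+ j]/(M * M ^+ j) -exprS.
  have [jp|jp] := eqVneq (j : nat) p.
    rewrite jp Cayley_Hamilton_sum mulNmx mulmx_suml mxE [RHS]summxE [X in - X]summxE -sumrN.
    apply: eq_bigr => i _; rewrite [col _ _ _ _]mxE [Cm _ _]mxE jp eqxx -scalemxAl.
    by rewrite [X in - X]mxE [RHS]mxE mulNr.
  have jp' : (j.+1 < p.+1)%N by have := ltn_ord j; rewrite ltnS; move: jp; lia.
  rewrite (bigD1 (Ordinal jp')) //= big1 ?addr0 => [|i].
    by rewrite [col _ _ _ _]mxE [Cm _ _]mxE (negbTE jp) /= eqxx scale1r.
  rewrite -val_eqE /= => /negbTE ij.
  by rewrite [col _ _ _ _]mxE [Cm _ _]mxE (negbTE jp) ij scale0r.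
exists Cm => //.
have := congr1 determinant E; rewrite !det_mulmx mulrC => /(mulfI K0) dE.
by rewrite unitmxE -dE -unitmxE.
Qed.

Lemma char_poly0_abs : absz ((char_poly M)`_0) = 1%N.
Proof.
by rewrite char_poly_det abszM abszX /= exp1n mul1n unit_absz // -unitmxE.
Qed.

(* The columns of B_M(n) are those of the Krylov matrix up to an integer matrix of
   determinant k_m or - k_m. *)
Lemma assoc_form_krylov n : `|assoc_form M n|%N = `|\det (krylov M n)|%N.
Proof.
pose w (i j : nat) : int := if j == p then (if i == 0%N then char_coef M p.+1 else 0)
  else if i == 0%N then 0 else if i == j.+1 then 1
  else if (i <= j)%N then - char_coef M (j.+1 - i) else 0.
pose W : 'M[int]_p.+1 := \matrix_(i, j) w i j.
have E : assoc_mx M n = krylov M n *m W.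
  apply/matrixP => a j; rewrite [LHS]mxE [RHS]mxE eqSS.
  pose x (i : nat) := (M ^+ i *m n) a 0.
  have -> : \sum_k krylov M n a k * W k j = \sum_(0 <= k < p.+1) x k * w k j.
    by rewrite big_mkord; apply: eq_bigr => k _; rewrite [W _ _]mxE [krylov _ _ _ _]mxE.
  rewrite [in RHS]big_ltn // {1}/w eqxx; have [jp|jp] := eqVneq (j : nat) p.
    rewrite [in RHS]big_nat [in RHS]big1 ?addr0 => [|i /andP[i1 _]]; last first.
      by rewrite /w jp eqxx gtn_eqF // mulr0.
    by rewrite /x mul1mx mxE mulrC.
  have jp' : (j.+2 <= p.+1)%N by have := ltn_ord j; move: jp; lia.
  rewrite mulr0 add0r [in RHS](@big_cat_nat _ _ _ j.+1) //=.
  rewrite [X in _ = _ + X]big_ltn // [X in _ = _ + (_ + X)]big_nat.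
  rewrite [X in _ = _ + (_ + X)]big1 => [|i /andP[ij _]]; last first.
    by rewrite /w (negbTE jp) gtn_eqF ?(ltn_trans _ ij)// gtn_eqF// leqNgt (ltn_trans _
      ij) // mulr0.
  rewrite addr0 {2}/w (negbTE jp) eqxx /= mulr1 mulmxBl mxE addrC; congr (_ + _).
  rewrite mxE mulmx_suml summxE -sumrN big_nat_rev /=.
  rewrite big_nat [RHS]big_nat; apply: eq_bigr => i /andP[i1 ij].
  rewrite -scalemxAl mxE /x /w (negbTE jp) gtn_eqF // ltn_eqF //.
  rewrite -ltnS ij mulrN; have -> : (j.+1 - (1 + j.+1 - i.+1) = i)%N by lia.
  have -> : (1 + j.+1 - i.+1 = j.+1 - i)%N by lia. by congr (- _); exact: mulrC.
rewrite /assoc_form E det_mulmx abszM.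
suff -> : `|\det W|%N = 1%N by rewrite muln1.
(* Row 0 has its only nonzero entry in the last column, namely [k_m], which is 1 or -1; the
   complementary minor is triangular with ones on the diagonal. *)
rewrite (expand_det_row W ord0) (bigD1 ord_max) //= big1 ?addr0 => [|j]; last first.
  by rewrite -val_eqE /= => jp; rewrite [W _ _]mxE /w (negbTE jp) eqxx mul0r.
rewrite [W _ _]mxE /w !eqxx abszM /cofactor abszM abszX /= exp1n mul1n.
rewrite /char_coef subnn abszN char_poly0_abs mul1n -det_tr det_trig; last first.
  apply/is_trig_mxP => i j ij; rewrite !mxE /w /= /bump /= leqNgt ltn_ord add0n add1n.
  by rewrite ltn_eqF ?ltn_ord //= eqSS gtn_eqF // ltnNge ltnW.
rewrite big1 // => i _; rewrite !mxE /w /= /bump /= leqNgt ltn_ord add0n add1n.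
by rewrite ltn_eqF ?ltn_ord //= eqxx.
Qed.

End Companion.

Section BetaRing.
Variables (R : realType) (p : nat) (M : 'M[int]_p.+1) (beta : R).
Hypothesis hM : pisot_automorphism M beta.

(** With constant term [c] equal to 1 or -1, the characteristic polynomial is [q X + c], so the
    inverse of [beta] is [- c q(beta)]. *)
Lemma Zbeta_beta_inv : Zbeta beta beta^-1.
Proof.
have [Mu _ [b1 _ _] rb] := hM.
have b0 : beta != 0 by rewrite gt_eqF// (lt_trans _ b1).
have /factor_theorem[q qE] : root (char_poly M - ((char_poly M)`_0)%:P) 0.
  by rewrite rootE hornerD hornerN hornerC horner_coef0 subrr.
rewrite subr0 in qE; set c := _`_0 in qE.
have := rootP rb; rewrite -[char_poly M](subrK c%:P) qE rmorphD rmorphM /= map_polyX map_polyC.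
rewrite hornerD hornerM hornerX hornerC => /eqP; rewrite addr_eq0 => /eqP E.
have cc : c * c = 1.
  have : `|c|%N = 1%N := char_poly0_abs Mu; clearbody c; clear; lia.
exists (- (q * c%:P)); rewrite rmorphN rmorphM /= map_polyC hornerN hornerM hornerC.
apply: (mulIf b0); rewrite mulVf // mulNr mulrAC E mulNr opprK -rmorphM /= cc.
by [].
Qed.

End BetaRing.

(** * Orbits steered by digits *)

Lemma bounded_int_vectors (q B : nat) : exists s : seq 'cV[int]_q,
  forall w : 'cV[int]_q, (forall i, `|w i 0| <= B%:Z) -> w \in s.
Proof.
exists [seq \col_i ((f i : nat)%:Z - B%:Z) | f : {ffun 'I_q -> 'I_(2 * B).+1}] => w wB.
apply/mapP; exists [ffun i => inord (absz (w i 0 + B%:Z))]; first by rewrite mem_enum.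
apply/matrixP => i j; rewrite (ord1 j) !mxE ffunE; have := wB i.
by move: (w i 0) => x; rewrite ler_norml => /andP[w1 w2]; rewrite inordK; lia.
Qed.

Lemma ultra_finite (T : eqType) (U : set_system nat) (f : nat -> T) (s : seq T) :
  UltraFilter U -> U [set j | f j \in s] -> exists x, U [set j | f j = x].
Proof.
move=> UU; elim: s => [|x s IH] H.
  have : U set0 by apply: filterS H.
  by move/filter_not_empty.
have [|nx] := in_ultra_setVsetC [set j | f j = x] UU; first by exists x.
apply: IH; apply: filterS2 H nx => j /=.
by rewrite inE => /orP[/eqP|].
Qed.

Lemma PoszSr (j : nat) : j.+1%:Z = j%:Z + 1.
Proof. by rewrite -addn1 PoszD. Qed.

Lemma telescope_step (V : zmodType) (a r X Y D : V) :
  a - r + (X + Y) - (a - (r - (X - D))) = Y + D.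
Proof.
have -> : a - (r - (X - D)) = (a - r) + (X - D) by rewrite opprD opprK addrA.
by rewrite opprD addrACA subrr add0r opprB addrC addrA subrK addrC.
Qed.

Lemma coset_step (V : zmodType) (c x a b : V) : c - (x + b) - (c - (x + a)) = a - b.
Proof. by rewrite opprB addrC addrA subrK opprD addrACA subrr add0r. Qed.

Lemma negz_addn (i k : nat) : (k <= i)%N -> - i%:Z + k%:Z = - (i - k)%N%:Z.
Proof. by move=> ki; rewrite -subzn// opprB addrC. Qed.

Lemma absz_shift (k : int) (i N : nat) : (N + `|k| <= i)%N ->
  exists q : nat, k = - i%:Z + N%:Z + q%:Z.
Proof. by move=> kN; exists (absz (k + i%:Z - N%:Z)%R); lia. Qed.

Lemma absz_le_addz (k : int) (j : nat) : (`|k| <= j)%N -> 0 <= k + j%:Z.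
Proof. by lia. Qed.

Lemma abszS (x : int) : 0 <= x -> absz (x + 1) = (absz x).+1.
Proof. by lia. Qed.

Lemma map_intr_inj (R : realType) (a b : nat) :
  injective (fun w : 'M[int]_(a, b) => map_mx intr w : 'M[R]_(a, b)).
Proof.
move=> x y /matrixP xy; apply/matrixP => i j.
by have := xy i j; rewrite !mxE => /intr_inj.
Qed.

(* [v] is the component of [n] on the expanding line, so that [tproj v] is the
   homoclinic point attached to [n]; [lcoord] is the coordinate along that line. *)
Section Orbits.
Variables (R : realType) (p : nat) (M : 'M[int]_p.+1) (beta : R) (n : 'cV[int]_p.+1).
Variables (l : 'rV[R]_p.+1) (v : 'cV[R]_p.+1) (C rho : R).
Local Notation A := (@map_mx int R intr p.+1 p.+1 M).
Local Notation nR := (@map_mx int R intr p.+1 1 n).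
(** The projection along [v] onto the contracting hyperplane, the kernel of [l]. *)
Local Notation Ps := (1 - v *m l).
Implicit Type x : 'cV[R]_p.+1.
Hypotheses (Mu : M \in unitmx) (b1 : 1 < beta) (lA : l *m A = beta *: l)
  (ln : l *m nR = 1%:M) (Av : A *m v = beta *: v) (lv : l *m v = 1%:M)
  (C0 : 0 <= C) (r01 : 0 < rho < 1)
  (decay : forall j i k, `|(A ^+ j * Ps) i k| <= C * rho ^+ j)
  (dK : \det (krylov M n) != 0).

Let b0 : 0 < beta. Proof. exact: lt_trans b1. Qed.
Let r0 : 0 < rho. Proof. by case/andP: r01. Qed.
Let r1 : 0 < 1 - rho. Proof. by rewrite subr_gt0; case/andP: r01. Qed.

Definition lcoord (x : 'cV[R]_p.+1) : R := (l *m x) 0 0.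

Lemma lcoordD x y : lcoord (x + y) = lcoord x + lcoord y.
Proof. by rewrite /lcoord mulmxDr mxE. Qed.

Lemma lcoordN x : lcoord (- x) = - lcoord x.
Proof. by rewrite /lcoord mulmxN mxE. Qed.

Lemma lcoordZ c x : lcoord (c *: x) = c * lcoord x.
Proof. by rewrite /lcoord -scalemxAr mxE. Qed.

Lemma lcoordA x : lcoord (A *m x) = beta * lcoord x.
Proof. by rewrite /lcoord mulmxA lA -scalemxAl mxE. Qed.

Lemma lcoordn : lcoord nR = 1.
Proof. by rewrite /lcoord ln mxE. Qed.

Lemma lcoordv : lcoord v = 1.
Proof. by rewrite /lcoord lv mxE. Qed.

Lemma Ps_apply x : Ps *m x = x - lcoord x *: v.
Proof.
rewrite mulmxBl mul1mx -mulmxA.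
have -> : l *m x = (lcoord x)%:M by rewrite [LHS]mx11_scalar.
by rewrite mul_mx_scalar.
Qed.

Lemma Ps_comm x : Ps *m (A *m x) = A *m (Ps *m x).
Proof. by rewrite !Ps_apply mulmxBr lcoordA -scalemxAr Av scalerA mulrC. Qed.

Lemma lcoord_Ps x : lcoord (Ps *m x) = 0.
Proof. by rewrite Ps_apply lcoordD lcoordN lcoordZ lcoordv mulr1 subrr. Qed.

Lemma exprA_apply J x : A ^+ J *m (A *m x) = A ^+ J.+1 *m x.
Proof. by rewrite mulmxA exprSr. Qed.

Lemma Aexpr_apply j x : A *m (A ^+ j *m x) = A ^+ j.+1 *m x.
Proof. by rewrite mulmxA exprS. Qed.

Definition nrm1 (x : 'cV[R]_p.+1) : R := \sum_i `|x i 0|.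

Lemma nrm1_ge0 x : 0 <= nrm1 x. Proof. exact: sumr_ge0. Qed.

Lemma le_nrm1 x i : `|x i 0| <= nrm1 x.
Proof. by rewrite /nrm1 (bigD1 i) //= lerDl sumr_ge0. Qed.

Lemma decay_apply j x i : `|(A ^+ j *m (Ps *m x)) i 0| <= C * rho ^+ j * nrm1 x.
Proof.
rewrite mulmxA mxE (le_trans (ler_norm_sum _ _ _))// mulr_sumr ler_sum// => k _.
by rewrite normrM ler_wpM2r// decay.
Qed.

(** Sum of a geometric series: a digit is at most [beta], and [j] steps later its contribution to
    the contracting part is at most [beta * C * rho ^+ j * nrm1 nR]. *)
Definition drift : R := beta * C * nrm1 nR / (1 - rho).

Lemma drift_ge0 : 0 <= drift.
Proof. by rewrite !mulr_ge0 ?nrm1_ge0 ?invr_ge0// ltW. Qed.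

Lemma forward_bound (y : nat -> 'cV[R]_p.+1) (e : nat -> nat) :
  (forall k, y k.+1 = A *m y k - (e k)%:R *: nR) -> (forall k, 0 <= lcoord (y k) < 1) ->
  forall k i, `|y k i 0| <= `|v i 0| + C * rho ^+ k * nrm1 (y 0%N) + drift.
Proof.
move=> yS y01 k i.
have eb k' : (e k')%:R <= beta.
  have := y01 k'.+1; rewrite yS lcoordD lcoordN lcoordZ lcoordA lcoordn mulr1 => /andP[h _].
  have /andP[_ a1] := y01 k'.
  have : beta * lcoord (y k') <= beta by rewrite ger_pMr// ltW.
  lra.
(* Stated after [J] further applications of [A], since the step from [k] to [k + 1] needs the bound
   for [J + 1]. *)
have key J : `|(A ^+ J *m (Ps *m y k)) i 0| <= C * rho ^+ (J + k) * nrm1 (y 0%N) + drift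
  * rho ^+ J.
  elim: k J => [|k IH] J.
    by rewrite addn0 (le_trans (decay_apply _ _ _))// lerDl mulr_ge0 ?drift_ge0//
      exprn_ge0// ltW.
  rewrite yS mulmxBr mulmxBr Ps_comm exprA_apply -!scalemxAr.
  have mB (X Y : 'cV[R]_p.+1) c : (X - c *: Y) i 0 = X i 0 - c * Y i 0 by rewrite !mxE.
  rewrite mB (le_trans (ler_normB _ _))//.
  have h1 := IH J.+1; rewrite normrM ger0_norm//.
  have h2 : (e k)%:R * `|(A ^+ J *m (Ps *m nR)) i 0| <= beta * (C * rho ^+ J * nrm1 nR).
    by rewrite ler_pM// decay_apply.
  apply: le_trans (lerD h1 h2) _; rewrite addSnnS -addrA lerD2l exprS.
  rewrite le_eqVlt; apply/orP; left; apply/eqP; rewrite /drift; field; rewrite gt_eqF//.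
have -> : y k = lcoord (y k) *: v + Ps *m y k by rewrite Ps_apply addrC subrK.
have := key 0%N; rewrite mul1mx mulr1 add0n => H.
rewrite mxE (le_trans (ler_normD _ _))// -addrA lerD// mxE normrM.
by have /andP[a0 a1] := y01 k; rewrite ger0_norm// ler_piMl// ltW.
Qed.

(* [y] lifts the orbit of a point of the torus, with the digits [e] steering it
   so that its unstable coordinate stays in [0, 1). *)
Definition orbit (e : int -> nat) (y : int -> 'cV[R]_p.+1) : Prop :=
  [/\ forall k, y (k + 1) = A *m y k - (e k)%:R *: nR,
      exists B, forall k i, `|y k i 0| <= B &
      forall k, 0 <= lcoord (y k) < 1].

Definition obound : R := nrm1 v + drift + 1.

Lemma pow_small (D e : R) : 0 < e -> exists J : nat, D * rho ^+ J <= e.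
Proof.
move=> e0; have ri : 1 < rho^-1 by rewrite invf_gt1//; case/andP: r01.
have [J JP] := expr_beta_unbounded ri (`|D| / e); exists J.
rewrite (le_trans (ler_wpM2r _ (ler_norm D))) ?exprn_ge0 ?(ltW r0)//.
rewrite -ler_pdivlMr ?exprn_gt0// -exprVn mulrC -ler_pdivrMr//; exact: ltW.
Qed.

(** Starting at time [k - J] with [J] so large that the initial term is at most 1 removes the
    dependence on the bound of the individual orbit. A common bound is what leaves finitely many
    differences between orbits in one coset. *)
Lemma orbit_bound e y : orbit e y -> forall k i, `|y k i 0| <= obound.
Proof.
move=> [yS [B yB] y01] k i.
have [J JP] := @pow_small (C * (p.+1%:R * B)) 1 ltr01.
pose y' (j : nat) := y (k - J%:Z + j%:Z).
have y'S j : y' j.+1 = A *m y' j - (e (k - J%:Z + j%:Z))%:R *: nR.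
  by rewrite /y' -yS PoszSr addrA.
have := @forward_bound y' _ y'S (fun j => y01 _) J i.
rewrite /y' subrK addr0 => /le_trans; apply; rewrite /obound addrAC.
apply: lerD; first by rewrite lerD2r le_nrm1.
rewrite (le_trans _ JP)// mulrAC ler_wpM2r ?exprn_ge0 ?(ltW r0)// ler_wpM2l//.
rewrite /nrm1 (le_trans (ler_sum _ (fun i _ => yB _ i)))// sumr_const card_ord mulr_natl //.
Qed.

Lemma lcoordX j x : lcoord (A ^+ j *m x) = beta ^+ j * lcoord x.
Proof.
elim: j => [|j IH]; first by rewrite mul1mx mul1r.
by rewrite exprS -[A * _]/(A *m _) -mulmxA lcoordA IH exprS mulrA.
Qed.

(** Hyperbolicity: a component along [v] would grow in the future, and the contracting part is the
    decayed image of a bounded vector from the distant past. *)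
Lemma zero_of_bounded (d : int -> 'cV[R]_p.+1) B : (forall k, d (k + 1) = A *m d k) ->
  (forall k i, `|d k i 0| <= B) -> forall k, d k = 0.
Proof.
move=> dS dB.
have dJ k (J : nat) : d (k + J%:Z) = A ^+ J *m d k.
  elim: J => [|J IH]; first by rewrite addr0 mul1mx.
  by rewrite PoszSr addrA dS IH mulmxA exprS.
have nB k : nrm1 (d k) <= p.+1%:R * B.
  by rewrite /nrm1 (le_trans (ler_sum _ (fun i _ => dB k i)))// sumr_const card_ord mulr_natl.
have [B' B'P] : exists B', forall k, `|lcoord (d k)| <= B'.
  exists (\sum_j `|l 0 j| * B) => k.
  rewrite /lcoord mxE (le_trans (ler_norm_sum _ _ _))// ler_sum// => j _.
  by rewrite normrM ler_wpM2l.
have L0 k : lcoord (d k) = 0.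
  apply/eqP; apply: contraT; rewrite -normr_gt0 => N0.
  have [J JP] := expr_beta_unbounded b1 (B' / `|lcoord (d k)|).
  have := B'P (k + J%:Z); rewrite dJ lcoordX.
  by rewrite normrM ger0_norm ?exprn_ge0 ?(ltW b0)// leNgt -ltr_pdivrMr// JP.
move=> k; apply/matrixP => i j; rewrite (ord1 j) mxE; apply/eqP; apply: contraT.
rewrite -normr_gt0 => N0.
have [|J JP] := @pow_small (C * (p.+1%:R * B)) (`|d k i 0| / 2); first by rewrite divr_gt0.
have := decay_apply J (d (k - J%:Z)) i.
rewrite Ps_apply L0 scale0r subr0 -dJ subrK => H.
have : C * rho ^+ J * nrm1 (d (k - J%:Z)) <= `|d k i 0| / 2.
  apply: le_trans JP; rewrite mulrAC ler_wpM2r ?exprn_ge0 ?(ltW r0)//.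
  by rewrite ler_wpM2l.
lra.
Qed.

Lemma orbit_unique e y y' : orbit e y -> orbit e y' -> y = y'.
Proof.
move=> oy oy'; apply/funext => k; apply/eqP; rewrite -subr_eq0; apply/eqP.
apply: (@zero_of_bounded (fun k => y k - y' k) (obound + obound)) => {}k.
  by case: oy oy' => yS _ _ [y'S _ _]; rewrite yS y'S mulmxBr; rewrite opprB addrA subrK.
move=> i; rewrite !mxE (le_trans (ler_normB _ _))// lerD//.
  exact: orbit_bound oy k i.
exact: orbit_bound oy' k i.
Qed.

Lemma orbit_digit e y k : orbit e y ->
  beta_shift beta (lcoord (y k)) = lcoord (y (k + 1)) /\
  beta * lcoord (y k) = (e k)%:R + lcoord (y (k + 1)).
Proof.
move=> [yS _ y01].
have E : lcoord (y (k + 1)) = beta * lcoord (y k) - (e k)%:R.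
  by rewrite yS lcoordD lcoordN lcoordZ lcoordA lcoordn mulr1.
split; last by rewrite E addrC subrK.
by have := @tau_def R beta (lcoord (y k)) (e k)%:Z; rewrite -pmulrn -E; apply; exact: y01.
Qed.

Lemma orbit_tau e y k j : orbit e y ->
  iter j (beta_shift beta) (lcoord (y k)) = lcoord (y (k + j%:Z)).
Proof.
move=> oy; elim: j => [|j IH]; first by rewrite addr0.
by rewrite /= IH (orbit_digit _ oy).1 -addrA -PoszSr.
Qed.

Lemma orbit_compactum e y : orbit e y -> beta_compactum beta e.
Proof.
move=> oy; apply/(compactum_values e b1); exists (fun k => lcoord (y k)) => k.
by split; [case: oy|exact: (orbit_digit k oy).2].
Qed.

(** The orbit is [a k *: v + X k]: the tail value [a k] collects the digits from [k] on, and the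
    series [X k] collects the contracted contributions of the earlier ones. *)
Lemma compactum_orbit e : beta_compactum beta e -> exists y, orbit e y.
Proof.
move=> eX; have [a aP] := (compactum_values e b1).1 eX.
have eb k : (e k)%:R <= beta.
  have [/andP[_ a1] E] := aP k; have [/andP[a0 _] _] := aP (k + 1).
  have : beta * a k <= beta by rewrite ger_pMr// ltW.
  lra.
pose U (k : int) N : 'cV[R]_p.+1 := - \sum_(j < N) (e (k - 1 - j%:Z))%:R *: (A ^+ j *m
  (Ps *m nR)).
have US k N : U (k + 1) N.+1 = A *m U k N - (e k)%:R *: (Ps *m nR).
  rewrite /U big_ord_recl opprD addrC; congr (_ + _); last first.
    by rewrite mul1mx subr0 addrK.
  rewrite mulmxN mulmx_sumr; congr (- _); apply: eq_bigr => j _.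
  rewrite -scalemxAr Aexpr_apply; congr ((e _)%:R *: _).
  by rewrite ?add1n PoszSr; ring.
have Ucvg k i : cvgn (fun N => U k N i 0).
  rewrite (_ : (fun N => _) = series (fun j => - ((e (k - 1 - j%:Z))%:R * (A ^+ j *m (Ps
    *m nR)) i 0))); last first.
    apply/funext => N; rewrite /U seriesEord /= mxE summxE -sumrN.
    by apply: eq_bigr => j _; rewrite mxE.
  apply: normed_cvg; apply: (series_le_cvg _ _ _ (@is_cvg_geometric_series _ (beta * (C *
    nrm1 nR)) rho _)).
  - by move=> j; exact: normr_ge0.
  - by move=> j; rewrite /geometric /= !mulr_ge0 ?nrm1_ge0 ?exprn_ge0 ?(ltW b0) ?(ltW r0).
  - move=> j; rewrite /= normrN normrM ger0_norm// -mulrA ler_pM// mulrAC; exact: decay_apply.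
  - by rewrite ger0_norm ?(ltW r0)//; case/andP: r01.
pose X k : 'cV[R]_p.+1 := \col_i limn (fun N => U k N i 0).
have UX k : U k N @[N --> \oo] --> X k by apply: col_cvg => i; rewrite mxE; exact: Ucvg.
have XS k : X (k + 1) = A *m X k - (e k)%:R *: (Ps *m nR).
  apply/matrixP => i j; rewrite (ord1 j) [LHS]mxE.
  have H1 : U (k + 1) N.+1 i 0 @[N --> \oo] --> limn (fun N => U (k + 1) N i 0).
    by rewrite (cvg_shiftS (fun N => U (k + 1) N i 0)); exact: Ucvg.
  have H2 : (A *m U k N) i 0 - ((e k)%:R *: (Ps *m nR)) i 0 @[N --> \oo] -->
    (A *m X k) i 0 - ((e k)%:R *: (Ps *m nR)) i 0.
    apply: cvgB; last exact: cvg_cst.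
    exact: (continuous_cvg _ (@continuous_mulmx_coord R _ _ A i (X k)) (UX k)).
  have E : (fun N => U (k + 1) N.+1 i 0) = (fun N => (A *m U k N) i 0 - ((e k)%:R *: (Ps
    *m nR)) i 0).
    by apply/funext => N; rewrite US !mxE.
  by move: H1; rewrite E => H1; rewrite (cvg_unique _ H1 H2) // !mxE.
have LU k N : lcoord (U k N) = 0.
  rewrite /U lcoordN /lcoord mulmx_sumr summxE big1 ?oppr0// => j _.
  by rewrite -/(lcoord _) lcoordZ lcoordX lcoord_Ps !mulr0.
have LX k : lcoord (X k) = 0.
  have H1 : (l *m U k N) 0 0 @[N --> \oo] --> (l *m X k) 0 0.
    exact: (continuous_cvg _ (@continuous_mulmx_coord R _ _ l 0 (X k)) (UX k)).
  have H2 : (fun N => (l *m U k N) 0 0) = (fun=> 0) by apply/funext => N; exact: LU.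
  by move: H1; rewrite H2 => H1; rewrite /lcoord (cvg_unique _ H1 (cvg_cst _)).
have UB k N i : `|U k N i 0| <= drift.
  rewrite /U mxE normrN summxE (le_trans (ler_norm_sum _ _ _))//.
  have : \sum_(j < N) beta * C * nrm1 nR * rho ^+ j <= drift.
    suff -> : \sum_(j < N) beta * C * nrm1 nR * rho ^+ j = drift * (1 - rho ^+ N).
      by rewrite ler_piMr ?drift_ge0// gerBl exprn_ge0// ltW.
    elim: N => [|N IH]; first by rewrite big_ord0 subrr mulr0.
    rewrite big_ord_recr /= IH exprS /drift; field; rewrite gt_eqF//.
  apply: le_trans; apply: ler_sum => j _; rewrite mxE normrM ger0_norm//.
  by rewrite -!mulrA ler_pM// [nrm1 _ * _]mulrC mulrA decay_apply.
exists (fun k => a k *: v + X k); split => [k||k].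
- have [_ E] := aP k; rewrite XS mulmxDr -scalemxAr Av scalerA [a k * _]mulrC E Ps_apply
  lcoordn scale1r.
  by rewrite scalerDl scalerBr; apply/matrixP => i j; rewrite !mxE; ring.
- exists (nrm1 v + drift) => k i; rewrite mxE (le_trans (ler_normD _ _))// lerD//.
    have [/andP[a0 a1] _] := aP k.
    by rewrite mxE normrM ger0_norm// (le_trans _ (le_nrm1 v i))// ler_piMl// ltW.
  rewrite mxE ler_norml limr_ge ?limr_le//=.
  - by near=> N; have := UB k N i; rewrite ler_norml => /andP[].
  - by near=> N; have := UB k N i; rewrite ler_norml => /andP[].
by rewrite lcoordD LX addr0 lcoordZ lcoordv mulr1; have [] := aP k.
Unshelve. all: by end_near.
Qed.

(** * The lattice spanned by the Krylov vectors *)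

Lemma Au : A \in unitmx.
Proof. by rewrite unitmxE det_map_mx rmorph_unit// -unitmxE. Qed.

Definition in_krylov (x : 'cV[R]_p.+1) : Prop :=
  exists c : 'cV[int]_p.+1, x = map_mx intr (krylov M n *m c).

Lemma in_krylov_int x : in_krylov x -> x \in @int_lattice R p.+1.
Proof. by move=> [c ->]; apply/int_lattice_sub; exists (krylov M n *m c). Qed.

Lemma in_krylovB x y : in_krylov x -> in_krylov y -> in_krylov (x - y).
Proof. by move=> [c ->] [d ->]; exists (c - d); rewrite mulmxBr map_mxB. Qed.

Lemma in_krylov0 : in_krylov 0.
Proof. by exists 0; rewrite mulmx0 map_mx0. Qed.

Lemma in_krylovN x : in_krylov x -> in_krylov (- x).
Proof. by move=> /(in_krylovB in_krylov0); rewrite sub0r. Qed.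

Lemma in_krylovD x y : in_krylov x -> in_krylov y -> in_krylov (x + y).
Proof. by move=> xG /in_krylovN /(in_krylovB xG); rewrite opprK. Qed.

Lemma in_krylov_n : in_krylov nR.
Proof.
exists (\col_i (i == 0 :> nat)%:R); congr map_mx.
rewrite krylov_sum (bigD1 ord0) //= big1 ?addr0 => [|i]; first by rewrite mxE scale1r mul1mx.
by rewrite -val_eqE /= mxE => /negbTE ->; rewrite scale0r.
Qed.

Lemma in_krylovZ (k : nat) x : in_krylov x -> in_krylov (k%:R *: x).
Proof.
move=> xG; elim: k => [|k IH]; first by rewrite scale0r; exact: in_krylov0.
by rewrite -natr1 scalerDl scale1r; exact: in_krylovD.
Qed.

Lemma in_krylovA x : in_krylov x -> in_krylov (A *m x).
Proof.
move=> [c ->]; have [Cm _ E] := krylov_companion Mu dK.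
by exists (Cm *m c); rewrite -map_mxM !mulmxA E.
Qed.

Lemma in_krylovA_inv x : in_krylov (A *m x) -> in_krylov x.
Proof.
move=> [c E]; have [Cm Cu E'] := krylov_companion Mu dK.
exists (invmx Cm *m c); apply: (can_inj (mulKmx Au)); rewrite E -map_mxM.
by rewrite !mulmxA E' mulmxK.
Qed.

Lemma in_krylovX j x : in_krylov x -> in_krylov (A ^+ j *m x).
Proof.
move=> xG; elim: j => [|j IH]; first by rewrite mul1mx.
by rewrite -Aexpr_apply; exact: in_krylovA.
Qed.

Lemma in_krylovX_inv j x : in_krylov (A ^+ j *m x) -> in_krylov x.
Proof.
elim: j => [|j IH]; first by rewrite mul1mx.
by rewrite -Aexpr_apply => /in_krylovA_inv.
Qed.

Local Notation KR := (@map_mx int R intr p.+1 p.+1 (krylov M n)).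

Lemma KRu : KR \in unitmx.
Proof. by rewrite unitmxE det_map_mx unitfE intr_eq0. Qed.

Lemma lcoord_krylov (c : 'cV[R]_p.+1) : lcoord (KR *m c) = \sum_j c j 0 * beta ^+ j.
Proof.
rewrite /lcoord mulmxA mxE; apply: eq_bigr => j _; rewrite mulrC; congr (_ * _).
have -> : (l *m KR) 0 j = lcoord (col j KR).
  by rewrite [LHS]mxE /lcoord [RHS]mxE; apply: eq_bigr => i _; rewrite [col _ _ _ _]mxE.
have -> : col j KR = A ^+ j *m nR by rewrite -map_col col_krylov map_mxM rmorphXn.
by rewrite lcoordX lcoordn mulr1.
Qed.

Lemma in_krylov_Zbeta x : in_krylov x -> Zbeta beta (lcoord x).
Proof.
move=> [c ->]; rewrite map_mxM lcoord_krylov.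
apply: (big_ind (Zbeta beta)) => [|a b|j _]; [exact: (Zbeta_int _ 0)|exact: ZbetaD|].
by rewrite mxE; apply: ZbetaM; [exact: Zbeta_int|exact/ZbetaX/Zbeta_beta].
Qed.

(** Reducing [A ^+ i0 *m Y] modulo the lattice leaves coefficients in [0, 1) on the Krylov basis, so
    a coordinate between 0 and the sum of the [beta ^+ j]. Going back by [i0] steps preserves cosets
    and divides the coordinate by [beta ^+ i0], which exceeds that sum. *)
Lemma bounded_start : exists SB : R, forall Y : 'cV[R]_p.+1, exists s : 'cV[R]_p.+1,
  [/\ in_krylov (s - Y), 0 <= lcoord s < 1 & nrm1 s <= SB].
Proof.
have [i0 i0P] := expr_beta_unbounded b1 (\sum_(j < p.+1) beta ^+ j).
pose B := invmx (A ^+ i0).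
have AXu : A ^+ i0 \in unitmx by rewrite -[_ \in _]/(_ \is a GRing.unit) unitrX //; exact: Au.
exists (\sum_i \sum_j `|(B *m KR) i j|) => Y.
pose c := invmx KR *m (A ^+ i0 *m Y).
pose fl : 'cV[int]_p.+1 := \col_i Num.floor (c i 0).
pose fr : 'cV[R]_p.+1 := c - map_mx intr fl.
have fr01 i : 0 <= fr i 0 < 1.
  have frE (c' : 'cV[R]_p.+1) : (c' - map_mx intr (\col_i Num.floor (c' i 0)) :
    'cV[R]_p.+1) i 0 =
      c' i 0 - (Num.floor (c' i 0))%:~R by rewrite !mxE.
  rewrite [fr i 0](frE c).
  by rewrite subr_ge0 floor_le ltrBlDl; have := floorD1_gt (c i 0); rewrite intrD.
have E : A ^+ i0 *m (B *m KR *m fr) = A ^+ i0 *m Y - map_mx intr (krylov M n *m fl).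
  by rewrite -[B *m KR *m _]mulmxA mulKVmx // /fr mulmxBr mulKVmx ?KRu// map_mxM.
have LE : lcoord (A ^+ i0 *m (B *m KR *m fr)) = \sum_j fr j 0 * beta ^+ j.
  by rewrite -[B *m KR *m _]mulmxA mulKVmx // lcoord_krylov.
exists (B *m KR *m fr); split.
- apply: (@in_krylovX_inv i0); rewrite mulmxBr E addrAC subrr add0r.
  by apply: in_krylovN; exists fl.
- rewrite lcoordX in LE; have bi : 0 < beta ^+ i0 by rewrite exprn_gt0.
  rewrite -(pmulr_rge0 _ bi) -(ltr_pM2l bi) mulr1 LE sumr_ge0 /= => [|j _]; last first.
    by have /andP[f0 _] := fr01 j; rewrite mulr_ge0// exprn_ge0// ltW.
  apply: le_lt_trans i0P; apply: ler_sum => j _.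
  by have /andP[f0 f1] := fr01 j; rewrite ler_piMl ?(ltW f1)// exprn_ge0// ltW.
rewrite /nrm1; apply: ler_sum => i _; rewrite mxE (le_trans (ler_norm_sum _ _ _))//.
apply: ler_sum => j _; have /andP[f0 f1] := fr01 j.
by rewrite normrM (ger0_norm f0) ler_piMr// ltW.
Qed.

Definition gdigit (x : 'cV[R]_p.+1) : nat := Num.truncn (beta * lcoord x).
Definition gstep (x : 'cV[R]_p.+1) : 'cV[R]_p.+1 := A *m x - (gdigit x)%:R *: nR.

Lemma gstep_lcoord x : 0 <= lcoord x < 1 -> 0 <= lcoord (gstep x) < 1.
Proof.
move=> /andP[x0 _]; rewrite lcoordD lcoordN lcoordZ lcoordA lcoordn mulr1.
have := tau_itv beta (lcoord x); have := tau_digit b1 x0; rewrite /gdigit; lra.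
Qed.

Lemma iter_gstep_lcoord k x : 0 <= lcoord x < 1 -> 0 <= lcoord (iter k gstep x) < 1.
Proof. by move=> x01; elim: k => //= k; exact: gstep_lcoord. Qed.

Lemma iter_gstep_gam k x : in_krylov (iter k gstep x - A ^+ k *m x).
Proof.
elim: k => [|k IH] /=; first by rewrite mul1mx subrr; exact: in_krylov0.
rewrite /gstep addrAC -Aexpr_apply -mulmxBr.
by apply: in_krylovB; [exact: in_krylovA|exact/in_krylovZ/in_krylov_n].
Qed.

Lemma iter_gstep_bound k x i : 0 <= lcoord x < 1 ->
  `|iter k gstep x i 0| <= nrm1 v + C * nrm1 x + drift.
Proof.
move=> x01; have := @forward_bound (fun k => iter k gstep x) (fun k => gdigit (iter k gstep x)).
move=> /(_ (fun k => erefl) (fun k => iter_gstep_lcoord k x01) k i) /le_trans; apply.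
rewrite lerD2r lerD ?le_nrm1// ler_wpM2r ?nrm1_ge0// ler_piMr// exprn_ile1 ?(ltW r0)//.
by case/andP: r01 => _ /ltW.
Qed.

Lemma finite_bounded_coset (Y : 'cV[R]_p.+1) (B : R) : exists s : seq 'cV[R]_p.+1,
  forall x, in_krylov (x - Y) -> (forall i, `|x i 0| <= B) -> x \in s.
Proof.
have [N NP] : exists N : nat, forall i, B + `|Y i 0| <= N%:R.
  pose b i := (Num.truncn (B + `|Y i 0|)).+1.
  exists (\max_i b i)%N => i; rewrite (le_trans (ltW (truncnS_gt _)))// ler_nat.
  by rewrite -/(b i) leq_bigmax.
have [s sP] := bounded_int_vectors p.+1 N.
exists [seq Y + map_mx intr w | w <- s] => x /in_krylov_int/int_lattice_sub[w wE] xB.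
have -> : x = Y + map_mx intr w by rewrite -wE addrC subrK.
apply: (map_f (fun w => Y + map_mx intr w)); apply: sP => i.
have := congr1 (fun z : 'cV[R]_p.+1 => z i 0) wE; rewrite !mxE => E.
rewrite -(ler_int R) intr_norm -E (le_trans (ler_normB _ _))// -pmulrn.
by apply: le_trans (NP i); rewrite lerD2r.
Qed.

(* Greedy orbits started ever further in the past meet a fixed coset of the
   lattice in a finite set, so a limit along an ultrafilter is attained. *)
Lemma orbit_exists (Y : 'cV[R]_p.+1) : exists e y, orbit e y /\ in_krylov (y 0 - Y).
Proof.
have [SB SBP] := bounded_start.
have Aunit : A \is a GRing.unit by exact: Au.
(* [s j] is a start at time [- j], in the coset from which time [k] is reached in the coset of
   [A ^ k *m Y], whatever [j] is. *)
have /choice[s sP] (j : nat) := SBP (A ^ (- j%:Z) *m Y).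
pose yy (j : nat) (k : int) := iter (absz (k + j%:Z)) gstep (s j).
pose B := nrm1 v + C * SB + drift.
have yyB j k i : `|yy j k i 0| <= B.
  have [_ s01 sB] := sP j; apply: le_trans (iter_gstep_bound _ _ s01) _.
  by rewrite lerD2r lerD2l ler_wpM2l.
have yyG (j : nat) (k : int) : 0 <= k + j%:Z -> in_krylov (yy j k - A ^ k *m Y).
  move=> kj; have [sG _ _] := sP j; rewrite /yy; set i := absz _.
  have ki : k = i%:Z - j%:Z by rewrite /i gez0_abs// addrK.
  have -> : A ^ k *m Y = A ^+ i *m (A ^ (- j%:Z) *m Y).
    by rewrite ki exprzDr // mulmxA.
  have := in_krylovD (iter_gstep_gam i (s j)) (in_krylovX i sG).
  by rewrite mulmxBr addrA subrK.
have [U [UU sU]] := @ultraFilterLemma _ (nbhs \oo) _.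
have Uj (k : int) : U [set j : nat | 0 <= k + j%:Z].
  by apply: sU; exists (absz k) => // j; exact: absz_le_addz.
have /choice[z zP] (k : int) : exists x, U [set j | yy j k = x].
  have [t tP] := finite_bounded_coset (A ^ k *m Y) B.
  apply: (@ultra_finite _ _ _ t); apply: filterS (Uj k) => j kj.
  by apply: tP; [exact: yyG|move=> i; exact: yyB].
have z01 k : 0 <= lcoord (z k) < 1.
  have [j <-] := filter_ex (zP k); have [_ s01 _] := sP j.
  exact: iter_gstep_lcoord.
exists (fun k => gdigit (z k)), z; split; last first.
  have [j [<- j0]] := filter_ex (filterI (zP 0) (Uj 0)).
  by have := yyG _ _ j0; rewrite expr0z mul1mx.
split=> // [k|].
  have [j [[<- <-] j0]] := filter_ex (filterI (filterI (zP (k + 1)) (zP k)) (Uj k)).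
  by rewrite -/(gstep _) /yy -iterS addrAC abszS.
exists B => k i; have [j <-] := filter_ex (zP k); exact: yyB.
Qed.

(** * The coding computed on orbits *)

Lemma toral_powE (k : int) x : toral_pow M k (tproj x) = tproj (A ^ k *m x).
Proof.
have it (B : 'M[int]_p.+1) j : iter j (toral_map B) (tproj x) = tproj ((map_mx intr B) ^+
  j *m x).
  elim: j => [|j IH] /=; first by rewrite mul1mx.
  by rewrite IH toral_mapE mulmxA exprS.
case: k => j /=; first by rewrite it.
have -> : A ^ Negz j = (map_mx intr (invmx M) : 'M[R]_p.+1) ^+ j.+1.
  rewrite NegzE -exprnN -exprVn; congr (_ ^+ _).
  by rewrite -[invmx M]/(M^-1) rmorphV.
by rewrite -it iterS.
Qed.

Lemma exprNv (N : nat) : A ^ (- N%:Z) *m v = (beta ^+ N)^-1 *: v.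
Proof.
have Xv j : A ^+ j *m v = beta ^+ j *: v.
  elim: j => [|j IH]; first by rewrite mul1mx scale1r.
  by rewrite -Aexpr_apply IH -scalemxAr Av scalerA -exprSr.
have Xu : A ^+ N \in unitmx by rewrite -[_ \in _]/(_ \is a GRing.unit) unitrX //; exact: Au.
apply: (can_inj (mulKmx Xu)); rewrite -exprnN mulKVmx // -scalemxAr Xv scalerA mulVf ?scale1r//.
by rewrite gt_eqF// exprn_gt0.
Qed.

(** Since [v = nR - Ps *m nR], the growing vector [A ^+ N *m v] is, modulo integer vectors, the
    decaying [- A ^+ N *m (Ps *m nR)]. *)
Lemma exprPv (N : nat) : in_krylov (A ^+ N *m v + A ^+ N *m (Ps *m nR)).
Proof.
rewrite -mulmxDr Ps_apply lcoordn scale1r addrC subrK; exact/in_krylovX/in_krylov_n.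
Qed.

Lemma decay_cvg0 (x : nat -> 'cV[R]_p.+1) (B : R) : (forall N, nrm1 (x N) <= B) ->
  A ^+ N *m (Ps *m x N) @[N --> \oo] --> (0 : 'cV[R]_p.+1).
Proof.
move=> xB; apply: col_cvg => i; rewrite mxE.
have g0 : geometric (C * B) rho @ \oo --> (0 : R).
  by apply: cvg_geometric; rewrite ger0_norm ?(ltW r0)//; case/andP: r01.
have g0' : - geometric (C * B) rho N @[N --> \oo] --> (0 : R).
  by rewrite -[X in _ --> X]oppr0; exact: cvgN.
apply: (squeeze_cvgr _ g0' g0); near=> N; rewrite -ler_norml /geometric /=.
rewrite (le_trans (decay_apply _ _ _))// mulrAC ler_wpM2r ?exprn_ge0 ?(ltW r0)//.
by rewrite ler_wpM2l.
Unshelve. all: by end_near.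
Qed.

Lemma beta_inv_cvg0 (c : nat -> R) (B : R) : (forall N, `|c N| <= B) ->
  ((beta ^+ N)^-1 * c N) *: v @[N --> \oo] --> (0 : 'cV[R]_p.+1).
Proof.
move=> cB; apply: col_cvg => i; rewrite mxE.
have g0 : geometric (B * `|v i 0|) beta^-1 @ \oo --> (0 : R).
  by apply: cvg_geometric; rewrite ger0_norm ?invr_ge0 ?(ltW b0)// invf_lt1.
have g0' : - geometric (B * `|v i 0|) beta^-1 N @[N --> \oo] --> (0 : R).
  by rewrite -[X in _ --> X]oppr0; exact: cvgN.
apply: (squeeze_cvgr _ g0' g0); near=> N; rewrite -ler_norml /geometric /= mxE !normrM.
have bN : 0 <= (beta ^+ N)^-1 by rewrite invr_ge0 exprn_ge0// ltW.
by rewrite (ger0_norm bN) exprVn -mulrA [X in _ <= X]mulrC ler_wpM2l// ler_wpM2r.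
Unshelve. all: by end_near.
Qed.

(** The partial sum up to [N] is the image of [A *m y 0 - r N] with a remainder [r N] tending to 0;
    going from [N] to [N + 1] changes the two sides by the same amount modulo the lattice. *)
Lemma coding_orbit e y : orbit e y -> coding M (tproj v) e = tproj (A *m y 0).
Proof.
move=> oy; have [yS [B yB] y01] := oy.
(* The first term holds the digits from [N] on, the second the contracted state at time [- N], which
   holds those before [- N]. *)
pose r (N : nat) := ((beta ^+ N)^-1 * (beta * lcoord (y N%:Z))) *: v
   + A ^+ N *m (Ps *m (A *m y (- N%:Z))).
have rE N : r N - r N.+1 = ((beta ^+ N)^-1 * (e N%:Z)%:R) *: v
   - (e (- N.+1%:Z))%:R *: (A ^+ N.+1 *m (Ps *m nR)).
  have E1 : (beta ^+ N)^-1 * (beta * lcoord (y N%:Z)) - (beta ^+ N.+1)^-1 * (beta *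
    lcoord (y N.+1%:Z)) =
      (beta ^+ N)^-1 * (e N%:Z)%:R.
    rewrite (orbit_digit _ oy).2 -PoszSr exprS; field.
    by rewrite expf_neq0 ?gt_eqF.
  have E2 : A ^+ N *m (Ps *m (A *m y (- N%:Z))) - A ^+ N.+1 *m (Ps *m (A *m y (- N.+1%:Z))) =
     - (e (- N.+1%:Z))%:R *: (A ^+ N.+1 *m (Ps *m nR)).
    have -> : y (- N%:Z) = A *m y (- N.+1%:Z) - (e (- N.+1%:Z))%:R *: nR.
      by rewrite -yS; congr y; rewrite PoszSr; ring.
    rewrite [Ps *m (A *m (_ - _))]Ps_comm exprA_apply -mulmxBr -mulmxBr addrAC subrr add0r.
    by rewrite !mulmxN -!scalemxAr scaleNr.
  by rewrite /r opprD addrACA -scalerBl E1 E2 scaleNr.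
have SE N : \sum_(0 <= k < N) (toral_pow M (- k%:Z) (tproj v) *+ e k%:Z
     + toral_pow M k.+1%:Z (tproj v) *+ e (- k.+1%:Z)) = tproj (A *m y 0 - r N).
  elim: N => [|N IH].
    have -> : r 0%N = A *m y 0.
      by rewrite /r expr0 invr1 mul1r mul1mx Ps_apply oppr0 lcoordA [LHS]addrC subrK.
    by rewrite big_geq // subrr tproj0.
  rewrite big_nat_recr //= IH -[toral_map M _]/(toral_pow M N.+1%:Z (tproj v)) !toral_powE.
  rewrite -!tprojMn -!tprojD; apply/tproj_eq/in_krylov_int.
  have -> : A *m y 0 - r N + ((A ^ (- N%:Z) *m v) *+ e N%:Z + (A ^ N.+1%:Z *m v) *+ e (-
    N.+1%:Z)) -
      (A *m y 0 - r N.+1) = (e (- N.+1%:Z))%:R *: (A ^+ N.+1 *m v + A ^+ N.+1 *m (Ps *m nR)).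
    have -> : (A ^ (- N%:Z) *m v) *+ e N%:Z = ((beta ^+ N)^-1 * (e N%:Z)%:R) *: v.
      by rewrite -scaler_nat exprNv scalerA mulrC.
    have -> : (A ^ N.+1%:Z *m v) *+ e (- N.+1%:Z) = (e (- N.+1%:Z))%:R *: (A ^+ N.+1 *m v).
      by rewrite -scaler_nat.
    have -> : r N.+1 = r N - (r N - r N.+1) by rewrite opprB addrC subrK.
    rewrite rE scalerDr; exact: telescope_step.
  exact/in_krylovZ/exprPv.
rewrite /coding; apply: (cvg_lim (@torus_hausdorff R p.+1)).
rewrite (_ : (fun N => _) = (fun N => tproj (A *m y 0 - r N))); last by apply/funext.
apply: (continuous_cvg _ (@tproj_continuous R p.+1 _)).
rewrite -[X in _ --> X]subr0; apply: cvgB; first exact: cvg_cst.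
rewrite -[X in _ --> X]addr0; apply: cvgD.
  apply: (@beta_inv_cvg0 _ beta) => N; have /andP[a0 a1] := y01 N%:Z.
  by rewrite ger0_norm ?mulr_ge0 ?(ltW b0)// ger_pMr// ltW.
have [B' B'P] : exists B', forall k, nrm1 (A *m y k) <= B'.
  exists (\sum_i \sum_j `|A i j| * B) => k; apply: ler_sum => i _.
  rewrite mxE (le_trans (ler_norm_sum _ _ _))//; apply: ler_sum => j _.
  by rewrite normrM ler_wpM2l.
exact: decay_cvg0 (fun N => B'P _).
Qed.

(** * Merging of orbits in one coset *)

Lemma orbit_gam e y k i : orbit e y -> in_krylov (y (k + i%:Z) - A ^+ i *m y k).
Proof.
move=> [yS _ _]; elim: i => [|i IH]; first by rewrite addr0 mul1mx subrr; exact: in_krylov0.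
rewrite PoszSr addrA yS addrAC -Aexpr_apply -mulmxBr.
by apply: in_krylovB; [exact: in_krylovA|exact/in_krylovZ/in_krylov_n].
Qed.

Lemma orbit_gam_past e y e' y' i : orbit e y -> orbit e' y' -> in_krylov (y 0 - y' 0) ->
  in_krylov (y (- i%:Z) - y' (- i%:Z)).
Proof.
move=> oy oy' G0; apply: (@in_krylovX_inv i); rewrite mulmxBr.
have := in_krylovB (orbit_gam (- i%:Z) i oy) (orbit_gam (- i%:Z) i oy').
rewrite addNr => /(in_krylovB G0).
move: (A ^+ i *m y (- i%:Z)) (A ^+ i *m y' (- i%:Z)) => a b.
have -> // : y 0 - y' 0 - (y 0 - a - (y' 0 - b)) = a - b.
by move: (y 0) (y' 0) => c d; apply/matrixP => r t; rewrite !mxE; ring.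
Qed.

(* The coordinates of the two orbits differ by one of finitely many elements of
   Z[beta]; reading the synchronizing word makes them equal from then on. *)
Lemma sync_orbits : weakly_finitary beta -> Zbeta beta beta^-1 ->
  exists f N, 0 <= f < 1 /\ forall e y e' y', orbit e y -> orbit e' y' ->
    in_krylov (y 0 - y' 0) ->
    (forall j : nat, exists2 i : nat,
      (j <= i)%N & same_digits beta N (lcoord (y (- i%:Z))) f) ->
    e = e'.
Proof.
move=> W Zi.
pose B := (Num.truncn (obound + obound)).+1.
have [s sP] := bounded_int_vectors p.+1 B.
pose gs := [seq lcoord (map_mx intr w) | w <- s & `[<in_krylov (map_mx intr w)>]].
have [f [N [f01 fP]]] : exists f N, 0 <= f < 1 /\ forall g a, g \in gs -> 0 <= a < 1 ->
  same_digits beta N a f ->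
    0 <= a - g < 1 -> iter N (beta_shift beta) (a - g) = iter N (beta_shift beta) a.
  apply: (sync_word b1 Zi W) => g /mapP[w]; rewrite mem_filter => /andP[/asboolP wG _] ->.
  exact: in_krylov_Zbeta.
exists f, N; split=> // e y e' y' oy oy' G0 often.
have y01 k : 0 <= lcoord (y k) < 1 by case: oy.
have y01' k : 0 <= lcoord (y' k) < 1 by case: oy'.
have merge k i : lcoord (y k) = lcoord (y' k) -> lcoord (y (k + i%:Z)) = lcoord (y' (k + i%:Z)).
  by move=> E; rewrite -(orbit_tau k i oy) -(orbit_tau k i oy') E.
have same k : lcoord (y k) = lcoord (y' k).
  (* An occurrence of the word at [- i] is taken so early that its last digit has been read by time
     [k]. *)
  have [i ji sd] := often (N + absz k)%N.
  have g : lcoord (y (- i%:Z) - y' (- i%:Z)) \in gs.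
    have gG := orbit_gam_past i oy oy' G0.
    have /int_lattice_sub[w wE] := in_krylov_int gG.
    rewrite wE; apply: (map_f (fun w => lcoord (map_mx intr w))).
    rewrite mem_filter; apply/andP; split; first by apply/asboolP; rewrite -wE.
    apply: sP => a; have := congr1 (fun z : 'cV[R]_p.+1 => z a 0) wE; rewrite !mxE => E.
    rewrite -(ler_int R) intr_norm -E -pmulrn (le_trans _ (ltW (truncnS_gt _)))//.
    by rewrite (le_trans (ler_normB _ _))// lerD// (orbit_bound oy, orbit_bound oy').
  have sub : lcoord (y (- i%:Z)) - lcoord (y (- i%:Z) - y' (- i%:Z)) = lcoord (y' (- i%:Z)).
    by rewrite lcoordD lcoordN; ring.
  have := fP _ (lcoord (y (- i%:Z))) g (y01 _) sd; rewrite sub => /(_ (y01' _)).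
  rewrite (orbit_tau _ N oy) (orbit_tau _ N oy') => E.
  have [q ->] := absz_shift ji; exact/merge/esym.
apply/funext => k.
have E1 := (orbit_digit k oy).2; have E2 := (orbit_digit k oy').2.
move: E1; rewrite same E2 same => /addIr /eqP; rewrite eqr_nat => /eqP; exact.
Qed.

(** * Null sets and the count of preimages *)

Lemma small_negligible d (T : measurableType d) (mu : {measure set T -> \bar R}) (D : set T) :
  (forall eps : R, 0 < eps -> exists U, [/\ measurable U, D `<=` U & (mu U <= eps%:E)%E]) ->
  mu.-negligible D.
Proof.
move=> H.
have /choice[U UP] (k : nat) : exists U, [/\ measurable U,
  D `<=` U & (mu U <= (k.+1%:R^-1)%:E)%E].
  by apply: H; rewrite invr_gt0.
exists (\bigcap_k U k); split.
- by apply: bigcap_measurableType => k _; have [] := UP k.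
- apply/eqP; rewrite eq_le measure_ge0 andbT; apply/lee_addgt0Pr => e e0.
  rewrite add0e; pose k := Num.truncn e^-1.
  have [mUk _ Uk] := UP k; apply: (le_trans (y := mu (U k))).
    apply: le_measure; rewrite ?inE//; last exact: bigcap_inf.
    by apply: bigcap_measurableType => i _; have [] := UP i.
  apply: le_trans Uk _; rewrite lee_fin -[e]invrK lef_pV2 ?posrE ?invr_gt0//.
  exact/ltW/truncnS_gt.
- by move=> x Dx k _; have [_ + _] := UP k; apply.
Qed.

Lemma tslab_union (B : 'M[int]_p.+1) (D K : R) (s : seq (R * R)) : B \in unitmx ->
  (forall a h, 0 < h -> (haar R p.+1 (tslab l B D a h) <= (K * h)%:E)%E) ->
  (forall q, q \in s -> 0 < q.2) ->
  exists U, [/\ measurable U, forall q, q \in s -> tslab l B D q.1 q.2 `<=` U &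
    (haar R p.+1 U <= (K * \sum_(q <- s) q.2)%:E)%E].
Proof.
move=> Bu HK; elim: s => [_|q s IH H].
  by exists set0; split; rewrite // ?measure0 ?big_nil ?mulr0.
have [|U [mU sU hU]] := IH; first by move=> r rs; apply: H; rewrite inE rs orbT.
have mq := @measurable_tslab R p.+1 l B D q.1 q.2 Bu.
exists (tslab l B D q.1 q.2 `|` U); split; first exact: measurableU.
  by move=> r; rewrite inE => /orP[/eqP -> x|/sU rU x /rU]; [left|right].
apply: (le_trans (measureU2 _ mq mU)); rewrite big_cons mulrDr EFinD.
by apply: leeD => //; apply: HK; apply: H; exact: mem_head.
Qed.

(** At time [- (j + m)] the coordinate avoids the word at [m] consecutive places, so it lies in a
    cover of small total length. The coded point is the image of that state under [M ^+ (j + m).+1],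
    hence lies in a union of thin slabs. *)
Lemma avoiding_null f N (j : nat) : 0 <= f < 1 ->
  (haar R p.+1).-negligible [set t | exists e y, [/\ orbit e y, tproj (A *m y 0) = t &
    forall i : nat, (j <= i)%N -> ~ same_digits beta N (lcoord (y (- i%:Z))) f]].
Proof.
move=> f01; have [K K0 KP] := slab_haar lv (obound + 1).
apply: small_negligible => eps e0.
(* The 3 pays for the enlarged intervals of [s'], and [K + 1] avoids division by zero. *)
have e1 : 0 < eps / (3 * (K + 1)) by rewrite divr_gt0// mulr_gt0// ltr_wpDl.
have [m [s [s1 s2 s3]]] := avoid_small_cover b1 N f01 e1.
pose i := (j + m)%N.
have Bu : M ^+ i.+1 \in unitmx by rewrite -[_ \in _]/(_ \is a GRing.unit) unitrX.
(* Slabs are open and the covering intervals closed, so each interval is extended by its own width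
   on both sides. *)
pose s' := [seq (q.1 - q.2, 3 * q.2) | q <- s].
have [|U [mU sU hU]] := @tslab_union (M ^+ i.+1) (obound + 1) K s' Bu (fun a h h0 => KP _
  a h Bu h0).
  by move=> _ /mapP[q /s1/andP[q0 _] ->] /=; rewrite mulr_gt0.
exists U; split; [exact: mU|move=> t [e [y [oy <- av]]]|]; last first.
  apply: le_trans hU _; rewrite lee_fin big_map /= -mulr_sumr.
  have : K * (3 * (eps / (3 * (K + 1)))) <= eps.
    have K1 : 0 < K + 1 by rewrite ltr_wpDl.
    rewrite (_ : K * _ = eps * (K / (K + 1))); last by field; rewrite gt_eqF.
    by rewrite ler_piMr ?(ltW e0)// ler_pdivrMr// mul1r lerDl.
  by apply: le_trans; rewrite ler_wpM2l// ler_pM2l.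
have aE : avoid beta f N m (lcoord (y (- i%:Z))).
  split; first by case: oy.
  move=> k km; rewrite (orbit_tau _ k oy).
  have ki : (k <= i)%N by rewrite (leq_trans (ltnW km))// leq_addl.
  by rewrite negz_addn//; apply: av; rewrite leq_subRL// addnC leq_add2l ltnW.
have [q qs /andP[qa qb]] := s2 _ aE; have /andP[q0 _] := s1 _ qs.
apply: (sU (q.1 - q.2, 3 * q.2)); first exact: (map_f (fun q => (q.1 - q.2, 3 * q.2))).
have := orbit_gam (- i%:Z) i oy; rewrite addNr => /in_krylovA /in_krylov_int.
rewrite mulmxBr Aexpr_apply => /tproj_eq ->.
exists (A ^+ i.+1 *m y (- i%:Z)) => //; exists (y (- i%:Z)); last by rewrite rmorphXn.
split; last by rewrite /=; move: qa qb; rewrite /lcoord; lra.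
by move=> k; rewrite (le_lt_trans (orbit_bound oy _ _))// ltrDl.
Qed.

(* Each coset of the lattice spanned by the Krylov vectors holds one preimage. *)
Lemma ae_preimages_krylov : weakly_finitary beta -> Zbeta beta beta^-1 ->
  ae_preimages M beta (tproj v) `|\det (krylov M n)|%N.
Proof.
move=> W Zi; have [f [N [f01 sync]]] := sync_orbits W Zi.
have [F [g [cF gex ginj]]] := int_cosets dK.
apply: negligibleS (negligible_bigcup (fun j => avoiding_null N j f01)).
move=> x /= ncard; apply: contrapT => nbad; apply: ncard.
have often e y : orbit e y -> tproj (A *m y 0) = x -> forall j : nat,
    exists2 i : nat, (j <= i)%N & same_digits beta N (lcoord (y (- i%:Z))) f.
  move=> oy yx j; apply: contrapT => nex; apply: nbad; exists j => //.
  by exists e, y; split=> // i ji sd; apply: nex; exists i.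
pose x0 := invmx A *m repr x.
have x0E : tproj (A *m x0) = x by rewrite mulKVmx ?Au// tproj_repr.
have /choice[Th ThP] (c : F) : exists e, exists y,
  orbit e y /\ in_krylov (y 0 - (x0 + map_mx intr (g c))).
  exact: orbit_exists.
have Ax (c : F) y : in_krylov (y - (x0 + map_mx intr (g c))) -> tproj (A *m y) = x.
  move=> /in_krylovA/in_krylov_int; rewrite mulmxBr => /tproj_eq ->.
  rewrite mulmxDr -[RHS]x0E; apply/tproj_eq; rewrite addrAC subrr add0r.
  by apply/int_lattice_sub; exists (M *m g c); rewrite map_mxM.
have -> : beta_compactum beta `&` coding M (tproj v) @^-1` [set x] =
    (fun i : 'I_#|F| => Th (enum_val i)) @` setT.
  apply/seteqP; split => [e [eX /= ex]|_ [i _ <-]]; last first.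
    have [y [oy yG]] := ThP (enum_val i); split; first exact: orbit_compactum oy.
    by rewrite /= (coding_orbit oy); exact: Ax yG.
  have [y oy] := compactum_orbit eX; rewrite (coding_orbit oy) in ex.
  have /tproj_eq/int_lattice_sub[w wE] : tproj (A *m y 0) = tproj (A *m x0) by rewrite ex x0E.
  have yw : y 0 - x0 = map_mx intr (invmx M *m w).
    apply: (can_inj (mulKmx Au)); rewrite mulmxBr wE -map_mxM mulmxA mulmxV// mul1mx //.
  have [c [d dE]] := gex (invmx M *m w).
  have yG : in_krylov (y 0 - (x0 + map_mx intr (g c))).
    by exists d; rewrite opprD addrA yw -map_mxB dE addrAC subrr add0r.
  exists (enum_rank c) => //; rewrite enum_rankK; have [y' [oy' y'G]] := ThP c.
  apply/esym; apply: (sync _ _ _ _ oy oy' _ (often _ _ oy ex)).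
  by have := in_krylovB yG y'G; rewrite opprB addrA subrK.
rewrite -cF; apply: (card_eq_trans (inj_card_eq _)); last by rewrite card_eq_sym card_II.
(* Equal digits force equal orbits, whose state at time 0 lies in only one coset. *)
move=> i j _ _ ThE; apply: enum_val_inj.
have [y [oy yG]] := ThP (enum_val i); have [y' [oy' y'G]] := ThP (enum_val j).
rewrite -ThE in oy'; rewrite -(orbit_unique oy oy') in y'G.
have [d dE] := in_krylovB y'G yG.
apply: (ginj _ _ d); apply: (@map_intr_inj R).
rewrite map_mxB -dE; exact/esym/coset_step.
Qed.

Lemma homoclinic_v : homoclinic M (tproj v).
Proof.
rewrite /homoclinic /mkset -tproj0; split.
  have -> : (fun k : nat => toral_pow M k%:Z (tproj v)) =
      (fun k => tproj (- (A ^+ k *m (Ps *m nR)))).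
    apply/funext => k; rewrite toral_powE -exprnP; apply/tproj_eq/in_krylov_int.
    by rewrite opprK; exact: exprPv.
  apply: (continuous_cvg _ (@tproj_continuous R p.+1 _)).
  rewrite -[X in _ --> X]oppr0; apply: cvgN.
  exact: (@decay_cvg0 (fun=> nR) (nrm1 nR)).
have -> : (fun k : nat => toral_pow M (- k%:Z) (tproj v)) =
    (fun k => tproj (((beta ^+ k)^-1 * 1) *: v)).
  by apply/funext => k; rewrite toral_powE exprNv mulr1.
apply: (continuous_cvg _ (@tproj_continuous R p.+1 _)).
by apply: (@beta_inv_cvg0 (fun=> 1) 1) => _; rewrite normr1.
Qed.

(** If [v] were an integer vector, so would be all [A ^ (- k) *m v], since [M] is unimodular; these
    are [v] divided by [beta ^+ k], so their entries eventually vanish. *)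
Lemma tproj_v_neq0 : tproj v <> 0.
Proof.
rewrite -tproj0 => /tproj_eq; rewrite subr0 => /int_lattice_sub[w wE].
suff v0 : v = 0 by have := lcoordv; rewrite v0 /lcoord mulmx0 mxE => /eqP;
  rewrite eq_sym oner_eq0.
apply/matrixP => i j; rewrite (ord1 j) [RHS]mxE.
have [k kP] := expr_beta_unbounded b1 `|v i 0|.
have bk : 0 < beta ^+ k by rewrite exprn_gt0.
have [w' w'E] : exists w' : 'cV[int]_p.+1, (beta ^+ k)^-1 *: v = map_mx intr w'.
  exists (invmx M ^+ k *m w); rewrite -exprNv map_mxM -wE; congr (_ *m _).
  by rewrite -exprnN -exprVn rmorphXn; congr (_ ^+ _); rewrite -[invmx M]/(M^-1) rmorphV.
have := congr1 (fun z : 'cV[R]_p.+1 => z i 0) w'E; rewrite !mxE => E.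
have : `|(w' i 0)%:~R| < 1 :> R.
  by rewrite -E normrM gtr0_norm ?invr_gt0// mulrC ltr_pdivrMr// mul1r.
rewrite -intr_norm -[1]/(1%:~R) ltr_int => w1.
have w0 : w' i 0 = 0 by apply/eqP; rewrite -absz_eq0 -leqn0 -ltnS -ltz_nat abszE.
by move/eqP: E; rewrite w0 mulf_eq0 invr_eq0 gt_eqF//= => /eqP.
Qed.

Lemma stable_lcoord x : (exists N D, forall k i, (N <= k)%N -> `|(A ^+ k *m x) i 0| <= D) ->
  lcoord x = 0.
Proof.
move=> [N [D H]]; apply/eqP; apply: contraT; rewrite -normr_gt0 => x0.
have [k kP] := expr_beta_unbounded b1 ((\sum_j `|l 0 j| * D) / `|lcoord x|).
pose k' := (k + N)%N.
have kk' : beta ^+ k <= beta ^+ k' by rewrite ler_weXn2l ?(ltW b1)// leq_addr.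
have : `|lcoord (A ^+ k' *m x)| <= \sum_j `|l 0 j| * D.
  rewrite /lcoord mxE (le_trans (ler_norm_sum _ _ _))// ler_sum// => j _.
  by rewrite normrM ler_wpM2l// H// leq_addl.
rewrite lcoordX normrM ger0_norm ?exprn_ge0 ?(ltW b0)// leNgt -ltr_pdivrMr//.
by rewrite (lt_le_trans kP).
Qed.

Lemma unstable_line x : (exists N D, forall k i, (N <= k)%N ->
  `|((A^-1) ^+ k *m x) i 0| <= D) ->
  x = lcoord x *: v.
Proof.
move=> [N [D H]]; apply/eqP; rewrite -subr_eq0 -Ps_apply; apply/eqP/matrixP => i j.
rewrite (ord1 j) [RHS]mxE; apply/eqP; apply: contraT; rewrite -normr_gt0 => x0.
have [|J JP] := @pow_small (C * (p.+1%:R * `|D|)) (`|(Ps *m x) i 0| / 2);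
  first by rewrite divr_gt0.
pose k := (J + N)%N; pose y := (A^-1) ^+ k *m x.
have xy : x = A ^+ k *m y.
  have Xu : A ^+ k \in unitmx by rewrite -[_ \in _]/(_ \is a GRing.unit) unitrX //; exact: Au.
  by rewrite /y exprVn mulKVmx.
have PsX j' (z : 'cV[R]_p.+1) : Ps *m (A ^+ j' *m z) = A ^+ j' *m (Ps *m z).
  elim: j' => [|j' IH]; first by rewrite !mul1mx.
  by rewrite -!Aexpr_apply Ps_comm IH.
have yD i' : `|y i' 0| <= `|D|.
  by apply: le_trans (ler_norm D); apply: H; exact: leq_addl.
have ny : nrm1 y <= p.+1%:R * `|D|.
  by rewrite /nrm1 (le_trans (ler_sum _ (fun i _ => yD i)))// sumr_const card_ord mulr_natl.
have := decay_apply k y i; rewrite -PsX -xy => h.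
have : C * rho ^+ k * nrm1 y <= C * (p.+1%:R * `|D|) * rho ^+ J.
  rewrite mulrAC; apply: ler_pM; rewrite ?mulr_ge0 ?nrm1_ge0 ?exprn_ge0 ?(ltW r0)//.
    by rewrite ler_wpM2l.
  by rewrite ler_wiXn2l ?(ltW r0) ?leq_addr//; case/andP: r01 => _ /ltW.
lra.
Qed.

(** Serves the homoclinic point 0, whose coding is constant: the origin lies in slabs of arbitrarily
    small thickness. *)
Lemma haar_zero_negligible : (haar R p.+1).-negligible [set 0].
Proof.
have [K K0 KP] := slab_haar lv 1.
apply: small_negligible => eps e0.
pose h := eps / (K + 1).
have K1 : 0 < K + 1 by rewrite ltr_wpDl.
have h0 : 0 < h by rewrite divr_gt0.
exists (tslab l 1%:M 1 (- (h / 2)) h); split.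
- by apply: measurable_tslab; exact: unitmx1.
- move=> _ ->; rewrite -tproj0; exists 0 => //; exists 0; last by rewrite mulmx0.
  by split=> [i|]; rewrite ?mulmx0 !mxE ?normr0//; lra.
apply: le_trans (KP _ _ _ (unitmx1 _ _) h0) _; rewrite lee_fin /h.
rewrite mulrCA ler_piMr ?(ltW e0)// ler_pdivrMr// mul1r lerDl //.
Qed.

End Orbits.

(** * Homoclinic points *)

Section ForwardLift.
Variables (R : realType) (p : nat) (B : 'M[int]_p.+1).
Hypothesis Bu : B \in unitmx.
Local Notation BR := (@map_mx int R intr p.+1 p.+1 B).

Lemma iter_toral_map k x : iter k (toral_map B) (tproj x) = tproj (BR ^+ k *m x).
Proof.
elim: k => [|k IH] /=; first by rewrite mul1mx.
by rewrite IH toral_mapE mulmxA exprS.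
Qed.

(* Consecutive small lifts differ by a small integer vector, hence by 0. *)
Lemma torus_forward_lift (t : torus R p.+1) :
  iter k (toral_map B) t @[k --> \oo] --> (0 : torus R p.+1) ->
  exists2 x : 'cV[R]_p.+1, tproj x = t &
    exists N D, forall k i, (N <= k)%N -> `|(BR ^+ k *m x) i 0| <= D.
Proof.
move=> t0; pose S := \sum_i \sum_j `|BR i j|.
have S0 : 0 <= S by apply: sumr_ge0 => i _; apply: sumr_ge0.
(* Then [d + S * d = 1 / 2], so the integer vector by which [z k.+1] and [BR *m z k] differ has
   entries below 1. *)
pose d : R := (2 * (1 + S))^-1.
have S1 : 0 < 1 + S by rewrite ltr_pwDl.
have d0 : 0 < d by rewrite invr_gt0 mulr_gt0.
have [N _ NP] := torus_cvg0_lift d0 t0.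
have /choice[z zP] (k : nat) : exists z : 'cV[R]_p.+1, (N <= k)%N ->
    tproj z = iter k (toral_map B) t /\ forall i, `|z i 0| < d.
  have [Nk|_] := leqP N k; last by exists 0.
  by have [z zt zd] := NP k Nk; exists z.
have Bz k i : (N <= k)%N -> `|(BR *m z k) i 0| <= S * d.
  move=> Nk; rewrite mxE (le_trans (ler_norm_sum _ _ _))//.
  have Si : \sum_j `|BR i j| <= S
    by rewrite /S [X in _ <= X](bigD1 i) //= lerDl sumr_ge0// => a _; exact: sumr_ge0.
  apply: le_trans (ler_wpM2r (ltW d0) Si); rewrite mulr_suml; apply: ler_sum => j _.
  by rewrite normrM ler_wpM2l//; apply/ltW; exact: (zP k Nk).2.
have zS k : (N <= k)%N -> z k.+1 = BR *m z k.
  move=> Nk; have Nk1 : (N <= k.+1)%N by apply: leqW.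
  have [z1t z1d] := zP _ Nk1; have [zt _] := zP _ Nk.
  have /tproj_eq/int_lattice_sub[w wE] : tproj (z k.+1) = tproj (BR *m z k).
    by rewrite z1t iterS -zt toral_mapE.
  apply/eqP; rewrite -subr_eq0 wE; apply/eqP/matrixP => i j; rewrite (ord1 j) !mxE.
  have subE (a b : 'cV[R]_p.+1) : (a - b) i 0 = a i 0 - b i 0 by rewrite !mxE.
  have := congr1 (fun y : 'cV[R]_p.+1 => y i 0) wE; rewrite subE [RHS]mxE => E.
  have : `|(w i 0)%:~R| < 1 :> R.
    rewrite -E (le_lt_trans (ler_normB _ _))//.
    have := z1d i; have := Bz k i Nk.
    have : d + S * d = 2^-1 by rewrite /d; field; rewrite gt_eqF.
    lra.
  rewrite -intr_norm -[1]/(1%:~R) ltr_int => w1.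
  suff -> : w i 0 = 0 by [].
  by apply/eqP; rewrite -absz_eq0 -leqn0 -ltnS -ltz_nat abszE.
have zN k : z (N + k)%N = BR ^+ k *m z N.
  elim: k => [|k IH]; first by rewrite addn0 mul1mx.
  by rewrite addnS zS ?leq_addr// IH mulmxA exprS.
have BRu : BR \in unitmx by rewrite unitmxE det_map_mx rmorph_unit// -unitmxE.
have Xu k : BR ^+ k \in unitmx by rewrite -[_ \in _]/(_ \is a GRing.unit) unitrX.
(* The small lifts are consistent only from time [N] on; [x] traces [z N] back to time 0. *)
pose x := invmx (BR ^+ N) *m z N.
exists x; last first.
  exists N, d => k i Nk; rewrite -(subnK Nk) exprD -mulmxA /x mulKVmx //.
  by rewrite -zN subnKC // ltW//; exact: (zP _ Nk).2.
have [zt _] := zP N (leqnn N); have t0E := tproj_repr t.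
rewrite -t0E iter_toral_map in zt.
have /int_lattice_sub[w wE] := (tproj_eq _ _).1 zt.
rewrite -t0E; apply/tproj_eq/int_lattice_sub; exists (invmx B ^+ N *m w).
apply: (can_inj (mulKmx (Xu N))); rewrite mulmxBr /x mulKVmx // wE map_mxM mulmxA.
have -> : map_mx intr (invmx B ^+ N) = invmx (BR ^+ N).
  rewrite -[invmx (BR ^+ N)]/((BR ^+ N)^-1) -exprVn rmorphXn; congr (_ ^+ _).
  by rewrite -[invmx B]/(B^-1) rmorphV.
by rewrite mulmxV // mul1mx.
Qed.

End ForwardLift.

Lemma zero_ae_preimages (R : realType) (p : nat) (M : 'M[int]_p.+1) (beta : R) :
  (haar R p.+1).-negligible [set 0] -> ae_preimages M beta (0 : torus R p.+1) 0.
Proof.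
apply: negligibleS => x /= H; apply: contrapT => x0; apply: H.
rewrite II0 card_eq0; apply/eqP/seteqP; split => // e [_ /= ex]; apply: x0; rewrite -ex.
have Mk (k : int) : toral_pow M k (0 : torus R p.+1) = 0.
  have it (B : 'M[int]_p.+1) j : iter j (toral_map B) (0 : torus R p.+1) = 0.
    by rewrite -tproj0 iter_toral_map mulmx0.
  by case: k => k; rewrite /toral_pow it.
rewrite /coding (_ : (fun N => _) = (fun=> 0)).
  exact: (cvg_lim (@torus_hausdorff R p.+1) (cvg_cst _)).
by apply/funext => N; rewrite big1 // => k _; rewrite !Mk !mul0rn addr0.
Qed.

(** Two sets of full measure share a point. This lets the values of the form be compared with any
    almost-sure count in the minimum. *)
Lemma ae_preimages_unique (R : realType) (m : nat) (M : 'M[int]_m) (beta : R) t q q' :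
  ae_preimages M beta t q -> ae_preimages M beta t q' -> q = q'.
Proof.
move=> H H'.
have [A [mA A0 sA]] := negligibleU H H'.
have [x Ax] : exists x, ~ A x.
  apply: contrapT => /forallNP nA.
  have AT : A = setT by apply/seteqP; split => // x _; apply: contrapT; exact: nA.
  by have := @probability_setT _ _ _ (haar R m); rewrite -AT A0 => /eqP;
    rewrite eq_sym onee_eq0.
have [Hq Hq'] : (beta_compactum beta `&` coding M t @^-1` [set x] #= `I_q)%card /\
    (beta_compactum beta `&` coding M t @^-1` [set x] #= `I_q')%card.
  by split; apply: contrapT => n; apply/Ax/sA; [left|right].
by apply/card_eq_II; apply: card_eq_trans Hq'; rewrite card_eq_sym.
Qed.

(** * Correspondence of homoclinic points and integer vectors *)

Section Main.
Variables (R : realType) (p : nat) (M : 'M[int]_p.+1) (beta : R).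
Hypotheses (hM : pisot_automorphism M beta) (W : weakly_finitary beta).
Local Notation A := (@map_mx int R intr p.+1 p.+1 M).

Let Mu : M \in unitmx. Proof. by case: hM. Qed.
Let irr : irreducible_poly (map_poly intr (char_poly M) : {poly rat}). Proof. by case: hM. Qed.
Let b1 : 1 < beta. Proof. by case: hM => _ _ []. Qed.

Lemma coding_of_vector (n : 'cV[int]_p.+1) : n != 0 -> exists t : torus R p.+1,
  [/\ homoclinic M t, t <> 0 & ae_preimages M beta t `|assoc_form M n|%N].
Proof.
move=> n0; have dK := det_krylov irr n0.
have [l [v [C [rho [lA ln Av lv [C0 r01 dec]]]]]] := pisot_splitting hM n0.
exists (tproj v); split.
- exact: (homoclinic_v Mu b1 ln Av C0 r01 dec dK).
- exact: (tproj_v_neq0 Mu b1 Av lv).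
rewrite (assoc_form_krylov Mu).
exact: (ae_preimages_krylov Mu b1 lA ln Av lv C0 r01 dec dK W (Zbeta_beta_inv hM)).
Qed.

(** [t] has a lift [s] with bounded forward orbit and a lift [u] with bounded backward orbit, and
    [n = u - s]. Here [u] lies on the expanding line and [s] has coordinate 0, so for nonzero [n]
    the lift [u] has coordinate 1 and equals [v]. *)
Lemma vector_of_homoclinic (t : torus R p.+1) : homoclinic M t ->
  exists n : 'cV[int]_p.+1, ae_preimages M beta t `|assoc_form M n|%N /\ (t <> 0 -> n != 0).
Proof.
move=> [tp tm].
have [s sE sB] := torus_forward_lift Mu tp.
have Viu : invmx M \in unitmx by rewrite unitmx_inv.
have tm' : iter k (toral_map (invmx M)) t @[k --> \oo] --> (0 : torus R p.+1).
  rewrite (_ : (fun k => _) = (fun k : nat => toral_pow M (- k%:Z) t)) //.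
  by apply/funext => -[].
have [u uE uB] := torus_forward_lift Viu tm'.
have VE : map_mx intr (invmx M) = A^-1 :> 'M[R]_p.+1.
  by rewrite -[invmx M]/(M^-1) rmorphV.
rewrite VE in uB.
have /tproj_eq/int_lattice_sub[n nE] : tproj u = tproj s by rewrite uE sE.
have [n0|n0] := eqVneq n 0; last first.
  exists n; split=> // ; have dK := det_krylov irr n0.
  have [l [v [C [rho [lA ln Av lv [C0 r01 dec]]]]]] := pisot_splitting hM n0.
  have us : u = v.
    rewrite (unstable_line Mu lA Av C0 r01 dec uB).
    have -> : lcoord l u = 1.
      rewrite -[u](subrK s) nE lcoordD (stable_lcoord b1 lA sB) addr0.
      exact: lcoordn ln.
    by rewrite scale1r.
  rewrite -uE us (assoc_form_krylov Mu).
  exact: (ae_preimages_krylov Mu b1 lA ln Av lv C0 r01 dec dK W (Zbeta_beta_inv hM)).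
(* For [n = 0] any nonzero vector supplies a splitting; it shows that [u], with coordinate 0 on the
   expanding line, vanishes. *)
pose n1 : 'cV[int]_p.+1 := \col_i 1.
have n10 : n1 != 0.
  by apply/eqP => /matrixP /(_ 0 0); rewrite !mxE.
have [l [v [C [rho [lA ln Av lv [C0 r01 dec]]]]]] := pisot_splitting hM n10.
have t0 : t = 0.
  rewrite -uE (unstable_line Mu lA Av C0 r01 dec uB).
  have -> : lcoord l u = 0.
    rewrite -[u](subrK s) nE n0 lcoordD (stable_lcoord b1 lA sB) addr0.
    by rewrite /lcoord map_mx0 mulmx0 mxE.
  by rewrite scale0r tproj0.
exists 0; split=> //; rewrite t0 (assoc_form_krylov Mu).
have -> : \det (krylov M 0) = 0.
  rewrite (expand_det_row _ ord0) big1 // => j _.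
  by rewrite [krylov _ _ _ _]mxE mulmx0 mxE mul0r.
exact: (zero_ae_preimages _ _ (haar_zero_negligible lv)).
Qed.

End Main.

Theorem proposition26 (R : realType) (m : nat) (M : 'M[int]_m) (beta : R)
    (hM : pisot_automorphism M beta) (hbeta : weakly_finitary beta) :
  (forall t : torus R m, homoclinic M t ->
     exists n : 'cV[int]_m, ae_preimages M beta t `|assoc_form M n|%N) /\
  (exists p : nat,
     is_min [set q | exists t : torus R m,
       [/\ homoclinic M t, t <> 0 & ae_preimages M beta t q]] p /\
     is_min [set `|assoc_form M n|%N | n in [set n : 'cV[int]_m | n <> 0]] p).
Proof.
case: m M hM => [|p] M hM.
  (* In dimension 0 the characteristic polynomial is 1, which is not irreducible. *)
  by case: hM => _ [+ _] _ _; rewrite /char_poly det_mx00 rmorph1 size_poly1.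
split=> [t /(vector_of_homoclinic hM hbeta)[n [H _]]|]; first by exists n.
pose S := [set `|assoc_form M n|%N | n in [set n : 'cV[int]_p.+1 | n <> 0]].
have Sex : exists q, `[< S q >].
  pose n1 : 'cV[int]_p.+1 := \col_i 1.
  exists (absz (assoc_form M n1)); apply/asboolP; exists n1 => //=.
  by move/matrixP => /(_ 0 0); rewrite !mxE.
case: (ex_minnP Sex) => q /asboolP[n n0 nq] qmin; exists q.
have Smin r : S r -> (q <= r)%N by move=> /asboolP; exact: qmin.
have n0' : n != 0 by apply/eqP.
split; split; [| |by exists n|exact: Smin].
  by have [t tP] := coding_of_vector hM hbeta n0'; exists t; rewrite -nq.
move=> r [t [ht t0 tr]]; have [n' [tn' /(_ t0) n'0]] := vector_of_homoclinic hM hbeta ht.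
by rewrite (ae_preimages_unique tr tn'); apply: Smin; exists n' => //; exact/eqP.
Qed.
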